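(* There exists $\alpha=\alpha(d)\in(0,\theta(d))$ with $$\alpha(d)=(1+o_d(1))\,\frac{\log(2/\sqrt3)\cdot d}{2^d}$$ such that the entropy density of sphere packings of $\mathbb{R}^d$ at density $\alpha$ satisfies $$f_d(\alpha)\ \ge\ -(1+o_d(1))\,\log(2/\sqrt3)\cdot d,$$ where each $o_d(1)$ denotes a quantity tending to $0$ as $d\to\infty$.
   Context: $\log$ is the natural logarithm and $d(x,y)$ is Euclidean distance. The sphere packing density of $\mathbb{R}^d$ is $$\theta(d)=\sup_{\mathcal{P}}\ \limsup_{R\to\infty}\frac{\mathrm{vol}(\mathcal{P}\cap B_R(0))}{\mathrm{vol}(B_R(0))},$$ where the supremum is over all packings $\mathcal{P}$ of $\mathbb{R}^d$ by equal-sized (non-overlapping) spheres, $B_R(0)$ is the closed ball of radius $R$ around $0$, and $\mathrm{vol}(\mathcal{P}\cap B_R(0))$ is the volume of the part of $B_R(0)$ covered by the spheres (solid balls) of the packing. Let $r_d$ be the radius of a ball of volume $1$ in $\mathbb{R}^d$. For a bounded, measurable set $S\subset\mathbb{R}^d$ put $\hat Z_S(0)=1$ and, for $k\ge1$, $$\hat Z_S(k)=\frac{1}{k!}\int_{S^k}\mathbf{1}\{d(x_i,x_j)>2r_d\ \text{for all } i\neq j\}\,dx_1\cdots dx_k .$$ Let $B_n$ be the ball of volume $n$ centered at the origin in $\mathbb{R}^d$. The entropy density of sphere packings of $\mathbb{R}^d$ at density $\alpha\in(0,\theta(d))$ is $$f_d(\alpha)=\lim_{n\to\infty}\frac{1}{\alpha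 n}\log\frac{\hat Z_{B_n}(\lfloor\alpha n\rfloor)}{n^{\lfloor\alpha n\rfloor}/(\lfloor\alpha n\rfloor)!}$$ (the limit exists, by subadditivity). *)

(* Defs.v *)
From HB Require Import structures.
From mathcomp Require Import all_boot all_order all_algebra.
From mathcomp Require Import all_classical all_reals all_analysis.

Set Implicit Arguments.
Unset Strict Implicit.
Unset Printing Implicit Defensive.

Import Order.TTheory GRing.Theory Num.Theory.
Import numFieldNormedType.Exports.

Local Open Scope classical_set_scope.
Local Open Scope ring_scope.

(* The n-fold product measure on [n.-tuple T]: [tuple_measure mu n.+1] is the
   image of [mu \x tuple_measure mu n] under [(x, t) |-> x :: t].  The lemma
   [tuple_measureX] below checks it on boxes. *)
Section tuple_measure.
Local Open Scope ereal_scope.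
Context {dp : measure_display} {T : measurableType dp} {R : realType}.

Definition consp n (p : T * n.-tuple T) : n.+1.-tuple T :=
  [tuple of p.1 :: p.2].

Lemma measurable_consp n : measurable_fun setT (@consp n).
Proof. exact: measurable_cons. Qed.

Variable mu : {sigma_finite_measure set T -> \bar R}.

Section cons_measure.
Variables (n : nat) (nu : {sigma_finite_measure set (n.-tuple T) -> \bar R}).

Definition cons_measure : set (n.+1.-tuple T) -> \bar R :=
  pushforward (mu \x nu) (@consp n).

Let m : {measure set (n.+1.-tuple T) -> \bar R} :=
  measure_function_pushforward__canonical__measure_function_Measure
    (mu \x nu) (@measurable_consp n).

Let cons_measure0 : cons_measure set0 = 0.
Proof. exact: (measure0 m). Qed.

Let cons_measure_ge0 A : 0 <= cons_measure A.
Proof. exact: (measure_ge0 m). Qed.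

Let cons_measure_sigma_additive : semi_sigma_additive cons_measure.
Proof. exact: (@measure_semi_sigma_additive _ _ _ m). Qed.

HB.instance Definition _ := isMeasure.Build _ _ _ cons_measure
  cons_measure0 cons_measure_ge0 cons_measure_sigma_additive.

Let cons_measure_sigma_finite : sigma_finite setT cons_measure.
Proof.
have /sigma_finiteP[F [TF ndF Foo]] := sigma_finiteT mu.
have /sigma_finiteP[G [TG ndG Goo]] := sigma_finiteT nu.
exists (fun k => (fun t : n.+1.-tuple T => tnth t ord0) @^-1` F k `&`
    (fun t : n.+1.-tuple T => [tuple of behead t]) @^-1` G k).
  apply/seteqP; split => // t _.
  have : setT (tnth t ord0) by [].
  have : setT [tuple of behead t] by [].
  rewrite TF TG => -[k _ Gk] [l _ Fl]; exists (maxn k l) => //; split => /=.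
  - by move: Fl; exact/subsetPset/ndF/leq_maxr.
  - by move: Gk; exact/subsetPset/ndG/leq_maxl.
move=> k; have [mFk Fkoo] := Foo k; have [mGk Gkoo] := Goo k; split.
  apply: measurableI; rewrite -[X in measurable X]setTI.
  - exact: measurable_tnth.
  - exact: measurable_behead.
rewrite /cons_measure /pushforward /=.
rewrite (_ : _ @^-1` _ = F k `*` G k).
  by rewrite product_measure1E// lte_mul_pinfty// ge0_fin_numE.
have bE (p : T * n.-tuple T) : [tuple of behead (consp p)] = p.2.
  exact: val_inj.
by apply/seteqP; split => -[x t] /=; rewrite bE.
Qed.

HB.instance Definition _ := Measure_isSigmaFinite.Build _ _ _ cons_measure
  cons_measure_sigma_finite.

End cons_measure.

Fixpoint tuple_measure n : {sigma_finite_measure set (n.-tuple T) -> \bar R} :=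
  match n with
  | 0 => \d_([tuple] : 0.-tuple T)
  | n'.+1 => cons_measure (tuple_measure n')
  end.

Lemma tuple_measureX n (A : 'I_n -> set T) : (forall i, measurable (A i)) ->
  tuple_measure n [set t | forall i, A i (tnth t i)] = \prod_(i < n) mu (A i).
Proof.
elim: n A => [|n IH] A mA /=.
  rewrite big_ord0 /dirac indicE mem_set//= => -[].
  by [].
rewrite big_ord_recl /cons_measure /pushforward.
have mS : measurable [set t : n.-tuple T | forall i, A (lift ord0 i) (tnth t i)].
  rewrite (_ : [set _ | _] =
      \bigcap_(i in [set: 'I_n]) ((fun t => tnth t i) @^-1` A (lift ord0 i))).
    apply: fin_bigcap_measurable => // i _.
    by rewrite -[X in measurable X]setTI; exact: measurable_tnth.
  by apply/seteqP; split=> t /= h i; [move=> _|]; exact: h.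
rewrite -(IH (fun i => A (lift ord0 i)))//.
rewrite -product_measure1E//; congr product_measure1.
apply/seteqP; split => -[x t] /=.
  move=> h; split; first by have := h ord0; rewrite (tnth_nth x).
  by move=> i; have := h (lift ord0 i); rewrite /consp !(tnth_nth x).
move=> [h0 h] i; case: (unliftP ord0 i) => [j ->|->].
  by have := h j; rewrite /consp !(tnth_nth x).
by rewrite (tnth_nth x).
Qed.

End tuple_measure.

Section sphere_packings.
Context {R : realType}.

Local Notation Rn d := (d.-tuple (measurableTypeR R)).

Definition eucl_dist d (x y : Rn d) : R :=
  Num.sqrt (\sum_(i < d) (tnth x i - tnth y i) ^+ 2).

Definition origin d : Rn d := [tuple 0 | i < d].

Definition eucl_cball d (x : Rn d) (r : R) : set (Rn d) :=
  [set y | eucl_dist x y <= r].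

Definition eucl_oball d (x : Rn d) (r : R) : set (Rn d) :=
  [set y | eucl_dist x y < r].

Definition vol d : {sigma_finite_measure set (Rn d) -> \bar R} :=
  tuple_measure (@lebesgue_measure R) d.

(* For d > 0 and v >= 0 there is exactly one such radius. *)
Definition ball_radius d (v : R) : R :=
  xget 0 [set r | 0 <= r /\ vol d (eucl_cball (origin d) r) = v%:E].

(* Spheres may touch, so only the open balls have to be disjoint. *)
Definition sphere_packing d (r : R) (C : set (Rn d)) : Prop :=
  0 < r /\ trivIset C (fun c => eucl_oball c r).

Definition covered d (r : R) (C : set (Rn d)) : set (Rn d) :=
  \bigcup_(c in C) eucl_cball c r.

Definition packing_density d (r : R) (C : set (Rn d)) : \bar R :=
  limf_esup (fun s : R =>
    vol d (covered r C `&` eucl_cball (origin d) s) /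
    vol d (eucl_cball (origin d) s))%E +oo.

Definition theta d : \bar R :=
  ereal_sup [set packing_density p.1 p.2 |
             p in [set p : R * set (Rn d) | sphere_packing p.1 p.2]].

Definition hard_core d k : set (k.-tuple (Rn d)) :=
  [set x | forall i j : 'I_k, i != j ->
           2 * ball_radius d 1 < eucl_dist (tnth x i) (tnth x j)].

Definition Zhat d (S : set (Rn d)) (k : nat) : \bar R :=
  if k == 0%N then 1%E else
  ((k`!%:R^-1)%:E *
   \int[tuple_measure (vol d) k]_(x in [set x | forall i, S (tnth x i)])
     (\1_(@hard_core d k) x)%:E)%E.

Definition vol_ball d (n : nat) : set (Rn d) :=
  eucl_cball (origin d) (ball_radius d n%:R).

(* Extended-real valued, since [Zhat] may vanish and then its logarithm
   is [-oo]. *)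
Definition entropy_seq d (a : R) (n : nat) : \bar R :=
  let k := Num.truncn (a * n%:R) in
  (((a * n%:R)^-1)%:E *
   lne (Zhat (@vol_ball d n) k * ((n%:R ^+ k / k`!%:R)^-1)%:E))%E.

Definition entropy_density d (a : R) : \bar R :=
  limn (entropy_seq d a).

End sphere_packings.

(* Main.v *)
Require Import Defs.
From HB Require Import structures.
From mathcomp Require Import all_boot all_order all_algebra.
From mathcomp Require Import all_classical all_reals all_analysis.
From mathcomp Require Import measurable_realfun ring lra.

Set Implicit Arguments.
Unset Strict Implicit.
Unset Printing Implicit Defensive.

Import Order.TTheory GRing.Theory Num.Theory.
Import numFieldNormedType.Exports.

Local Open Scope classical_set_scope.
Local Open Scope ring_scope.

(** Occupancy method.  In a grand-canonical hard-sphere gas of fugacity [lam],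
    condition on the configuration outside the ball [B] of radius [2 r] around a
    point [v], and let [Z] be the partition function of what is left uncovered
    in [B].  The probability that [v] is free is the mean of [1 / Z], and the
    number of points in [B] has mean at least the mean of [exp(-q) t], where [t] is
    [lam] times the uncovered volume, so that [Z <= exp t], and
    [q = 2 lam 3^(d/2)] bounds [lam] times the part of the uncovered set that a
    uniform point of it excludes on average.
    Balancing both against the density of points, with the tangent to [exp] at
    [y], gives density at least [a = (1 + y) / (exp y / lam + 2^d exp q)], which is
    [(1 + o(1)) ln (2 / sqrt 3) d / 2^d] for [lam = 3^(-d/2) / d].

    For the entropy, some number [k] of points with [k >= a V - 1] satisfies
    [lam^k Zhat(k) >= 1 / poly(V)] in a cube of volume [V].  Filling a ball with
    such cubes and with empty ones bounds the entropy density at any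
    [alpha < a] below by [ln alpha - 1 - ln lam].  Comparing balls with cubes
    both ways (cubes inside a ball, and a ball inside a large cube whose rest is
    filled with near-optimal cubes) shows that the limit exists, and repeating a
    configuration of one cube periodically shows [alpha < theta]. *)

(** * The hard-core gas on a measure space *)

(** The constant comes from the two terms in the denominator of [a]. The fugacity [3^(-d/2) / d] is
    small enough that [q = 2 / d] vanishes, so [2^d exp q] is essentially [2^d]; then [y] may grow
    until [exp y / lam] is comparable with [2^d], that is up to about [d ln (2 / sqrt 3)], and [a]
    is about [y / 2^d]. The entropy has the same constant because [ln alpha - ln lam] is
    [- d ln 2 + (d / 2) ln 3] up to logarithms of [d]. The obstacle is that the entropy fixes the
    number of points, while occupancy controls a mean over all numbers. So the comparisons work with
    cubes whose count strictly exceeds [alpha] times their volume; this surplus pays for gaps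
    between cubes, boundary layers and rounding, and makes [alpha < theta] strict. No conditional
    probability is formed. A configuration outside acts by cutting down the activity, so each
    conditional statement is an inequality between nonnegative functionals, proved for all
    activities below a given one and then integrated over the outside points. *)

Lemma sum_exp_coeff_le (R : realType) (x : R) n : 0 <= x ->
  \sum_(m < n) (m`!%:R^-1 * x ^+ m) <= expR x.
Proof.
move=> x0; rewrite /expR.
have -> : \sum_(m < n) (m`!%:R^-1 * x ^+ m) = series (exp_coeff x) n.
  by rewrite /series/= big_mkord; apply: eq_bigr => i _; rewrite /exp_coeff/= mulrC.
apply: nondecreasing_cvgn_le; last exact: is_cvg_series_exp_coeff.
apply/nondecreasing_seqP => m; rewrite /series/= big_nat_recr//= lerDl.
by rewrite divr_ge0// exprn_ge0.
Qed.

Section hard_core_gas.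
Local Open Scope ereal_scope.
Context {dp : measure_display} {T : measurableType dp} {R : realType}.
Variable mu : {sigma_finite_measure set T -> \bar R}.
Variable far : rel T.
Hypothesis mfar : measurable_fun setT (fun p : T * T => (far p.1 p.2)%:R : R).
Hypothesis far_sym : symmetric far.

Implicit Types (phi psi chi : T -> R).

(** A fugacity times the indicator of a region is an activity, and so is what other points leave of
    it: [cut phi x] is [phi] after a point has been placed at [x]. *)
Definition activity phi := measurable_fun setT phi /\ forall x, (0 <= phi x)%R.

Definition cut phi x : T -> R := fun y => (phi y * (far x y)%:R)%R.

(** Places [m] mutually far points with weight [phi] and evaluates [F] at what they leave of a
    second activity [psi]. Cutting both activities at each point encodes the hard core without
    tuples. *)
Fixpoint jint m (F : (T -> R) -> \bar R) phi psi : \bar R :=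
  if m is m'.+1
  then \int[mu]_x ((phi x)%:E * jint m' F (cut phi x) (cut psi x))
  else F psi.

Definition wint k phi := jint k (fun=> 1) phi phi.

(** Measurability is required jointly with a parameter from an arbitrary space, since each integral
    in [jint] adds its variable to the parameters: the induction of [measurable_jint] passes from
    [T'] to [T' * T]. *)
Definition measurable_functional (F : (T -> R) -> \bar R) :=
  (forall psi, activity psi -> 0 <= F psi) /\
  forall d' (T' : measurableType d') (Psi : T' * T -> R),
    measurable_fun setT Psi -> (forall p, (0 <= Psi p)%R) ->
    measurable_fun setT (fun p => F (fun y => Psi (p, y))).

Lemma measurable_far_pair d' (T' : measurableType d') (f g : T' -> T) :
  measurable_fun setT f -> measurable_fun setT g ->
  measurable_fun setT (fun p => (far (f p) (g p))%:R : R).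
Proof.
move=> mf mg; exact: (measurableT_comp mfar (measurable_fun_pair mf mg)).
Qed.

Lemma measurable_far x : measurable_fun setT (fun y => (far x y)%:R : R).
Proof. exact: measurable_far_pair. Qed.

Lemma activity_cut phi x : activity phi -> activity (cut phi x).
Proof.
move=> [mphi phi0]; split=> [|y]; last by rewrite mulr_ge0.
by apply: measurable_funM => //; exact: measurable_far.
Qed.

Lemma activityD phi psi : activity phi -> activity psi ->
  activity (phi \+ psi)%R.
Proof.
move=> [mphi phi0] [mpsi psi0]; split=> [|y]; last by rewrite addr_ge0.
exact: measurable_funD.
Qed.

Lemma cutD phi psi x : cut (phi \+ psi)%R x = (cut phi x \+ cut psi x)%R.
Proof. by apply/funext => y; rewrite /cut/= mulrDl. Qed.

Lemma cutC phi x y : cut (cut phi x) y = cut (cut phi y) x.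
Proof. by apply/funext => z; rewrite /cut/= mulrAC. Qed.

Lemma le_cut phi x y : (0 <= phi y)%R -> (cut phi x y <= phi y)%R.
Proof. by move=> ?; rewrite /cut; case: (far x y); rewrite ?mulr1// mulr0. Qed.

Lemma jint_ge0 F m phi psi : measurable_functional F ->
  activity phi -> activity psi -> 0 <= jint m F phi psi.
Proof.
move=> [F0 _]; elim: m phi psi => [|m IH] phi psi aphi apsi /=; first exact: F0.
apply: integral_ge0 => x _; apply: mule_ge0.
  by rewrite lee_fin; case: aphi.
by apply: IH; exact: activity_cut.
Qed.

Let measurable_cut2 d' (T' : measurableType d') (Psi : T' * T -> R) :
  measurable_fun setT Psi ->
  measurable_fun setT (fun q : (T' * T) * T =>
    (Psi (q.1.1, q.2) * (far q.1.2 q.2)%:R)%R).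
Proof.
move=> mP.
have m11 : measurable_fun setT (fun q : (T' * T) * T => q.1.1).
  exact: (measurableT_comp measurable_fst measurable_fst).
have m12 : measurable_fun setT (fun q : (T' * T) * T => q.1.2).
  exact: (measurableT_comp measurable_snd measurable_fst).
apply: measurable_funM; last exact: measurable_far_pair.
exact: (measurableT_comp mP (measurable_fun_pair m11 measurable_snd)).
Qed.

Lemma measurable_jint F m d' (T' : measurableType d') (Phi Psi : T' * T -> R) :
  measurable_functional F ->
  measurable_fun setT Phi -> (forall p, (0 <= Phi p)%R) ->
  measurable_fun setT Psi -> (forall p, (0 <= Psi p)%R) ->
  measurable_fun setT
    (fun p => jint m F (fun y => Phi (p, y)) (fun y => Psi (p, y))).
Proof.
move=> mF; elim: m d' T' Phi Psi => [|m IH] d' T' Phi Psi mPhi Phi0 mPsi Psi0 /=.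
  exact: mF.2.
pose f (q : T' * T) := (Phi q)%:E *
  jint m F (cut (fun y => Phi (q.1, y)) q.2) (cut (fun y => Psi (q.1, y)) q.2).
rewrite (_ : (fun p => _) = (fun p => \int[mu]_x f (p, x))); last first.
  by apply/funext => p; apply: eq_integral.
apply: (measurable_fun_fubini_tonelli_F f) => [|q].
  apply: emeasurable_funM; first exact/measurable_EFinP.
  apply: (IH _ _ (fun q : (T' * T) * T => (Phi (q.1.1, q.2) * (far q.1.2 q.2)%:R)%R)
   (fun q : (T' * T) * T => (Psi (q.1.1, q.2) * (far q.1.2 q.2)%:R)%R)).
  - exact: measurable_cut2.
  - by move=> p; rewrite mulr_ge0.
  - exact: measurable_cut2.
  - by move=> p; rewrite mulr_ge0.
have sectionP (P : T' * T -> R) : measurable_fun setT P -> (forall p, (0 <= P p)%R) ->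
    activity (fun y => P (q.1, y)).
  by move=> mP P0; split => //; exact: measurableT_comp.
apply: mule_ge0; rewrite ?lee_fin//.
by apply: jint_ge0 => //; apply: activity_cut; exact: sectionP.
Qed.

Let measurable_cut phi : activity phi ->
  measurable_fun setT (fun q : T * T => (phi q.2 * (far q.1 q.2)%:R)%R).
Proof.
move=> [mphi _]; apply: measurable_funM => //.
exact: (measurableT_comp mphi measurable_snd).
Qed.

Let cut_ge0 phi (aphi : activity phi) (q : T * T) :
  (0 <= phi q.2 * (far q.1 q.2)%:R)%R.
Proof. by rewrite mulr_ge0//; case: aphi. Qed.

Lemma measurable_jint_cut F m chi phi psi : measurable_functional F ->
  activity chi -> activity phi -> activity psi ->
  measurable_fun setT
    (fun x => (chi x)%:E * jint m F (cut phi x) (cut psi x)).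
Proof.
move=> mF achi aphi apsi; apply: emeasurable_funM.
  by apply/measurable_EFinP; case: achi.
exact: (measurable_jint m mF (measurable_cut aphi) (cut_ge0 aphi)
  (measurable_cut apsi) (cut_ge0 apsi)).
Qed.

Lemma jint_cut_ge0 F m chi phi psi x : measurable_functional F ->
  activity chi -> activity phi -> activity psi ->
  0 <= (chi x)%:E * jint m F (cut phi x) (cut psi x).
Proof.
move=> mF [_ chi0] aphi apsi; apply: mule_ge0; first by rewrite lee_fin.
by apply: jint_ge0 => //; exact: activity_cut.
Qed.

Lemma measurable_functional_cst (c : R) : (0 <= c)%R ->
  measurable_functional (fun=> c%:E).
Proof. by move=> c0; split => *; [rewrite lee_fin|exact: measurable_cst]. Qed.

Lemma measurable_functional_wint k : measurable_functional (wint k).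
Proof.
have m1 := measurable_functional_cst ler01.
by split=> *; [exact: jint_ge0|exact: measurable_jint].
Qed.

Lemma measurable_functionalM (c : R) F : (0 <= c)%R ->
  measurable_functional F -> measurable_functional (fun psi => c%:E * F psi).
Proof.
move=> c0 [F0 mF]; split=> [psi apsi|d' T' Psi mPsi Psi0].
  by apply: mule_ge0; [rewrite lee_fin|exact: F0].
by apply: measurable_funeM; exact: mF.
Qed.

Lemma measurable_functionalD F G : measurable_functional F ->
  measurable_functional G -> measurable_functional (fun psi => F psi + G psi).
Proof.
move=> [F0 mF] [G0 mG]; split=> [psi apsi|d' T' Psi mPsi Psi0].
  by apply: adde_ge0; [exact: F0|exact: G0].
by apply: emeasurable_funD; [exact: mF|exact: mG].
Qed.

Lemma measurable_functional_sum n (F : 'I_n -> (T -> R) -> \bar R) :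
  (forall i, measurable_functional (F i)) ->
  measurable_functional (fun psi => \sum_(i < n) F i psi).
Proof.
move=> mF; split=> [psi apsi|d' T' Psi mPsi Psi0].
  by apply: sume_ge0 => i _; exact: (mF i).1.
by apply: emeasurable_sum => i; exact: (mF i).2.
Qed.

(** Weighs a configuration together with one marked point of it. For a partition function this is
    the unnormalised mean number of points, as in the Mecke formula; see [insert_Zsum]. *)
Definition insert F phi := \int[mu]_x ((phi x)%:E * F (cut phi x)).

Lemma measurable_functional_insert F : measurable_functional F ->
  measurable_functional (insert F).
Proof.
move=> mF; split=> [psi apsi|d' T' Psi mPsi Psi0].
  exact: (@jint_ge0 F 1 psi psi).
exact: (@measurable_jint F 1 d' T' Psi Psi).
Qed.

Lemma jintD F G m phi psi : measurable_functional F -> measurable_functional G ->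
  activity phi -> activity psi ->
  jint m (fun chi => F chi + G chi) phi psi = jint m F phi psi + jint m G phi psi.
Proof.
move=> mF mG; elim: m phi psi => [//|m IH] phi psi aphi apsi /=.
rewrite -ge0_integralD//; last 4 first.
- by move=> x _; exact: jint_cut_ge0.
- exact: measurable_jint_cut.
- by move=> x _; exact: jint_cut_ge0.
- exact: measurable_jint_cut.
apply: eq_integral => x _; rewrite IH; [|exact: activity_cut..].
by rewrite ge0_muleDr// jint_ge0//; exact: activity_cut.
Qed.

Lemma jintM F m phi psi (c : R) : measurable_functional F -> (0 <= c)%R ->
  activity phi -> activity psi ->
  jint m (fun chi => c%:E * F chi) phi psi = c%:E * jint m F phi psi.
Proof.
move=> mF c0; elim: m phi psi => [//|m IH] phi psi aphi apsi /=.
rewrite -ge0_integralZl//; last 2 first.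
- exact: measurable_jint_cut.
- by move=> x _; exact: jint_cut_ge0.
by apply: eq_integral => x _; rewrite IH; [rewrite muleCA|exact: activity_cut..].
Qed.

Lemma jint0 m phi psi : jint m (fun=> 0) phi psi = 0.
Proof.
elim: m phi psi => [//|m IH] phi psi /=.
by apply: integral0_eq => x _; rewrite IH mule0.
Qed.

Lemma jint_sum n (F : 'I_n -> (T -> R) -> \bar R) m phi psi :
  (forall i, measurable_functional (F i)) -> activity phi -> activity psi ->
  jint m (fun chi => \sum_(i < n) F i chi) phi psi =
  \sum_(i < n) jint m (F i) phi psi.
Proof.
move=> mF aphi apsi; elim: n F mF => [|n IH] F mF.
  rewrite big_ord0 -[RHS](jint0 m phi psi); congr (jint m _ phi psi).
  by apply/funext => chi; rewrite big_ord0.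
rewrite big_ord_recl -IH// -jintD//; last exact: measurable_functional_sum.
by congr (jint m _ phi psi); apply/funext => chi; rewrite big_ord_recl.
Qed.

Lemma le_jint F G m phi psi : measurable_functional F ->
  measurable_functional G -> activity phi -> activity psi ->
  (forall chi, activity chi -> (forall x, (chi x <= psi x)%R) ->
    F chi <= G chi) ->
  jint m F phi psi <= jint m G phi psi.
Proof.
move=> mF mG; elim: m phi psi => [|m IH] phi psi aphi apsi FG /=; first exact: FG.
apply: ge0_le_integral => //.
- by move=> x _; exact: jint_cut_ge0.
- exact: measurable_jint_cut.
- exact: measurable_jint_cut.
move=> x _; apply: lee_wpmul2l; first by rewrite lee_fin; case: aphi.
apply: IH => [| |chi achi chipsi]; [exact: activity_cut..|].
apply: FG => // y; apply: (le_trans (chipsi y)).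
by apply: le_cut; case: apsi.
Qed.

(** By Tonelli, the [psi]-point placed before the [phi]-points may be placed after them: symmetry of
    [far] exchanges the cuts that the two kinds of points inflict on each other. *)
Lemma jint_swap F m phi psi : measurable_functional F ->
  activity phi -> activity psi ->
  \int[mu]_x ((psi x)%:E * jint m F (cut phi x) (cut psi x)) =
  jint m (insert F) phi psi.
Proof.
move=> mF; elim: m phi psi => [//|m IH] phi psi aphi apsi /=.
pose f (q : T * T) := ((psi q.1 * (phi q.2 * (far q.1 q.2)%:R))%:E *
  jint m F (cut (cut phi q.1) q.2) (cut (cut psi q.1) q.2)).
transitivity (\int[mu]_x \int[mu]_y f (x, y)).
  apply: eq_integral => x _; rewrite -ge0_integralZl//.
  - by apply: eq_integral => y _; rewrite /f/= EFinM muleA.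
  - by apply: measurable_jint_cut => //; exact: activity_cut.
  - by move=> y _; apply: jint_cut_ge0 => //; exact: activity_cut.
  - by rewrite lee_fin; case: apsi.
have mcc chi : activity chi -> measurable_fun setT (fun q : (T * T) * T =>
    (chi q.2 * (far q.1.1 q.2)%:R * (far q.1.2 q.2)%:R)%R).
  move=> [mchi chi0]; have m11 : measurable_fun setT (fun q : (T * T) * T => q.1.1).
    exact: (measurableT_comp measurable_fst measurable_fst).
  have m12 : measurable_fun setT (fun q : (T * T) * T => q.1.2).
    exact: (measurableT_comp measurable_snd measurable_fst).
  apply: measurable_funM; last exact: measurable_far_pair.
  apply: measurable_funM; last exact: measurable_far_pair.
  exact: (measurableT_comp mchi measurable_snd).
rewrite (fubini_tonelli f).
- apply: eq_integral => y _ /=.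
  rewrite -IH; [|exact: activity_cut..].
  rewrite -ge0_integralZl//.
  + apply: eq_integral => x _; rewrite /f/= (cutC phi) (cutC psi) [far x y]far_sym.
    by rewrite mulrC -mulrA EFinM muleA (mulrC _ (psi x)).
  + apply: measurable_jint_cut => //; exact: activity_cut.
  + by move=> x _; apply: jint_cut_ge0 => //; exact: activity_cut.
  + by rewrite lee_fin; case: aphi.
- apply: emeasurable_funM.
    apply/measurable_EFinP; apply: measurable_funM; last exact: measurable_cut.
    by case: apsi => mpsi _; exact: (measurableT_comp mpsi measurable_fst).
  apply: (measurable_jint m mF (mcc _ aphi) _ (mcc _ apsi)) => p.
    by rewrite !mulr_ge0//; case: aphi.
  by rewrite !mulr_ge0//; case: apsi.
- move=> q; apply: mule_ge0.
    by rewrite lee_fin !mulr_ge0//; [case: apsi|case: aphi].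
  by apply: jint_ge0 => //; do 2 apply: activity_cut.
Qed.

Lemma wintS k phi :
  wint k.+1 phi = \int[mu]_x ((phi x)%:E * wint k (cut phi x)).
Proof. by []. Qed.

Lemma jint_cst1 m phi psi : jint m (fun=> 1) phi psi = wint m phi.
Proof.
rewrite /wint; move: {3}phi => psi'; elim: m phi psi psi' => [//|m IH] phi psi psi' /=.
by apply: eq_integral => x _; rewrite (IH _ _ (cut psi' x)).
Qed.

Lemma wint_ge0 k phi : activity phi -> 0 <= wint k phi.
Proof. exact: (measurable_functional_wint k).1. Qed.

(** Each of the [k] points is charged to [phi] or to [psi]. The induction splits on the first point;
    [jint_swap] moves a first point of [psi] behind those of [phi], and Pascal's rule adds up the
    two cases. *)
Lemma wintD k phi psi : activity phi -> activity psi ->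
  wint k (phi \+ psi)%R =
  \sum_(m < k.+1) 'C(k, m)%:R%:E * jint m (wint (k - m)) phi psi.
Proof.
elim: k phi psi => [|k IH] phi psi aphi apsi.
  by rewrite big_ord1/= bin0 mul1e.
pose A m := jint m (wint (k.+1 - m)) phi psi.
have A0 m : 0 <= A m by apply: jint_ge0 => //; exact: measurable_functional_wint.
have mw l : measurable_functional (wint l) by exact: measurable_functional_wint.
pose S (chi : T -> R) (x : T) := \sum_(m < k.+1) 'C(k, m)%:R%:E * ((chi x)%:E *
  jint m (wint (k - m)) (cut phi x) (cut psi x)).
have S0 chi x : activity chi -> 0 <= S chi x.
  move=> achi; apply: sume_ge0 => m _; apply: mule_ge0; first by rewrite lee_fin.
  exact: jint_cut_ge0.
have mS chi : activity chi -> measurable_fun setT (S chi).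
  move=> achi; apply: emeasurable_sum => m; apply: measurable_funeM.
  exact: measurable_jint_cut.
have intS chi : activity chi -> \int[mu]_x S chi x = \sum_(m < k.+1) 'C(k, m)%:R%:E *
    \int[mu]_x ((chi x)%:E * jint m (wint (k - m)) (cut phi x) (cut psi x)).
  move=> achi; rewrite ge0_integral_sum//.
  - apply: eq_bigr => m _; rewrite ge0_integralZl// ?lee_fin//.
      exact: measurable_jint_cut.
    by move=> x _; exact: jint_cut_ge0.
  - by move=> m; apply: measurable_funeM; exact: measurable_jint_cut.
  - by move=> m x _; apply: mule_ge0; [rewrite lee_fin|exact: jint_cut_ge0].
have -> : wint k.+1 (phi \+ psi)%R = \int[mu]_x (S phi x + S psi x).
  rewrite wintS; apply: eq_integral => x _.
  rewrite cutD IH; [|exact: activity_cut..].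
  rewrite EFinD ge0_muleDl ?lee_fin; [|by case: aphi|by case: apsi].
  have sM chi : activity chi -> (chi x)%:E * (\sum_(m < k.+1) 'C(k, m)%:R%:E *
      jint m (wint (k - m)) (cut phi x) (cut psi x)) = S chi x.
    move=> achi; rewrite ge0_sume_distrr.
      by apply: eq_bigr => m _; rewrite muleCA.
    move=> m _; apply: mule_ge0; first by rewrite lee_fin.
    by apply: jint_ge0 => //; exact: activity_cut.
  by rewrite !sM.
rewrite ge0_integralD//; last 4 first.
- by move=> x _; exact: S0.
- exact: mS.
- by move=> x _; exact: S0.
- exact: mS.
rewrite !intS//.
have -> : \sum_(m < k.+1) 'C(k, m)%:R%:E *
    \int[mu]_x ((phi x)%:E * jint m (wint (k - m)) (cut phi x) (cut psi x)) =
    \sum_(m < k.+1) 'C(k, m)%:R%:E * A m.+1.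
  by apply: eq_bigr => m _; rewrite /A subSS.
have -> : \sum_(m < k.+1) 'C(k, m)%:R%:E *
    \int[mu]_x ((psi x)%:E * jint m (wint (k - m)) (cut phi x) (cut psi x)) =
    \sum_(m < k.+1) 'C(k, m)%:R%:E * A m.
  apply: eq_bigr => m _; rewrite jint_swap// /A.
  by rewrite subSn// -ltnS.
rewrite [RHS]big_ord_recl/=.
have -> : \sum_(i < k.+1) 'C(k.+1, bump 0 i)%:R%:E * jint (bump 0 i)
    (wint (k.+1 - bump 0 i)) phi psi =
    \sum_(m < k.+1) 'C(k, m.+1)%:R%:E * A m.+1 + \sum_(m < k.+1) 'C(k, m)%:R%:E * A m.+1.
  rewrite -big_split/=; apply: eq_bigr => m _.
  rewrite /bump/= add1n binS natrD EFinD ge0_muleDl ?lee_fin//.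
rewrite addeA [RHS]addeC; congr (_ + _).
rewrite big_ord_recl/= bin0 -/(A 0%N) bin0; congr (_ + _).
rewrite [RHS]big_ord_recr/= bin_small// mul0e adde0.
by apply: eq_bigr.
Qed.


Lemma le_wint k phi psi : activity phi -> activity psi ->
  (forall x, (phi x <= psi x)%R) -> wint k phi <= wint k psi.
Proof.
have m1 := measurable_functional_cst ler01.
elim: k phi psi => [//|k IH] phi psi aphi apsi le.
rewrite !wintS; apply: ge0_le_integral => //.
- by move=> x _; exact: jint_cut_ge0.
- exact: measurable_jint_cut.
- exact: measurable_jint_cut.
move=> x _; apply: lee_pmul => //.
- by rewrite lee_fin; case: aphi.
- by apply: wint_ge0; exact: activity_cut.
- by rewrite lee_fin.
- apply: IH => [| |y]; [exact: activity_cut..|].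
  by rewrite ler_wpM2r.
Qed.

(** Forgetting all exclusions caused by the [chi]-points leaves [m] independent integrals, each at
    most [s]. *)
Lemma jint_wint_le m l chi phi (s : R) : activity chi -> activity phi ->
  \int[mu]_x (chi x)%:E <= s%:E ->
  jint m (wint l) chi phi <= (s ^+ m)%:E * wint l phi.
Proof.
have m1 := measurable_functional_wint l.
have int0 (chi' : T -> R) : activity chi' -> 0 <= \int[mu]_x (chi' x)%:E.
  by move=> [_ chi0]; apply: integral_ge0 => x _; rewrite lee_fin.
elim: m chi phi => [|m IH] chi phi achi aphi les /=.
  by rewrite expr0 mul1e.
have s0 : (0 <= s)%R by rewrite -lee_fin (le_trans _ les)// int0.
apply: (@le_trans _ _ (\int[mu]_x ((chi x)%:E * ((s ^+ m)%:E * wint l phi)))).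
  apply: ge0_le_integral => //.
  - by move=> x _; exact: jint_cut_ge0.
  - exact: measurable_jint_cut.
  - apply: emeasurable_funM => //; apply/measurable_EFinP; by case: achi.
  move=> x _; apply: lee_wpmul2l; first by rewrite lee_fin; case: achi.
  have acx := activity_cut x achi; have apx := activity_cut x aphi.
  apply: (le_trans (IH _ _ acx apx _)).
    apply: le_trans les; apply: ge0_le_integral => //.
    + by move=> y _; rewrite lee_fin; case: acx.
    + by apply/measurable_EFinP; case: acx.
    + by apply/measurable_EFinP; case: achi.
    + by move=> y _; rewrite lee_fin le_cut//; case: achi.
  apply: lee_wpmul2l; first by rewrite lee_fin exprn_ge0.
  by apply: le_wint => // y; apply: le_cut; case: aphi.
rewrite ge0_integralZr//; last 3 first.
- by apply/measurable_EFinP; case: achi.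
- by move=> x _; rewrite lee_fin; case: achi.
- by apply: mule_ge0; [rewrite lee_fin exprn_ge0|exact: wint_ge0].
rewrite exprS EFinM -muleA; apply: lee_wpmul2r => //.
by apply: mule_ge0; [rewrite lee_fin exprn_ge0|exact: wint_ge0].
Qed.

Lemma wint_le_expr k phi (s : R) : activity phi ->
  \int[mu]_x (phi x)%:E <= s%:E -> wint k phi <= (s ^+ k)%:E.
Proof.
move=> aphi les; rewrite -(jint_cst1 k phi phi).
by have := jint_wint_le k 0 aphi aphi les; rewrite mule1.
Qed.

Lemma wintS_le k phi (s : R) : activity phi ->
  \int[mu]_x (phi x)%:E <= s%:E -> wint k.+1 phi <= s%:E * wint k phi.
Proof.
move=> aphi les.
have := jint_wint_le 1 k aphi aphi les; rewrite expr1; exact.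
Qed.

Lemma wint_eq0_le k k' phi (s : R) : activity phi ->
  \int[mu]_x (phi x)%:E <= s%:E -> (k <= k')%N -> wint k phi = 0 ->
  wint k' phi = 0.
Proof.
move=> aphi les /subnK <-; elim: (k' - k)%N => [//|n IH] wk.
apply/eqP; rewrite eq_le wint_ge0// andbT addSn.
by apply: (le_trans (wintS_le _ aphi les)); rewrite IH// mule0.
Qed.

Lemma wint_scale k phi (c : R) : (0 <= c)%R -> activity phi ->
  wint k (fun x => c * phi x)%R = (c ^+ k)%:E * wint k phi.
Proof.
move=> c0; elim: k phi => [|k IH] phi aphi; first by rewrite expr0 mul1e.
rewrite !wintS -ge0_integralZl//; last 3 first.
- exact: (measurable_jint_cut _ (measurable_functional_cst ler01) aphi aphi aphi).
- move=> x _; exact: (jint_cut_ge0 _ _ (measurable_functional_cst ler01) aphi aphi aphi).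
- by rewrite lee_fin exprn_ge0.
apply: eq_integral => x _.
rewrite (_ : cut _ x = fun y => c * cut phi x y)%R; last first.
  by apply/funext => y; rewrite /cut mulrA.
rewrite IH; last exact: activity_cut.
by rewrite exprS !EFinM -!muleA; congr (_ * _); rewrite muleCA.
Qed.

(** A nonzero integral has a point where its integrand is nonzero. Reading one off each iterated
    integral turns positivity of a partition function into an actual configuration. *)
Lemma wint_neq0 k phi : activity phi -> wint k phi != 0 ->
  exists s : seq T, [/\ size s = k, pairwise far s &
    all (fun x => phi x != 0)%R s].
Proof.
elim: k phi => [|k IH] phi aphi; first by exists [::].
rewrite wintS => /eqP int0.
have [x /eqP] : exists x, (phi x)%:E * wint k (cut phi x) <> 0.
  by apply/existsNP => H; apply: int0; apply: integral0_eq.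
rewrite mule_eq0 negb_or => /andP[phix /(IH _ (activity_cut x aphi))].
move=> [s [ss ps /allP sphi]]; exists (x :: s); split => /=; first by rewrite ss.
- apply/andP; split=> //; apply: sub_all (introT allP sphi) => y.
  by rewrite /cut; case: (far x y); rewrite ?mulr0 ?eqxx.
- apply/andP; split=> //; apply: sub_all (introT allP sphi) => y.
  by apply: contra => /eqP; rewrite /cut => ->; rewrite mul0r.
Qed.

(** * The grand partition function and its spatial Markov property *)

Lemma sum_antidiagonal (F : nat -> nat -> \bar R) K :
  \sum_(k < K) \sum_(m < k.+1) F m (k - m)%N =
  \sum_(m < K) \sum_(l < K | (m + l < K)%N) F m l.
Proof.
transitivity (\sum_(k < K) \sum_(m < K | (m < k.+1)%N) F m (k - m)%N).
  by apply: eq_bigr => k _; rewrite (big_ord_widen K (fun m => F m (k - m)%N) (ltn_ord k)).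
rewrite (exchange_big_dep xpredT)//=; apply: eq_bigr => m _.
rewrite -(big_mkord (fun k => m < k.+1)%N (fun k => F m (k - m)%N)).
rewrite -(big_mkord (fun l => m + l < K)%N (fun l => F m l)).
have mK := ltnW (ltn_ord m).
rewrite (@big_cat_nat _ _ _ m)//= [X in (X + _)%R]big_nat_cond.
rewrite [X in (X + _)%R]big1; last first.
  by move=> i /andP[/andP[_ im]]; rewrite ltnS leqNgt im.
rewrite add0r -{1}[in LHS](add0n (nat_of_ord m)) big_addn.
rewrite [RHS](@big_cat_nat _ _ _ (K - m))//= ?leq_subr//.
rewrite [X in _ = (_ + X)%R]big_nat_cond [X in _ = (_ + X)%R]big1; last first.
  by move=> i /andP[/andP[]]; rewrite leq_subLR leqNgt => /negbTE ->.
rewrite addr0 big_nat_cond [RHS]big_nat_cond; apply: eq_big => i.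
  by rewrite addnC ltnS leq_addr ltn_subRL; case: (m + i < K)%N.
by rewrite addnK.
Qed.

(** Truncation to fewer than [K] points keeps the sums finite. It loses nothing when [wint] vanishes
    from [K] on, as it does in a cube once [K] exceeds the packing bound. *)
Definition Zsum K phi := \sum_(k < K) (k`!%:R^-1)%:E * wint k phi.

Let invfact_ge0 k : (0 <= (k`!%:R^-1 : R))%R.
Proof. by rewrite invr_ge0. Qed.

Lemma measurable_functional_Zsum K : measurable_functional (Zsum K).
Proof.
apply: measurable_functional_sum => k; apply: measurable_functionalM => //.
exact: measurable_functional_wint.
Qed.

Lemma Zsum_ge0 K phi : activity phi -> 0 <= Zsum K phi.
Proof. exact: (measurable_functional_Zsum K).1. Qed.

Let binfact k m : (m <= k)%N ->
  (k`!%:R^-1 * 'C(k, m)%:R = m`!%:R^-1 * (k - m)`!%:R^-1 :> R)%R.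
Proof.
move=> mk; rewrite -[in LHS](bin_fact mk) !natrM !invfM mulrAC mulVf ?mul1r//.
by rewrite pnatr_eq0 -lt0n bin_gt0.
Qed.

Lemma ZsumD K phi psi : activity phi -> activity psi ->
  Zsum K (phi \+ psi)%R = \sum_(m < K) \sum_(l < K | (m + l < K)%N)
    (m`!%:R^-1)%:E * ((l`!%:R^-1)%:E * jint m (wint l) phi psi).
Proof.
move=> aphi apsi; rewrite -(sum_antidiagonal (fun m l =>
  (m`!%:R^-1)%:E * ((l`!%:R^-1)%:E * jint m (wint l) phi psi))).
apply: eq_bigr => k _; rewrite wintD// ge0_sume_distrr.
  apply: eq_bigr => m _; rewrite !muleA -!EFinM binfact//.
  by rewrite -ltnS.
move=> m _; apply: mule_ge0; first by rewrite lee_fin.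
by apply: jint_ge0 => //; exact: measurable_functional_wint.
Qed.

(** The points of [chi] contribute at most the sum of [s^m / m!]. With zero [phi] this is
    [Z <= exp t]; with [near_part] and [cut] of one activity it says that placing a point leaves at
    least the fraction [exp (- s)] of [Z], where [s] is the activity it excludes. *)
Lemma Zsum_le_exp K chi phi (s : R) : activity chi -> activity phi ->
  \int[mu]_x (chi x)%:E <= s%:E ->
  Zsum K (chi \+ phi)%R <= (expR s)%:E * Zsum K phi.
Proof.
move=> achi aphi les; rewrite ZsumD//.
have s0 : (0 <= s)%R.
  rewrite -lee_fin (le_trans _ les)// integral_ge0// => x _.
  by rewrite lee_fin; case: achi.
have F0 l : 0 <= (l`!%:R^-1)%:E * wint l phi.
  by apply: mule_ge0; [rewrite lee_fin|exact: wint_ge0].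
apply: (@le_trans _ _ (\sum_(m < K) (m`!%:R^-1 * s ^+ m)%:E * Zsum K phi)).
  apply: lee_sum => m _; rewrite ge0_sume_distrr; last by move=> l _; exact: F0.
  rewrite [leRHS](bigID (fun l : 'I_K => (m + l < K)%N))/= -[leLHS]adde0.
  apply: leeD; last first.
    apply: sume_ge0 => l _; apply: mule_ge0; last exact: F0.
    by rewrite lee_fin mulr_ge0// exprn_ge0.
  apply: lee_sum => l _; rewrite EFinM -muleA; apply: lee_wpmul2l.
    by rewrite lee_fin.
  rewrite muleCA; apply: lee_wpmul2l; first by rewrite lee_fin.
  exact: jint_wint_le.
rewrite -ge0_sume_distrl; last first.
  by move=> m _; rewrite lee_fin mulr_ge0// exprn_ge0.
apply: lee_wpmul2r; first exact: Zsum_ge0.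
rewrite sumEFin lee_fin; exact: sum_exp_coeff_le.
Qed.

(* Sum over the configurations of the points in [phi]; [F] is evaluated at what
   they leave uncovered of [psi]. *)
Definition outer K F phi psi := \sum_(m < K) (m`!%:R^-1)%:E * jint m F phi psi.

Lemma le_outer K F G (a : R) phi psi : measurable_functional F ->
  measurable_functional G -> (0 <= a)%R -> activity phi -> activity psi ->
  (forall chi, activity chi -> (forall x, (chi x <= psi x)%R) ->
    a%:E * F chi <= G chi) ->
  a%:E * outer K F phi psi <= outer K G phi psi.
Proof.
move=> mF mG a0 aphi apsi FG; rewrite ge0_sume_distrr; last first.
  by move=> m _; apply: mule_ge0; [rewrite lee_fin|exact: jint_ge0].
apply: lee_sum => m _; rewrite muleCA; apply: lee_wpmul2l; first by rewrite lee_fin.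
rewrite -jintM//; apply: le_jint => //; exact: measurable_functionalM.
Qed.

Lemma outerD K F G phi psi : measurable_functional F ->
  measurable_functional G -> activity phi -> activity psi ->
  outer K (fun chi => F chi + G chi) phi psi = outer K F phi psi + outer K G phi psi.
Proof.
move=> mF mG aphi apsi; rewrite -big_split/=; apply: eq_bigr => m _.
by rewrite jintD// ge0_muleDr// jint_ge0.
Qed.

Lemma outerM K F phi psi (c : R) : measurable_functional F -> (0 <= c)%R ->
  activity phi -> activity psi ->
  outer K (fun chi => c%:E * F chi) phi psi = c%:E * outer K F phi psi.
Proof.
move=> mF c0 aphi apsi; rewrite /outer ge0_sume_distrr; last first.
  by move=> m _; apply: mule_ge0; [rewrite lee_fin|exact: jint_ge0].
by apply: eq_bigr => m _; rewrite jintM// muleCA.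
Qed.

Lemma outer_cst1 K phi psi : outer K (fun=> 1) phi psi = Zsum K phi.
Proof. by apply: eq_bigr => m _; rewrite jint_cst1. Qed.

Lemma jint_wint_eq0 m l phi psi : activity phi -> activity psi ->
  wint (m + l) (phi \+ psi)%R = 0 -> jint m (wint l) phi psi = 0.
Proof.
move=> aphi apsi; rewrite wintD// => /eqP.
have t0 (i : 'I_(m + l).+1) : 0 <= 'C(m + l, i)%:R%:E * jint i (wint (m + l - i)) phi psi.
  apply: mule_ge0; first by rewrite lee_fin.
  by apply: jint_ge0 => //; exact: measurable_functional_wint.
rewrite seq_psume_eq0// => /allP/(_ (inord m)).
rewrite mem_index_enum inordK ?ltnS ?leq_addr// => /(_ isT).
rewrite addnC addnK mule_eq0 => /orP[|/eqP//].
by rewrite eqe pnatr_eq0 -leqn0 leqNgt bin_gt0 leq_addl.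
Qed.

(** The spatial Markov property: placing points of [phi], then points of [psi] in what is left,
    produces all configurations of the sum. The two truncations differ by terms with [m + l >= K],
    which vanish by [jint_wint_eq0]. *)
Lemma outer_Zsum K phi psi : activity phi -> activity psi ->
  (forall k, (K <= k)%N -> wint k (phi \+ psi)%R = 0) ->
  outer K (Zsum K) phi psi = Zsum K (phi \+ psi)%R.
Proof.
move=> aphi apsi wK; rewrite ZsumD//; apply: eq_bigr => m _.
have mw k : measurable_functional (wint k) by exact: measurable_functional_wint.
rewrite jint_sum//; last by move=> i; exact: measurable_functionalM.
rewrite ge0_sume_distrr; last first.
  by move=> i _; apply: jint_ge0 => //; exact: measurable_functionalM.
rewrite (bigID (fun l : 'I_K => (m + l < K)%N))/= [X in _ + X]big1 ?adde0.
  by apply: eq_bigr => l _; rewrite jintM.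
move=> l; rewrite -leqNgt => Kml; rewrite jintM// jint_wint_eq0// ?mule0//.
exact: wK.
Qed.

(** The Markov property with a marked point in [psi]: [jint_swap] places this point first, so it
    cuts both activities and [outer_Zsum] applies to what remains. *)
Lemma outer_insert_Zsum K phi psi : activity phi -> activity psi ->
  (forall k, (K <= k)%N -> wint k (phi \+ psi)%R = 0) ->
  outer K (insert (Zsum K)) phi psi =
  \int[mu]_x ((psi x)%:E * Zsum K (cut (phi \+ psi)%R x)).
Proof.
move=> aphi apsi wK.
have mZ := measurable_functional_Zsum K.
have mj m : measurable_fun setT (fun x =>
    (m`!%:R^-1)%:E * ((psi x)%:E * jint m (Zsum K) (cut phi x) (cut psi x))).
  by apply: measurable_funeM; exact: measurable_jint_cut.
rewrite /outer; under eq_bigr do rewrite -jint_swap//.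
transitivity (\sum_(m < K) \int[mu]_x ((m`!%:R^-1)%:E *
    ((psi x)%:E * jint m (Zsum K) (cut phi x) (cut psi x)))).
  apply: eq_bigr => m _; rewrite ge0_integralZl//.
  - exact: measurable_jint_cut.
  - by move=> x _; exact: jint_cut_ge0.
rewrite -ge0_integral_sum//; last first.
  by move=> m x _; apply: mule_ge0; [rewrite lee_fin|exact: jint_cut_ge0].
apply: eq_integral => x _.
have acx := activity_cut x aphi; have apx := activity_cut x apsi.
rewrite cutD -outer_Zsum//.
  rewrite ge0_sume_distrr.
    by apply: eq_bigr => m _; rewrite muleCA.
  by move=> m _; apply: mule_ge0; [rewrite lee_fin|exact: jint_ge0].
move=> k Kk; apply/eqP; rewrite eq_le wint_ge0 ?andbT; last exact: activityD.
have app := activityD aphi apsi.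
rewrite -(wK k Kk); apply: le_wint => //; first exact: activityD.
by move=> y; rewrite -cutD; apply: le_cut; case: app.
Qed.

Lemma Zsum_fin K phi (s : R) : activity phi -> \int[mu]_x (phi x)%:E <= s%:E ->
  Zsum K phi \is a fin_num.
Proof.
move=> aphi les; apply/sum_fin_numP => k _ _; rewrite fin_numM// ge0_fin_numE.
  by apply: le_lt_trans (ltry _); exact: wint_le_expr les.
exact: wint_ge0.
Qed.

(** * The occupancy inequality *)

Definition near_part phi x : T -> R := fun y => (phi y * (~~ far x y)%:R)%R.

Lemma near_partE phi x : (near_part phi x \+ cut phi x)%R = phi.
Proof.
apply/funext => y; rewrite /near_part /cut/=.
by case: (far x y); rewrite ?mulr1 ?mulr0 ?addr0 ?add0r.
Qed.

Lemma measurable_near_pair d' (T' : measurableType d') (f g : T' -> T) :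
  measurable_fun setT f -> measurable_fun setT g ->
  measurable_fun setT (fun p => (~~ far (f p) (g p))%:R : R).
Proof.
move=> mf mg; rewrite (_ : (fun p => _) = (fun p => 1 - (far (f p) (g p))%:R)%R).
  by apply: measurable_funB => //; exact: measurable_far_pair.
by apply/funext => p; case: (far _ _); rewrite ?subrr ?subr0.
Qed.

Lemma activity_near_part phi x : activity phi -> activity (near_part phi x).
Proof.
move=> [mphi phi0]; split=> [|y]; last by rewrite mulr_ge0.
by apply: measurable_funM => //; exact: measurable_near_pair.
Qed.

Lemma le_near_part phi x y : (0 <= phi y)%R -> (near_part phi x y <= phi y)%R.
Proof. by move=> ?; rewrite /near_part; case: (far x y); rewrite ?mulr1// mulr0. Qed.

Let expRN_tangent (a s : R) : (expR (- a) * (1 + a - s) <= expR (- s))%R.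
Proof.
rewrite [X in (_ <= expR X)%R](_ : (_ = - a + (a - s))%R); last by ring.
by rewrite expRD ler_wpM2l ?expR_ge0// -addrA expR_ge1Dx.
Qed.

Lemma integral_activity_fin phi (s : R) : activity phi ->
  \int[mu]_x (phi x)%:E <= s%:E ->
  \int[mu]_x (phi x)%:E = (fine (\int[mu]_x (phi x)%:E))%:E.
Proof.
move=> [_ phi0] les; rewrite fineK// ge0_fin_numE ?(le_lt_trans les) ?ltry//.
by apply: integral_ge0 => x _; rewrite lee_fin.
Qed.

Lemma integral_activity_le phi psi : activity phi -> activity psi ->
  (forall x, (phi x <= psi x)%R) ->
  \int[mu]_x (phi x)%:E <= \int[mu]_x (psi x)%:E.
Proof.
move=> [mphi phi0] [mpsi psi0] le; apply: ge0_le_integral => //.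
- by move=> x _; rewrite lee_fin.
- exact/measurable_EFinP.
- exact/measurable_EFinP.
- by move=> x _; rewrite lee_fin.
Qed.

(** Placing a point at [x] leaves at least the fraction [exp (- s x)] of [Z], where [s x] is the
    activity excluded by [x]. The average of [s] over [chi] is at most [q], so the average fraction
    is at least [exp (- q)]: Jensen's inequality, obtained from the tangent at [q]. *)
Let Zsum_le_insert K chi (t q : R) : (0 <= q)%R -> activity chi ->
  \int[mu]_x (chi x)%:E = t%:E ->
  \int[mu]_x ((chi x)%:E * \int[mu]_y (near_part chi x y)%:E) <= (q * t)%:E ->
  (t * expR (- q))%:E * Zsum K chi <= insert (Zsum K) chi.
Proof.
move=> q0 achi chit hq; have [mchi chi0] := achi.
have t_ge0 : (0 <= t)%R.
  by rewrite -lee_fin -chit integral_ge0// => x _; rewrite lee_fin.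
have lechi : \int[mu]_x (chi x)%:E <= t%:E by rewrite chit.
have Zf := Zsum_fin K achi lechi.
pose z := fine (Zsum K chi); have zE : Zsum K chi = z%:E by rewrite fineK.
have z0 : (0 <= z)%R by rewrite -lee_fin -zE Zsum_ge0.
pose s x := fine (\int[mu]_y (near_part chi x y)%:E).
have les x : \int[mu]_y (near_part chi x y)%:E <= t%:E.
  rewrite -chit; apply: integral_activity_le => //; first exact: activity_near_part.
  by move=> y; exact: le_near_part.
have sE x : \int[mu]_y (near_part chi x y)%:E = (s x)%:E.
  by apply: integral_activity_fin (les x); exact: activity_near_part.
have ms : measurable_fun setT s.
  apply/measurable_EFinP.
  rewrite (_ : _ \o _ = fun x => \int[mu]_y (near_part chi x y)%:E).
    apply: (measurable_fun_fubini_tonelli_F (fun q => (near_part chi q.1 q.2)%:E)).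
      apply/measurable_EFinP; apply: measurable_funM; last exact: measurable_near_pair.
      exact: (measurableT_comp mchi measurable_snd).
    by move=> p; rewrite lee_fin mulr_ge0.
  by apply/funext => x; rewrite /= sE.
have s_ge0 x : (0 <= s x)%R.
  by rewrite fine_ge0// integral_ge0// => y _; rewrite lee_fin mulr_ge0.
have cutbound x : (expR (- q) * (1 + q - s x) * z)%:E <= Zsum K (cut chi x).
  have := @Zsum_le_exp K _ _ (s x) (activity_near_part x achi) (activity_cut x achi).
  rewrite near_partE sE zE => /(_ (lexx _)) h.
  apply: (@le_trans _ _ (expR (- s x) * z)%:E).
    by rewrite lee_fin ler_wpM2r.
  rewrite EFinM; apply: (@le_trans _ _ ((expR (- s x))%:E *
      ((expR (s x))%:E * Zsum K (cut chi x)))).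
    by apply: lee_wpmul2l => //; rewrite lee_fin expR_ge0.
  by rewrite muleA -EFinM mulrC expRxMexpNx_1 mul1e.
have mM : measurable_fun setT (fun x => (chi x)%:E * Zsum K (cut chi x)).
  apply: (@measurable_jint_cut (Zsum K) 0 chi chi chi) => //; exact: measurable_functional_Zsum.
have M0 x : 0 <= (chi x)%:E * Zsum K (cut chi x).
  by apply: (@jint_cut_ge0 (Zsum K) 0 chi chi chi) => //; exact: measurable_functional_Zsum.
have c0 : (0 <= expR (- q) * (1 + q) * z)%R.
  by rewrite !mulr_ge0 ?expR_ge0 ?addr_ge0.
have ez0 : (0 <= expR (- q) * z)%R by rewrite mulr_ge0 ?expR_ge0.
(* The term with [- s x] is moved to the right before integrating, so that every integrand stays
   nonnegative. *)
have key : (t * (expR (- q) * (1 + q) * z))%:E <=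
    insert (Zsum K) chi + (expR (- q) * z)%:E * (q * t)%:E.
  have := hq; under eq_integral do rewrite sE.
  move=> hq'; rewrite EFinM -chit -ge0_integralZr//; last 2 first.
  - exact/measurable_EFinP.
  - by move=> x _; rewrite lee_fin.
  apply: (@le_trans _ _ (\int[mu]_x ((chi x)%:E * Zsum K (cut chi x) +
      (expR (- q) * z)%:E * ((chi x)%:E * (s x)%:E)))).
    apply: ge0_le_integral => //.
    - by move=> x _; apply: mule_ge0; rewrite lee_fin.
    - by apply: emeasurable_funM => //; exact/measurable_EFinP.
    - apply: emeasurable_funD => //; apply: measurable_funeM.
      by apply: emeasurable_funM; exact/measurable_EFinP.
    move=> x _; rewrite muleCA -ge0_muleDr; last 2 first.
    - by apply: Zsum_ge0; exact: activity_cut.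
    - by rewrite -EFinM lee_fin mulr_ge0.
    apply: lee_wpmul2l; first by rewrite lee_fin.
    rewrite -EFinM -leeBlDr// -EFinB; apply: le_trans (cutbound x).
    by rewrite lee_fin; lra.
  rewrite ge0_integralD//; last 2 first.
  - by move=> x _; rewrite -!EFinM lee_fin !mulr_ge0// ?expR_ge0.
  - apply: measurable_funeM; apply: emeasurable_funM; exact/measurable_EFinP.
  rewrite leeD2l// ge0_integralZl//; last 2 first.
  - apply: emeasurable_funM; exact/measurable_EFinP.
  - by move=> x _; rewrite -EFinM lee_fin mulr_ge0.
  by apply: lee_wpmul2l; rewrite ?lee_fin.
rewrite zE -EFinM -(@leeD2rE _ ((expR (- q) * z)%:E * (q * t)%:E)) -?EFinM//.
by apply: le_trans key; rewrite -EFinD lee_fin; lra.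
Qed.

(* Tangent-line bounds on both factors: [1 >= exp(-t) Z] with [t = int chi],
   and the insertion estimate [insert Z >= t exp(-q) Z]. *)
Let Zsum_le_tangent K chi (t q y : R) : (0 <= q)%R -> (0 <= y)%R ->
  activity chi -> \int[mu]_x (chi x)%:E = t%:E ->
  \int[mu]_x ((chi x)%:E * \int[mu]_y (near_part chi x y)%:E) <= (q * t)%:E ->
  (expR (- y) * (1 + y))%:E * Zsum K chi <=
  1 + (expR (q - y))%:E * insert (Zsum K) chi.
Proof.
move=> q0 y0 achi chit hq.
have lechi : \int[mu]_x (chi x)%:E <= t%:E by rewrite chit.
have Zf := Zsum_fin K achi lechi.
have ins0 := (measurable_functional_insert (measurable_functional_Zsum K)).1 _ achi.
have hins := Zsum_le_insert K q0 achi chit hq.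
pose z := fine (Zsum K chi); have zE : Zsum K chi = z%:E by rewrite fineK.
have z0 : (0 <= z)%R by rewrite -lee_fin -zE Zsum_ge0.
have Zle : z%:E <= (expR t)%:E.
  have a0 : activity (fun=> 0%R : R) by split.
  have := @Zsum_le_exp K chi (fun=> 0%R) t achi a0 lechi.
  rewrite (_ : (chi \+ _)%R = chi); last by apply/funext => x; rewrite /= addr0.
  rewrite zE => /le_trans; apply; rewrite -[leRHS]mule1; apply: lee_wpmul2l.
    by rewrite lee_fin expR_ge0.
  case: K {Zf hins ins0 z zE z0} => [|K]; first by rewrite /Zsum big_ord0.
  rewrite /Zsum big_ord_recl/= big1 ?adde0 ?mule1 ?invr1//.
  move=> i _; rewrite wintS integral0_eq ?mule0// => x _.
  by rewrite mul0e.
rewrite zE -EFinM.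
have z1 : (expR (- t) * z <= 1)%R.
  by rewrite expRN ler_pdivrMl ?expR_gt0// mulr1 -lee_fin.
have tang := expRN_tangent y t.
apply: (@le_trans _ _ (1 + (expR (q - y))%:E * ((t * expR (- q))%:E * Zsum K chi))).
  rewrite zE -!EFinM -EFinD lee_fin expRD.
  have -> : (expR q * expR (- y) * (t * expR (- q) * z) =
    (expR q * expR (- q)) * (expR (- y) * t * z))%R by ring.
  rewrite expRxMexpNx_1 mul1r.
  have := ler_wpM2r z0 tang; lra.
by rewrite leeD2l//; apply: lee_wpmul2l => //; rewrite lee_fin expR_ge0.
Qed.

(** The local bound at [v] is integrated against [phi v]. The weight of [v] being free integrates to
    [insert (Zsum K) phi]; in the weight of the points near [v], Tonelli counts each point [u] once
    for every [v] near it, a mass of at most [D]. *)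
Theorem Zsum_occupancy K phi (s q y D : R) : (0 <= q)%R -> (0 <= y)%R ->
  activity phi -> \int[mu]_x (phi x)%:E = s%:E ->
  (forall k, (K <= k)%N -> wint k phi = 0) ->
  (forall x, \int[mu]_u (near_part phi x u)%:E <= D%:E) ->
  (forall v chi, activity chi -> (forall x, (chi x <= near_part phi v x)%R) ->
    \int[mu]_x ((chi x)%:E * \int[mu]_u (near_part chi x u)%:E) <=
    q%:E * \int[mu]_x (chi x)%:E) ->
  (expR (- y) * (1 + y) * s)%:E * Zsum K phi <=
  (1 + expR (q - y) * D)%:E * insert (Zsum K) phi.
Proof.
move=> q0 y0 aphi ints wK hD hq; have [mphi phi0] := aphi.
have les : \int[mu]_x (phi x)%:E <= s%:E by rewrite ints.
have mZ := measurable_functional_Zsum K.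
have c0 : (0 <= expR (- y) * (1 + y))%R by rewrite mulr_ge0 ?expR_ge0// addr_ge0.
have mfar2 : measurable_fun setT (fun p : T * T => (~~ far p.1 p.2)%:R : R).
  exact: measurable_near_pair.
have mcutZ : measurable_fun setT (fun x => Zsum K (cut phi x)).
  exact: (mZ.2 _ _ _ (measurable_cut aphi) (cut_ge0 aphi)).
have cutZ0 x : 0 <= Zsum K (cut phi x) by apply: Zsum_ge0; exact: activity_cut.
(* The outside is [cut phi v] and the ball is [near_part phi v]. Leaving the ball empty, the outside
   sums to [Zsum K (cut phi v)], the weight of [v] being free; [Zsum_le_tangent] applies to whatever
   the outside leaves of the ball. *)
have local v : (expR (- y) * (1 + y))%:E * Zsum K phi <= Zsum K (cut phi v) +
    (expR (q - y))%:E * \int[mu]_u ((near_part phi v u)%:E * Zsum K (cut phi u)).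
  have an := activity_near_part v aphi; have ac := activity_cut v aphi.
  have phiE : (cut phi v \+ near_part phi v)%R = phi.
    by rewrite -[RHS](near_partE phi v); apply/funext => x /=; rewrite addrC.
  have wK' k : (K <= k)%N -> wint k (cut phi v \+ near_part phi v)%R = 0.
    by rewrite phiE; exact: wK.
  have m1 := measurable_functional_cst ler01.
  have mI := measurable_functional_insert mZ.
  have := outer_insert_Zsum ac an wK'; rewrite phiE => <-.
  rewrite -[in leLHS]phiE -outer_Zsum// -(outer_cst1 K _ (near_part phi v)).
  rewrite -outerM ?expR_ge0// -outerD//; last first.
    by apply: measurable_functionalM => //; exact: expR_ge0.
  apply: le_outer => //.
    apply: measurable_functionalD => //.
    by apply: measurable_functionalM => //; exact: expR_ge0.
  move=> chi achi chile.
  have chis : \int[mu]_x (chi x)%:E <= s%:E.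
    apply: le_trans les; apply: integral_activity_le => // x.
    by apply: (le_trans (chile x)); exact: le_near_part.
  have chiE := integral_activity_fin achi chis.
  apply: (Zsum_le_tangent K q0 y0 achi chiE).
  by rewrite EFinM -chiE; exact: hq.
have mphiE : measurable_fun setT (EFin \o phi) by exact/measurable_EFinP.
pose f (p : T * T) := (phi p.1)%:E * ((near_part phi p.1 p.2)%:E * Zsum K (cut phi p.2)).
have mf : measurable_fun setT f.
  apply: emeasurable_funM; first exact: (measurableT_comp mphiE measurable_fst).
  apply: emeasurable_funM; last exact: (measurableT_comp mcutZ measurable_snd).
  apply/measurable_EFinP; apply: measurable_funM => //.
  exact: (measurableT_comp mphi measurable_snd).
have f0 p : 0 <= f p.
  by rewrite /f !mule_ge0// lee_fin// mulr_ge0.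
have mint1 : measurable_fun setT (fun v => \int[mu]_u f (v, u)).
  exact: measurable_fun_fubini_tonelli_F mf f0.
have int1E v : \int[mu]_u f (v, u) =
    (phi v)%:E * \int[mu]_u ((near_part phi v u)%:E * Zsum K (cut phi u)).
  rewrite -ge0_integralZl ?lee_fin//.
    apply: emeasurable_funM => //; apply/measurable_EFinP.
    by case: (activity_near_part v aphi).
  by move=> u _; rewrite mule_ge0// lee_fin mulr_ge0.
have swap : \int[mu]_v \int[mu]_u f (v, u) <= D%:E * insert (Zsum K) phi.
  rewrite (fubini_tonelli f)// /insert -ge0_integralZl//; last 3 first.
  - exact: emeasurable_funM.
  - by move=> x _; rewrite mule_ge0// lee_fin.
  - apply: le_trans (hD point); apply: integral_ge0 => x _.
    by rewrite lee_fin mulr_ge0.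
  apply: ge0_le_integral; first exact: measurableT.
  - by move=> x _; apply: integral_ge0.
  - exact: measurable_fun_fubini_tonelli_G mf f0.
  - by apply: measurable_funeM; exact: emeasurable_funM.
  move=> u _; rewrite [leRHS]muleC.
  rewrite (_ : \int[mu]_x f (x, u) =
    ((phi u)%:E * Zsum K (cut phi u)) * \int[mu]_x (near_part phi u x)%:E).
    by apply: lee_wpmul2l; [rewrite mule_ge0// lee_fin|exact: hD].
  rewrite -ge0_integralZl//; last 3 first.
  - by apply/measurable_EFinP; case: (activity_near_part u aphi).
  - by move=> x _; rewrite lee_fin mulr_ge0.
  - by rewrite mule_ge0// lee_fin.
  apply: eq_integral => x _; rewrite /f/= /near_part far_sym !EFinM.
  rewrite !muleA (muleC (phi x)%:E) -!muleA; congr (_ * _).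
  by rewrite muleA muleC.
rewrite EFinM -ints muleC muleA muleC -ge0_integralZr//; last 2 first.
- by move=> x _; rewrite lee_fin.
- by apply: mule_ge0; [exact: Zsum_ge0|rewrite lee_fin].
apply: (@le_trans _ _ (\int[mu]_v ((phi v)%:E * Zsum K (cut phi v) +
    (expR (q - y))%:E * \int[mu]_u f (v, u)))).
  apply: ge0_le_integral => //.
  - by move=> x _; rewrite !mule_ge0 ?lee_fin//; exact: Zsum_ge0.
  - by apply: emeasurable_funM.
  - apply: emeasurable_funD; first exact: emeasurable_funM.
    exact: measurable_funeM.
  move=> v _; rewrite int1E [X in _ <= _ + X]muleCA -ge0_muleDr; last 2 first.
  - exact: cutZ0.
  - apply: mule_ge0; first by rewrite lee_fin expR_ge0.
    by apply: integral_ge0 => u _; rewrite mule_ge0// lee_fin mulr_ge0.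
  by apply: lee_wpmul2l; rewrite ?lee_fin// muleC.
rewrite ge0_integralD//; last 4 first.
- by move=> x _; rewrite mule_ge0// lee_fin.
- exact: emeasurable_funM.
- by move=> x _; apply: mule_ge0; [rewrite lee_fin expR_ge0|exact: integral_ge0].
- exact: measurable_funeM.
rewrite ge0_integralZl//; last by move=> x _; exact: integral_ge0.
have D0 : (0 <= D)%R.
  rewrite -lee_fin; apply: le_trans (hD point); apply: integral_ge0 => x _.
  by rewrite lee_fin mulr_ge0.
rewrite EFinD ge0_muleDl ?lee_fin ?mulr_ge0 ?expR_ge0// mul1e.
by rewrite leeD2l// EFinM -muleA; apply: lee_wpmul2l; rewrite ?lee_fin ?expR_ge0.
Qed.

(** Inserting a point turns the term of [k] points into a multiple of that of [k + 1]. After this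
    shift of index the top term is a multiple of [wint K phi], whence the hypothesis. *)
Lemma insert_Zsum K phi : activity phi -> wint K phi = 0 ->
  insert (Zsum K) phi = \sum_(k < K) (k%:R * k`!%:R^-1)%:E * wint k phi.
Proof.
move=> aphi wK.
transitivity (\sum_(k < K) (k`!%:R^-1)%:E * wint k.+1 phi).
  have mw k : measurable_functional (wint k) by exact: measurable_functional_wint.
  have ms k : measurable_fun setT (fun x => (phi x)%:E * wint k (cut phi x)).
    exact: (@measurable_jint_cut (wint k) 0 phi phi phi).
  have s0 k x : 0 <= (phi x)%:E * wint k (cut phi x).
    exact: (@jint_cut_ge0 (wint k) 0 phi phi phi).
  transitivity (\int[mu]_x \sum_(k < K) (k`!%:R^-1)%:E *
      ((phi x)%:E * wint k (cut phi x))).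
    apply: eq_integral => x _; rewrite ge0_sume_distrr.
      by apply: eq_bigr => k _; rewrite muleCA.
    move=> k _; apply: mule_ge0; first by rewrite lee_fin.
    by apply: wint_ge0; exact: activity_cut.
  rewrite ge0_integral_sum//.
  - apply: eq_bigr => k _; rewrite ge0_integralZl// ?lee_fin//.
  - by move=> k; apply: measurable_funeM.
  - by move=> k x _; apply: mule_ge0; rewrite ?lee_fin.
case: K wK => [|K] wK; first by rewrite !big_ord0.
rewrite big_ord_recr/= wK mule0 adde0 [RHS]big_ord_recl/= mul0r mul0e add0e.
apply: eq_bigr => k _; rewrite /bump/= add1n; congr (_%:E * _).
by rewrite factS natrM invfM mulrA divff ?mul1r// pnatr_eq0.
Qed.

(* The expected number of points is at least [m + 1], so some term at or above
   [m] carries at least the average weight. *)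
Lemma exists_heavy_term K phi (s m : R) : activity phi -> (0 < K)%N ->
  \int[mu]_x (phi x)%:E <= s%:E -> wint K phi = 0 ->
  (m + 1)%:E * Zsum K phi <= insert (Zsum K) phi ->
  (0 <= m)%R ->
  exists k : nat, [/\ (k < K)%N, (m <= k%:R)%R &
    ((K%:R ^+ 2)^-1)%:E <= (k`!%:R^-1)%:E * wint k phi].
Proof.
move=> aphi K0 les wK hm m0; rewrite insert_Zsum// in hm.
pose w k := fine (wint k phi).
have wE k : wint k phi = (w k)%:E.
  rewrite fineK// ge0_fin_numE; last exact: wint_ge0.
  by apply: le_lt_trans (ltry _); exact: wint_le_expr les.
have w0 k : (0 <= w k)%R by rewrite -lee_fin -wE wint_ge0.
pose z k := (k`!%:R^-1 * w k)%R.
have z0 k : (0 <= z k)%R by rewrite mulr_ge0.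
have hm' : ((m + 1) * \sum_(k < K) z k <= \sum_(k < K) k%:R * z k)%R.
  rewrite -lee_fin EFinM -!sumEFin; move: hm.
  congr (_ * _ <= _); apply: eq_bigr => k _.
    by rewrite wE.
  by rewrite wE /z mulrA.
have sum1 : (1 <= \sum_(k < K) z k)%R.
  case: (K) K0 => // K' _; rewrite big_ord_recl/= {1}/z/= /w/= invr1 mul1r.
  by rewrite lerDl sumr_ge0.
apply/not_existsP => H.
(* If every term at or above [m] were below [K^-2], each [(k - m) z_k] would be below [1 / K] and
   their sum below 1. But the bound on the mean makes this sum at least the sum of the [z_k], which
   is at least 1 by the empty configuration. *)
have zlt (k : 'I_K) : ((k%:R - m) * z k < K%:R^-1)%R.
  have Kgt0 : (0 < K%:R :> R)%R by rewrite ltr0n.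
  have [mk|km] := leP m k%:R; last first.
    apply: (@le_lt_trans _ _ 0%R); last by rewrite invr_gt0.
    by rewrite mulr_le0_ge0// subr_le0 ltW.
  have [zk|zk] := ltP (z k) ((K%:R ^+ 2)^-1)%R; last first.
    exfalso; apply: (H k); split => //.
    by rewrite wE -EFinM lee_fin.
  apply: (@le_lt_trans _ _ (K%:R * z k)%R).
    by rewrite ler_wpM2r// lerBlDr (le_trans (_ : _ <= K%:R)%R)// ?lerDl// ler_nat ltnW.
  by rewrite -ltr_pdivlMl// -invfM.
have : (\sum_(k < K) (k%:R - m) * z k < 1)%R.
  apply: (@lt_le_trans _ _ (\sum_(k < K) K%:R^-1)%R).
    apply: ltr_sum; last by move=> k _; exact: zlt.
    by apply/hasP; exists (Ordinal K0); rewrite // mem_index_enum.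
  by rewrite sumr_const card_ord -[(_ *+ K)%R]mulr_natr mulVf// pnatr_eq0 -lt0n.
apply/negP; rewrite -leNgt; under eq_bigr do rewrite mulrBl.
rewrite sumrB -mulr_sumr; lra.
Qed.

Lemma jint_separated m l phi psi : activity phi -> activity psi ->
  (forall x y, phi x != 0%R -> psi y != 0%R -> far x y) ->
  jint m (wint l) phi psi = wint m phi * wint l psi.
Proof.
move=> aphi apsi; elim: m phi aphi => [|m IH] phi aphi sep /=; first by rewrite mul1e.
rewrite wintS -ge0_integralZr//; last 3 first.
- exact: (measurable_jint_cut _ (measurable_functional_cst ler01) aphi aphi aphi).
- move=> x _; exact: (jint_cut_ge0 _ _ (measurable_functional_cst ler01) aphi aphi aphi).
- exact: wint_ge0.
apply: eq_integral => x _.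
have [->|phix] := eqVneq (phi x) 0%R; first by rewrite !mul0e.
rewrite -muleA (_ : cut psi x = psi); last first.
  apply/funext => y; rewrite /cut; have [->|psiy] := eqVneq (psi y) 0%R.
    by rewrite mul0r.
  by rewrite sep// mulr1.
rewrite IH//; first exact: activity_cut.
move=> y z; rewrite /cut => phiy; apply: sep.
by apply: contra phiy => /eqP ->; rewrite mul0r.
Qed.

(** Far activities do not cut each other, so the term of [wintD] with [m] points in [phi] factors,
    and the other terms are nonnegative. Partition functions of separated regions are thus
    supermultiplicative. *)
Lemma wint_separated m l phi psi : activity phi -> activity psi ->
  (forall x y, phi x != 0%R -> psi y != 0%R -> far x y) ->
  (m`!%:R^-1)%:E * wint m phi * ((l`!%:R^-1)%:E * wint l psi) <=
  ((m + l)`!%:R^-1)%:E * wint (m + l) (phi \+ psi)%R.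
Proof.
move=> aphi apsi sep; rewrite wintD//.
have t0 (i : 'I_(m + l).+1) : 0 <= 'C(m + l, i)%:R%:E * jint i (wint (m + l - i)) phi psi.
  apply: mule_ge0; first by rewrite lee_fin.
  by apply: jint_ge0 => //; exact: measurable_functional_wint.
have mlt : (m < (m + l).+1)%N by rewrite ltnS leq_addr.
rewrite muleACA -EFinM.
rewrite (_ : (_ * _)%R = ((m + l)`!%:R^-1 * 'C(m + l, m)%:R)%R); last first.
  by rewrite binfact ?leq_addr// addKn.
rewrite EFinM -muleA; apply: lee_wpmul2l; first by rewrite lee_fin.
rewrite (bigD1 (Ordinal mlt))//= addKn jint_separated//.
by rewrite leeDl// sume_ge0.
Qed.

End hard_core_gas.

(** * Euclidean geometry and the volume *)

Section euclidean.
Context {R : realType}.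
Local Notation Rn d := (d.-tuple (measurableTypeR R)).

Let norm2 d (a : 'I_d -> R) := Num.sqrt (\sum_(i < d) a i ^+ 2).

Let sumsq_ge0 d (a : 'I_d -> R) : 0 <= \sum_(i < d) a i ^+ 2.
Proof. by apply: sumr_ge0 => i _; exact: sqr_ge0. Qed.

Let cauchy_schwarz d (a b : 'I_d -> R) :
  \sum_(i < d) a i * b i <= norm2 a * norm2 b.
Proof.
rewrite /norm2 -sqrtrM ?sumsq_ge0//.
have [h|h] := leP (\sum_(i < d) a i * b i) 0; first exact: le_trans h (sqrtr_ge0 _).
rewrite -(ger0_norm (ltW h)) -sqrtr_sqr ler_sqrt; last exact: mulr_ge0.
set ab := \sum_i a i * b i; set A := \sum_(i < d) a i ^+ 2; set B := \sum_(i < d) b i ^+ 2.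
have [B0|B0] := eqVneq B 0.
  have b0 i : b i = 0.
    move/eqP: B0; rewrite psumr_eq0; last by move=> j _; exact: sqr_ge0.
    by move=> /allP/(_ i); rewrite mem_index_enum sqrf_eq0 => /(_ isT)/eqP.
  by rewrite /ab big1 ?expr0n ?mulr_ge0 ?sumsq_ge0// => i _; rewrite b0 mulr0.
have Bgt0 : 0 < B by rewrite lt_def B0 sumsq_ge0.
have : 0 <= \sum_(i < d) (B * a i - ab * b i) ^+ 2 by exact: sumsq_ge0.
have -> : \sum_(i < d) (B * a i - ab * b i) ^+ 2 = B * (A * B - ab ^+ 2).
  transitivity (\sum_(i < d) (B ^+ 2 * a i ^+ 2 + (- (2 * B * ab)) * (a i * b i) +
      ab ^+ 2 * b i ^+ 2)); first by apply: eq_bigr => i _; ring.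
  by rewrite !big_split/= -!mulr_sumr -/A -/B -/ab; ring.
by rewrite pmulr_rge0// subr_ge0.
Qed.

Let norm2D d (a b : 'I_d -> R) :
  norm2 (fun i => a i + b i) <= norm2 a + norm2 b.
Proof.
have n0 (c : 'I_d -> R) : 0 <= norm2 c by exact: sqrtr_ge0.
rewrite -(@ler_pXn2r _ 2)//= ?nnegrE ?addr_ge0//.
rewrite sqrrD !sqr_sqrtr ?sumsq_ge0//.
under eq_bigr do rewrite sqrrD.
rewrite !big_split/= lerD2r lerD2l -mulr2n lerMn2r /=.
exact: cauchy_schwarz.
Qed.

Lemma eucl_dist_ge0 d (x y : Rn d) : 0 <= eucl_dist x y.
Proof. exact: sqrtr_ge0. Qed.

Lemma eucl_distC d (x y : Rn d) : eucl_dist x y = eucl_dist y x.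
Proof. by congr Num.sqrt; apply: eq_bigr => i _; rewrite -sqrrN opprB. Qed.

Lemma eucl_distxx d (x : Rn d) : eucl_dist x x = 0.
Proof. by rewrite /eucl_dist big1 ?sqrtr0// => i _; rewrite subrr expr0n. Qed.

Lemma eucl_dist_triangle d (x y z : Rn d) :
  eucl_dist x z <= eucl_dist x y + eucl_dist y z.
Proof.
apply: le_trans (norm2D (fun i => tnth x i - tnth y i) (fun i => tnth y i - tnth z i)).
by rewrite le_eqVlt; apply/orP; left; apply/eqP; congr Num.sqrt; apply: eq_bigr => i _; rewrite addrA subrK.
Qed.

Lemma coord_le_eucl_dist d (x y : Rn d) i : `|tnth x i - tnth y i| <= eucl_dist x y.
Proof.
rewrite -sqrtr_sqr ler_sqrt ?sumsq_ge0// (bigD1 i)//= lerDl.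
by apply: sumr_ge0 => j _; exact: sqr_ge0.
Qed.

(** The crude factor [d] in place of [sqrt d] suffices: the dimension is fixed while volumes grow,
    and the bound enters boundary layers and constants. *)
Lemma eucl_dist_le d (x y : Rn d) (L : R) : 0 <= L ->
  (forall i, `|tnth x i - tnth y i| <= L) -> eucl_dist x y <= d%:R * L.
Proof.
move=> L0 h; have dL : 0 <= d%:R * L by rewrite mulr_ge0.
rewrite -(ger0_norm dL) -sqrtr_sqr ler_sqrt ?sqr_ge0//.
apply: (@le_trans _ _ (\sum_(i < d) L ^+ 2)).
  apply: ler_sum => i _; rewrite -real_normK ?num_real//.
  by rewrite lerXn2r// nnegrE.
rewrite sumr_const card_ord exprMn -[leLHS]mulr_natl ler_wpM2r ?sqr_ge0//.
by rewrite -natrX ler_nat; case: d {x y h dL} => // d; rewrite expnS leq_pmulr.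
Qed.

Lemma measurable_eucl_dist d d' (T : measurableType d') (f g : T -> Rn d) :
  measurable_fun setT f -> measurable_fun setT g ->
  measurable_fun setT (fun t => eucl_dist (f t) (g t)).
Proof.
move=> mf mg.
apply: (measurableT_comp (continuous_measurable_fun (@sqrt_continuous R))).
apply: measurable_sum => i; apply: measurable_funX; apply: measurable_funB.
  exact: (measurableT_comp (measurable_tnth i) mf).
exact: (measurableT_comp (measurable_tnth i) mg).
Qed.

Lemma measurable_eucl_cball d (x : Rn d) r : measurable (eucl_cball x r).
Proof.
rewrite -[eucl_cball _ _]setTI (_ : _ `&` _ =
    setT `&` (fun y => eucl_dist x y) @^-1` `]-oo, r]).
  by apply: measurable_eucl_dist.
by congr (_ `&` _); apply/seteqP; split => y /=; rewrite in_itv.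
Qed.

Lemma measurable_dist_gt d (D : R) :
  measurable_fun setT (fun p : Rn d * Rn d => (D < eucl_dist p.1 p.2)%R%:R : R).
Proof.
rewrite (_ : (fun p => _) = (fun b : bool => b%:R : R) \o
  (fun p : Rn d * Rn d => D < eucl_dist p.1 p.2)); last by [].
apply: measurableT_comp => //.
apply: measurable_fun_ltr => //; exact: measurable_eucl_dist.
Qed.

Section affine.
Variables (d : nat) (a : R) (b : Rn d).

Definition affine_map (t : Rn d) : Rn d := [tuple a * tnth t i + tnth b i | i < d].

Lemma measurable_affine_map : measurable_fun setT affine_map.
Proof.
apply/measurable_fun_tnthP => i; rewrite (_ : _ \o _ = fun t => a * tnth t i + tnth b i).
  apply: measurable_funD => //; apply: measurable_funM => //; exact: measurable_tnth.
by apply/funext => t; rewrite /= tnth_mktuple.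
Qed.

Lemma eucl_dist_affine (x y : Rn d) : 0 <= a ->
  eucl_dist (affine_map x) (affine_map y) = a * eucl_dist x y.
Proof.
move=> a0; rewrite /eucl_dist.
under eq_bigr do rewrite !tnth_mktuple.
rewrite (_ : \sum_(i < d) _ = a ^+ 2 * \sum_(i < d) (tnth x i - tnth y i) ^+ 2).
  by rewrite sqrtrM ?sqr_ge0// sqrtr_sqr ger0_norm.
by rewrite mulr_sumr; apply: eq_bigr => i _; ring.
Qed.

End affine.

Local Open Scope ereal_scope.

(** The rescaled image measure agrees with Lebesgue measure on half-open intervals, hence
    everywhere. *)
Lemma lebesgue_affine (a b : R) (A : set (measurableTypeR R)) : (0 < a)%R ->
  measurable A ->
  lebesgue_measure ((fun x : measurableTypeR R => a * x + b)%R @^-1` A) =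
  (a^-1)%:E * lebesgue_measure A.
Proof.
move=> a0 mA.
have mf : measurable_fun setT (fun x : measurableTypeR R => a * x + b : measurableTypeR R)%R.
  by apply: measurable_funD => //; exact: measurable_funM.
have ai : (0 <= a)%R by exact: ltW.
pose p : {measure set (measurableTypeR R) -> \bar R} :=
  measure_function_pushforward__canonical__measure_function_Measure
    (@lebesgue_measure R) mf.
pose m : {measure set (measurableTypeR R) -> \bar R} := mscale (NngNum ai) p.
suff -> : lebesgue_measure A = m A.
  by rewrite /m/= /mscale/= muleA -EFinM mulVf ?mul1e// gt_eqF.
apply: lebesgue_measure_unique => // X [[x y] _ <-]/=.
rewrite /m/= /mscale/= /p/= /pushforward/=.
have -> : (fun t => a * t + b)%R @^-1` `]x, y]%classic =
    (`](x - b) / a, (y - b) / a]%classic)%R.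
  apply/seteqP; split => t /=; rewrite !in_itv/= ler_pdivlMr// ltr_pdivrMr//;
    by rewrite ltrBlDr lerBrDr [(t * a)%R]mulrC.
rewrite !lebesgue_measure_itv/= !lte_fin ltr_pM2r ?invr_gt0// ltrD2r.
case: ifPn => _; last by rewrite mule0.
by rewrite -!EFinB -EFinM; congr _%:E; field; rewrite gt_eqF.
Qed.

Lemma ge0_integral_lebesgue_affine (a b : R) (f : measurableTypeR R -> \bar R) :
  (0 < a)%R -> measurable_fun setT f -> (forall x, 0 <= f x) ->
  \int[lebesgue_measure]_x f (a * x + b)%R =
  (a^-1)%:E * \int[lebesgue_measure]_x f x.
Proof.
move=> a0 mf f0.
have ma : measurable_fun setT (fun x : measurableTypeR R => a * x + b : measurableTypeR R)%R.
  by apply: measurable_funD => //; exact: measurable_funM.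
have ai : (0 <= a^-1)%R by rewrite invr_ge0 ltW.
transitivity (\int[pushforward lebesgue_measure
    (fun x : measurableTypeR R => a * x + b : measurableTypeR R)%R]_x f x).
  by rewrite ge0_integral_pushforward// preimage_setT.
rewrite (eq_measure_integral (mscale (NngNum ai) (@lebesgue_measure R))).
  by rewrite ge0_integral_mscale.
by move=> A mA _; exact: lebesgue_affine.
Qed.

Lemma tuple_measureS n (A : set (Rn n.+1)) :
  vol n.+1 A = \int[lebesgue_measure]_x vol n [set t | A (consp (x, t))].
Proof.
rewrite /vol/= /cons_measure /pushforward /product_measure1.
apply: eq_integral => x _ /=; congr (tuple_measure _ _ _).
by apply/seteqP; split => t; rewrite /xsection /= ?in_setE ?inE.
Qed.

Lemma measurable_vol_section n (A : set (Rn n.+1)) : measurable A ->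
  measurable_fun setT (fun x : measurableTypeR R => vol n [set t | A (consp (x, t))]).
Proof.
move=> mA; have mA' : measurable (@consp _ _ n @^-1` A : set (measurableTypeR R * Rn n)).
  by rewrite -[X in measurable X]setTI; exact: (@measurable_consp _ (measurableTypeR R) n).
rewrite (_ : (fun x => _) = vol n \o xsection (@consp _ _ n @^-1` A)).
  exact: measurable_fun_xsection.
apply/funext => x /=; congr (vol n _).
by apply/seteqP; split => t; rewrite /xsection /= ?in_setE ?inE.
Qed.

Lemma tnth_consp0 n (x : measurableTypeR R) (t : Rn n) : tnth (consp (x, t)) ord0 = x.
Proof. by rewrite (tnth_nth x). Qed.

Lemma tnth_conspS n (x : measurableTypeR R) (t : Rn n) j :
  tnth (consp (x, t)) (lift ord0 j) = tnth t j.
Proof. by rewrite !(tnth_nth x). Qed.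

Lemma affine_map_consp n (a : R) (b : Rn n.+1) x (t : Rn n) :
  affine_map a b (consp (x, t)) =
  consp ((a * x + tnth b ord0)%R, affine_map a [tuple of behead b] t).
Proof.
apply: eq_from_tnth => i; rewrite tnth_mktuple; case: (unliftP ord0 i) => [j ->|->].
  by rewrite !tnth_conspS tnth_mktuple !(tnth_nth 0%R)/= nth_behead.
by rewrite !tnth_consp0.
Qed.

Lemma vol_affine d (a : R) (b : Rn d) (A : set (Rn d)) : (0 < a)%R ->
  measurable A -> vol d (affine_map a b @^-1` A) = (a ^- d)%:E * vol d A.
Proof.
move=> a0; elim: d b A => [|d IH] b A mA.
  rewrite expr0 invr1 mul1e (_ : affine_map a b @^-1` A = A)//.
  by apply/seteqP; split => t; rewrite /= (tuple0 (affine_map a b t)) (tuple0 t).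
rewrite !tuple_measureS.
transitivity (\int[@lebesgue_measure R]_x ((a ^- d)%:E * vol d
    [set t | A (consp ((a * x + tnth b ord0)%R, t))])).
  apply: eq_integral => x _; rewrite -(IH [tuple of behead b]).
    by congr (vol d _); apply/seteqP; split => t; rewrite /= affine_map_consp.
  rewrite (_ : [set t | _] = xsection (@consp _ _ d @^-1` A) (a * x + tnth b ord0)%R).
    apply: measurable_xsection; rewrite -[X in measurable X]setTI.
    exact: (@measurable_consp _ (measurableTypeR R) d).
  by apply/seteqP; split => t; rewrite /xsection /= ?in_setE ?inE.
have mv := measurable_vol_section mA.
rewrite ge0_integralZl//; last 2 first.
- apply: (measurableT_comp mv).
  by apply: measurable_funD => //; exact: measurable_funM.
- by rewrite lee_fin invr_ge0 exprn_ge0// ltW.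
rewrite (ge0_integral_lebesgue_affine (tnth b ord0) a0 mv)//.
by rewrite muleA -EFinM -invfM exprSr mulrC.
Qed.

End euclidean.

(** * Volumes of boxes and balls *)

Section balls.
Context {R : realType}.
Local Notation Rn d := (d.-tuple (measurableTypeR R)).

Definition unit_ball_vol d : R := fine (vol d (eucl_cball (@origin R d) 1)).

Lemma measurable_box d (P : 'I_d -> set (measurableTypeR R)) :
  (forall i, measurable (P i)) ->
  measurable [set t : Rn d | forall i, P i (tnth t i)].
Proof.
move=> mP; rewrite (_ : [set _ | _] =
    \bigcap_(i in [set: 'I_d]) ((fun t => tnth t i) @^-1` P i)).
  apply: fin_bigcap_measurable => // i _.
  by rewrite -[X in measurable X]setTI; exact: measurable_tnth.
by apply/seteqP; split=> t /= h i; [move=> _|]; exact: h.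
Qed.

Lemma vol_box d (a : 'I_d -> R) (L : R) : 0 <= L ->
  vol d [set t | forall i, a i <= tnth t i < a i + L] = (L ^+ d)%:E.
Proof.
move=> L0.
pose I i : set (measurableTypeR R) := `[a i, (a i + L)[%classic.
rewrite (_ : [set _ | _] = [set t : Rn d | forall i, I i (tnth t i)]); last first.
  by apply/seteqP; split => t /= h i; have := h i; rewrite /I/= in_itv.
transitivity (\prod_(i < d) lebesgue_measure (I i))%E.
  by apply: (@tuple_measureX _ _ _ _ d I) => i; exact: measurable_itv.
rewrite /I; under eq_bigr do rewrite lebesgue_measure_itv/= lte_fin.
rewrite (eq_bigr (fun=> L%:E)); last first.
  move=> i _; case: ifPn; first by rewrite -EFinB addrAC subrr add0r.
  by rewrite ltrDl -leNgt => L0'; congr _%:E; apply/eqP; rewrite eq_le L0 L0'.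
rewrite -[X in (L ^+ X)%:E](card_ord d) -prodr_const.
by elim/big_ind2 : _ => // x1 x2 y1 y2 -> ->; rewrite EFinM.
Qed.

Lemma measurable_cube d (a : 'I_d -> R) (L : R) :
  measurable [set t : Rn d | forall i, a i <= tnth t i < a i + L].
Proof.
pose I i : set (measurableTypeR R) := `[a i, (a i + L)[%classic.
rewrite (_ : [set _ | _] = [set t : Rn d | forall i, I i (tnth t i)]).
  by apply: (@measurable_box d I) => i; exact: measurable_itv.
by apply/seteqP; split => t /= h i; have := h i; rewrite /I/= in_itv.
Qed.

Lemma vol_cball d (x : Rn d) (rho : R) : (0 < rho) ->
  vol d (eucl_cball x rho) = ((rho ^+ d)%:E * vol d (eucl_cball (@origin R d) 1))%E.
Proof.
move=> rho0.
have -> : eucl_cball (@origin R d) 1 = affine_map rho x @^-1` eucl_cball x rho.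
  apply/seteqP; split => t; rewrite /eucl_cball/=;
    rewrite (_ : eucl_dist x (affine_map rho x t) = rho * eucl_dist (origin d) t);
    rewrite ?ger_pMr//;
    rewrite -(eucl_dist_affine x)// ?(ltW rho0)//; congr eucl_dist;
    by apply: eq_from_tnth => i; rewrite !tnth_mktuple mulr0 add0r.
rewrite vol_affine//; last exact: measurable_eucl_cball.
by rewrite muleA -EFinM mulfV ?mul1e// expf_neq0// gt_eqF.
Qed.

Let unit_cball_le d : (vol d (eucl_cball (@origin R d) 1) <= (4 ^+ d)%:E)%E.
Proof.
(* Boxes are half-open, so [[-2, 2)] is taken to contain [[-1, 1]]. *)
rewrite -(@vol_box d (fun=> -2)) ?ler0n//; apply: le_measure; rewrite ?inE.
- exact: measurable_eucl_cball.
- exact: measurable_cube.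
move=> t ht i; have := le_trans (coord_le_eucl_dist (origin d) t i) ht.
by rewrite tnth_mktuple ler_norml; lra.
Qed.

Lemma unit_ball_volE d : vol d (eucl_cball (@origin R d) 1) = (unit_ball_vol d)%:E.
Proof. by rewrite fineK// ge0_fin_numE// (le_lt_trans (unit_cball_le d)) ?ltry. Qed.

Lemma unit_ball_vol_le d : unit_ball_vol d <= 4 ^+ d.
Proof. by rewrite -lee_fin -unit_ball_volE. Qed.

Lemma unit_ball_vol_gt0 d : 0 < unit_ball_vol d.
Proof.
rewrite -lte_fin -unit_ball_volE.
have d0 : 0 < d.+1%:R :> R by rewrite ltr0n.
(* A cube of side [1 / (d + 1)] with a corner at the origin lies in the unit ball by the crude bound
   [eucl_dist_le]; [d + 1] also covers dimension 0. *)
apply: (@lt_le_trans _ _ ((d.+1%:R^-1 ^+ d)%:E : \bar R)).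
  by rewrite lte_fin exprn_gt0// invr_gt0.
rewrite -(@vol_box d (fun=> 0)) ?invr_ge0 ?ler0n//; apply: le_measure; rewrite ?inE.
- exact: measurable_cube.
- exact: measurable_eucl_cball.
move=> t ht; rewrite /eucl_cball/=.
apply: (@le_trans _ _ (d%:R * d.+1%:R^-1)).
  apply: eucl_dist_le => [|i]; first by rewrite invr_ge0 ltW.
  have := ht i; rewrite tnth_mktuple add0r sub0r normrN => /andP[t0 t1].
  by rewrite ger0_norm// ltW.
by rewrite ler_pdivrMr// mul1r ler_nat.
Qed.

Lemma vol_cballE d (x : Rn d) (rho : R) : 0 < rho ->
  vol d (eucl_cball x rho) = (rho ^+ d * unit_ball_vol d)%:E.
Proof. by move=> r0; rewrite vol_cball// unit_ball_volE. Qed.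

Lemma ball_radiusP d (v : R) : (0 < d)%N -> 0 < v ->
  0 < ball_radius d v /\ ball_radius d v ^+ d * unit_ball_vol d = v.
Proof.
move=> d0 v0; have w0 := unit_ball_vol_gt0 d.
have dn0 : d%:R != 0 :> R by rewrite pnatr_eq0 -lt0n.
rewrite /ball_radius; set P := [set r | _].
have exP : exists r, P r.
  exists ((v / unit_ball_vol d) `^ d%:R^-1).
  have vw : 0 < v / unit_ball_vol d by rewrite divr_gt0.
  split; first exact: powR_ge0.
  rewrite vol_cballE ?powR_gt0//; congr _%:E.
  by rewrite -powR_mulrn ?powR_ge0// -powRrM mulVf// powRr1 ?ltW// divfK// gt_eqF.
have [r0 rv] := xgetPex 0 exP.
set r := xget _ _ in r0 rv *.
(* The definition also admits radius 0. It is excluded because the ball would then lie in the single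
   point [0], which has volume 0 when [d > 0]. *)
move: r0; rewrite le_eqVlt => /orP[/eqP r0|r0]; last first.
  by split=> //; move: rv; rewrite vol_cballE// => -[].
pose O : set (measurableTypeR R) := [set 0].
have mO : measurable O by exact: measurable_set1.
exfalso; have : (vol d (eucl_cball (@origin R d) r) <= 0)%E.
  rewrite -r0; apply: (@le_trans _ _ (vol d [set t | forall i, O (tnth t i)])).
    apply: le_measure; rewrite ?inE.
    - exact: measurable_eucl_cball.
    - exact: (@measurable_box d (fun=> O)).
    move=> t ht i; have := le_trans (coord_le_eucl_dist (origin d) t i) ht.
    by rewrite tnth_mktuple sub0r normrN normr_le0 => /eqP.
  rewrite (_ : vol d _ = \prod_(i < d) lebesgue_measure O)%E; last first.
    exact: (@tuple_measureX _ _ _ _ d (fun=> O)).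
  case: d d0 {w0 dn0 P exP r0 r rv} => // d _.
  by rewrite big_ord_recl lebesgue_measure_set1 mul0e.
by rewrite rv lee_fin leNgt v0.
Qed.

Lemma vol_translate d (b : Rn d) (A : set (Rn d)) : measurable A ->
  vol d (affine_map 1 b @^-1` A) = vol d A.
Proof. by move=> mA; rewrite vol_affine// expr1n invr1 mul1e. Qed.

Lemma ge0_integral_translate d (b : Rn d) (f : Rn d -> \bar R) :
  measurable_fun setT f -> (forall x, 0 <= f x)%E ->
  (\int[vol d]_x f (affine_map 1 b x) = \int[vol d]_x f x)%E.
Proof.
move=> mf f0.
transitivity (\int[pushforward (vol d) (affine_map 1 b)]_x f x)%E.
  by rewrite ge0_integral_pushforward// ?preimage_setT//; exact: measurable_affine_map.
apply: eq_measure_integral; first exact: measurable_affine_map.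
by move=> ? A mA _; exact: vol_translate.
Qed.

End balls.

(** * Hard spheres *)

Section tuple_integral.
Local Open Scope ereal_scope.
Context {dp : measure_display} {T : measurableType dp} {R : realType}.
Variable mu : {sigma_finite_measure set T -> \bar R}.
Variable far : rel T.
Hypothesis mfar : measurable_fun setT (fun p : T * T => (far p.1 p.2)%:R : R).

(** The bridge between [Zhat] and [wint]. Since [pairwise] compares each entry with the later ones,
    the first coordinate splits off as a cut. *)
Definition hard_core_weight n (phi : T -> R) (t : n.-tuple T) : R :=
  ((\prod_(x <- t) phi x) * (pairwise far t)%:R)%R.

Lemma hard_core_weight_consp n phi x (t : n.-tuple T) :
  hard_core_weight phi (consp (x, t)) =
  (phi x * hard_core_weight (cut far phi x) t)%R.
Proof.
rewrite /hard_core_weight/= big_cons -!mulrA; congr (_ * _)%R.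
rewrite big_split/= -mulrA; congr (_ * _)%R; rewrite -mulnb natrM; congr (_ * _)%R.
by elim: (t : seq T) => [|y s IH]; rewrite ?big_nil// big_cons -IH -natrM mulnb.
Qed.

Lemma hard_core_weight_ge0 n phi (t : n.-tuple T) : (forall x, (0 <= phi x)%R) ->
  (0 <= hard_core_weight phi t)%R.
Proof. by move=> phi0; rewrite mulr_ge0// prodr_ge0. Qed.

Lemma measurable_hard_core_weight n phi : measurable_fun setT phi ->
  measurable_fun setT (hard_core_weight phi : n.-tuple T -> R).
Proof.
move=> mphi; elim: n => [|n IH].
  rewrite (_ : hard_core_weight phi = cst (hard_core_weight phi [tuple])).
    exact: measurable_cst.
  by apply/funext => t; rewrite (tuple0 t).
pose b (t : n.+1.-tuple T) : n.-tuple T := [tuple of behead t].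
have mb : measurable_fun setT b by exact: measurable_behead.
have mh : measurable_fun setT (fun t : n.+1.-tuple T => tnth t ord0).
  exact: measurable_tnth.
rewrite (_ : hard_core_weight phi = fun t : n.+1.-tuple T =>
  (phi (tnth t ord0) * hard_core_weight phi (b t) *
   \prod_(i < n) (far (tnth t ord0) (tnth (b t) i))%:R)%R).
  apply: measurable_funM.
    by apply: measurable_funM; [exact: (measurableT_comp mphi)|exact: (measurableT_comp IH)].
  apply: measurable_prod => i _; apply: measurable_far_pair => //.
  exact: (measurableT_comp (measurable_tnth i) mb).
apply/funext => t; rewrite {1}[t](_ : _ = consp (tnth t ord0, b t)); last first.
  by apply: val_inj => /=; rewrite {1}(tuple_eta t).
rewrite /b; move: [tuple of behead t] (tnth t ord0) => {mb mh}{}b x.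
rewrite hard_core_weight_consp -mulrA; congr (_ * _)%R.
rewrite /hard_core_weight big_split/= mulrAC; congr (_ * _)%R.
by rewrite -(big_tuple _ _ b xpredT (fun y => (far x y)%:R)).
Qed.

Lemma integral_hard_core_weight n phi : activity phi ->
  \int[tuple_measure mu n]_t (hard_core_weight phi t)%:E = wint mu far n phi.
Proof.
elim: n phi => [|n IH] phi aphi.
  rewrite /= integral_dirac//=; last first.
    by apply/measurable_EFinP; apply: measurable_hard_core_weight; case: aphi.
  by rewrite diracT mul1e /hard_core_weight big_nil mulr1.
have [mphi phi0] := aphi.
have mw : measurable_fun setT (fun t : n.+1.-tuple T => (hard_core_weight phi t)%:E).
  by apply/measurable_EFinP; exact: measurable_hard_core_weight.
have mc := @measurable_consp _ T n.
transitivity (\int[mu \x tuple_measure mu n]_p (hard_core_weight phi (consp p))%:E).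
  rewrite /= /cons_measure ge0_integral_pushforward ?preimage_setT//.
  by move=> t _; rewrite lee_fin hard_core_weight_ge0.
rewrite (fubini_tonelli1 (fun p => (hard_core_weight phi (consp p))%:E)); last 2 first.
- exact: (measurableT_comp mw).
- by move=> p; rewrite lee_fin hard_core_weight_ge0.
rewrite wintS; apply: eq_integral => x _; rewrite /fubini_F.
have ac := activity_cut mfar x aphi.
rewrite -IH// -ge0_integralZl//.
- by apply: eq_integral => t _; rewrite hard_core_weight_consp EFinM.
- by apply/measurable_EFinP; apply: measurable_hard_core_weight; case: ac.
- by move=> t _; rewrite lee_fin hard_core_weight_ge0//; case: ac.
- by rewrite lee_fin.
Qed.

Lemma wint_comp (tau : T -> T) k phi :
  (forall x y, far (tau x) (tau y) = far x y) ->
  (forall f : T -> \bar R, measurable_fun setT f -> (forall x, 0 <= f x) ->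
    \int[mu]_x f (tau x) = \int[mu]_x f x) ->
  activity phi ->
  wint mu far k (phi \o tau) = wint mu far k phi.
Proof.
move=> ftau itau; elim: k phi => [//|k IH] phi aphi; rewrite !wintS.
have m1 := @measurable_functional_cst _ T R 1 ler01.
rewrite -[RHS]itau; last 2 first.
- exact: (measurable_jint_cut mu mfar k m1 aphi aphi aphi).
- by move=> x; exact: (jint_cut_ge0 mu mfar k x m1 aphi aphi aphi).
apply: eq_integral => x _; rewrite -(IH (cut far phi (tau x))); last exact: activity_cut.
by congr (_ * wint _ _ _ _); apply/funext => y; rewrite /cut/= ftau.
Qed.

End tuple_integral.

Section hard_spheres.
Context {R : realType}.
Local Notation Rn d := (d.-tuple (measurableTypeR R)).

Definition rad d : R := ball_radius d 1.

Definition hfar d : rel (Rn d) := fun x y => 2 * rad d < eucl_dist x y.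

Lemma hfar_sym d : symmetric (@hfar d).
Proof. by move=> x y; rewrite /hfar eucl_distC. Qed.

Lemma measurable_hfar d :
  measurable_fun setT (fun p : Rn d * Rn d => (hfar p.1 p.2)%:R : R).
Proof. exact: measurable_dist_gt. Qed.

Definition hint d k (phi : Rn d -> R) : \bar R := wint (vol d) (@hfar d) k phi.

Lemma activity_indic d (S : set (Rn d)) : measurable S ->
  activity (\1_S : Rn d -> R).
Proof. by move=> mS; split=> [|x]; [exact: measurable_indic|rewrite indicE]. Qed.

Lemma pairwise_hfarP d k (x : k.-tuple (Rn d)) :
  reflect (hard_core x) (pairwise (@hfar d) x).
Proof.
apply: (iffP idP) => [px i j ij|hx].
  have H (a b : 'I_k) : (a < b)%N -> hfar (tnth x a) (tnth x b).
    move=> ab; rewrite !(tnth_nth (@origin R d)).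
    move/(pairwiseP (@origin R d)): px => /(_ a b).
    by rewrite !inE !size_tuple !ltn_ord => /(_ isT isT ab).
  have [/H//|/H|/val_inj/eqP] := ltngtP i j; last by rewrite (negbTE ij).
  by rewrite hfar_sym.
case: k x hx => [|k] x hx; first by rewrite (tuple0 x).
apply/(pairwiseP (@origin R d)) => i j; rewrite !inE size_tuple => ik jk ij.
have := hx (Ordinal ik) (Ordinal jk); rewrite !(tnth_nth (@origin R d))/=; apply.
by rewrite -val_eqE/= neq_ltn ij.
Qed.

Lemma ZhatE d (S : set (Rn d)) k : measurable S ->
  Zhat S k = ((k`!%:R^-1)%:E * hint k (\1_S))%E.
Proof.
move=> mS; rewrite /Zhat; case: eqVneq => [->|k0].
  by rewrite invr1 mul1e.
congr (_ * _)%E; rewrite /hint -integral_hard_core_weight//; last exact: measurable_hfar.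
rewrite integral_mkcond; apply: eq_integral => x _.
rewrite patchE /hard_core_weight.
rewrite [in RHS]big_tuple -/(pairwise _ _).
case: ifPn => [/set_mem/= xS|/negP xS].
  rewrite big1 ?mul1r; last by move=> i _; rewrite indicE mem_set.
  rewrite indicE (_ : (x \in _) = pairwise (@hfar d) x)//.
  by apply/idP/idP => [/set_mem/pairwise_hfarP//|/pairwise_hfarP/mem_set].
have /existsNP[i xiS] : ~ (forall i, S (tnth x i)) by move=> h; apply/xS/mem_set.
by rewrite (bigD1 i)//= indicE memNset// !mul0r.
Qed.

Lemma hint_translate d k (b : Rn d) (phi : Rn d -> R) : activity phi ->
  hint k (phi \o affine_map 1 b) = hint k phi.
Proof.
move=> aphi; apply: wint_comp => //.
- exact: measurable_hfar.
- by move=> x y; rewrite /hfar eucl_dist_affine// mul1r.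
- by move=> f mf f0; exact: ge0_integral_translate.
Qed.

Lemma rad_gt0 d : (0 < d)%N -> 0 < rad d.
Proof. by move=> d0; have [] := @ball_radiusP R d 1 d0 ltr01. Qed.

Lemma vol_cball_rad d (x : Rn d) (c : R) : (0 < d)%N -> 0 < c ->
  vol d (eucl_cball x (c * rad d)) = (c ^+ d)%:E.
Proof.
move=> d0 c0; have [r0 r1] := @ball_radiusP R d 1 d0 ltr01.
by rewrite vol_cballE ?mulr_gt0// exprMn -mulrA r1 mulr1.
Qed.

Let sq_eucl_dist d (x y : Rn d) :
  eucl_dist x y ^+ 2 = \sum_(i < d) (tnth x i - tnth y i) ^+ 2.
Proof. by rewrite sqr_sqrtr// sumr_ge0// => i _; exact: sqr_ge0. Qed.

Let midpoint d (x y : Rn d) : Rn d := [tuple (tnth x i + tnth y i) / 2 | i < d].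

Let eucl_dist_midpoint d (v x u : Rn d) : eucl_dist (midpoint v x) u ^+ 2 =
  (eucl_dist v u ^+ 2 + eucl_dist x u ^+ 2) / 2 - eucl_dist v x ^+ 2 / 4.
Proof.
rewrite !sq_eucl_dist -big_split/= !mulr_suml -sumrB; apply: eq_bigr => i _.
by rewrite tnth_mktuple; field.
Qed.

(** Apollonius' identity at the midpoint [p] of [v] and [x]: [|pu|^2 = (|vu|^2 + |xu|^2) / 2 -
    |vx|^2 / 4]. As [|vu| <= |vx|], this is at most [|vx|^2 / 4 + |xu|^2 / 2 <= r^2 + 2 r^2]. Hence
    the factor [sqrt 3], against 2 for the full exclusion ball. *)
Let lens_in_ball d (v x u : Rn d) : eucl_dist v x <= 2 * rad d ->
  eucl_dist v u <= eucl_dist v x -> eucl_dist x u <= 2 * rad d ->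
  eucl_dist (midpoint v x) u <= Num.sqrt 3 * rad d.
Proof.
move=> vx vu xu.
have v0 := eucl_dist_ge0 v x; have u0 := eucl_dist_ge0 v u.
have x0 := eucl_dist_ge0 x u.
have r0 : 0 <= rad d by rewrite -(@pmulr_rge0 _ 2)// (le_trans v0 vx).
rewrite -(@ler_pXn2r _ 2)//= ?nnegrE ?eucl_dist_ge0 ?mulr_ge0 ?sqrtr_ge0//.
rewrite eucl_dist_midpoint exprMn (@sqr_sqrtr _ 3)//.
have h1 : eucl_dist v u ^+ 2 <= eucl_dist v x ^+ 2 by rewrite lerXn2r// nnegrE.
have h2 : eucl_dist v x ^+ 2 <= (2 * rad d) ^+ 2 by rewrite lerXn2r// nnegrE// mulr_ge0.
have h3 : eucl_dist x u ^+ 2 <= (2 * rad d) ^+ 2 by rewrite lerXn2r// nnegrE// mulr_ge0.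
by move: h2 h3; rewrite exprMn; lra.
Qed.

(* By symmetry, at twice the cost one may keep only the pairs whose second point
   is the closer one to [v]; that point is then in a ball of radius
   [sqrt 3 * rad d]. *)
Lemma local_pair_integral d (v : Rn d) (lam : R) (chi : Rn d -> R) :
  (0 < d)%N -> 0 <= lam -> activity chi ->
  (forall x, chi x <= lam * (~~ hfar v x)%:R) ->
  (\int[vol d]_x ((chi x)%:E * \int[vol d]_u (near_part (@hfar d) chi x u)%:E) <=
   (2 * lam * Num.sqrt 3 ^+ d)%:E * \int[vol d]_x (chi x)%:E)%E.
Proof.
move=> d0 lam0 [mchi chi0] chile.
have s30 : 0 < Num.sqrt 3 :> R by rewrite sqrtr_gt0.
pose c (x u : Rn d) : R := (eucl_dist v u <= eucl_dist v x)%R%:R.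
pose g (p : Rn d * Rn d) : R := chi p.1 * (chi p.2 * (~~ hfar p.1 p.2)%:R * c p.1 p.2).
have mfst : measurable_fun setT (fun p : Rn d * Rn d => p.1) by exact: measurable_fst.
have msnd : measurable_fun setT (fun p : Rn d * Rn d => p.2) by exact: measurable_snd.
have mc : measurable_fun setT (fun p : Rn d * Rn d => c p.1 p.2).
  rewrite /c (_ : (fun p => _) = (fun b : bool => b%:R : R) \o
    (fun p : Rn d * Rn d => eucl_dist v p.2 <= eucl_dist v p.1)); last by [].
  apply: measurableT_comp => //.
  by apply: measurable_fun_ler => //; apply: measurable_eucl_dist.
have mg : measurable_fun setT g.
  apply: measurable_funM; first exact: (measurableT_comp mchi).
  apply: measurable_funM => //; apply: measurable_funM.
    exact: (measurableT_comp mchi).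
  apply: measurable_near_pair => //; exact: measurable_hfar.
have g0 p : 0 <= g p by rewrite !mulr_ge0.
have mgE : measurable_fun setT (EFin \o g) by exact/measurable_EFinP.
have mg1 x : measurable_fun setT (fun u => (g (x, u))%:E).
  exact: (measurableT_comp mgE).
have mg2 x : measurable_fun setT (fun u => (g (u, x))%:E).
  exact: (measurableT_comp mgE).
have mF : measurable_fun setT (fun x => \int[vol d]_u (g (x, u))%:E)%E.
  exact: (measurable_fun_fubini_tonelli_F (EFin \o g)).
have mG : measurable_fun setT (fun x => \int[vol d]_u (g (u, x))%:E)%E.
  exact: (measurable_fun_fubini_tonelli_G (EFin \o g)).
have mn (x : Rn d) : measurable_fun setT (near_part (@hfar d) chi x).
  by case: (@activity_near_part _ _ _ _ (@measurable_hfar d) _ x (conj mchi chi0)).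
(* Of the two orders of a pair, at least one satisfies the constraint [c]. *)
have half x : ((chi x)%:E * \int[vol d]_u (near_part (@hfar d) chi x u)%:E <=
    \int[vol d]_u (g (x, u))%:E + \int[vol d]_u (g (u, x))%:E)%E.
  rewrite -ge0_integralZl//; last 3 first.
  - exact/measurable_EFinP.
  - by move=> u _; rewrite lee_fin mulr_ge0.
  - by rewrite lee_fin.
  rewrite -ge0_integralD//; last 2 first.
  - by move=> u _; rewrite lee_fin.
  - by move=> u _; rewrite lee_fin.
  apply: ge0_le_integral; first exact: measurableT.
  - by move=> u _; rewrite mule_ge0// lee_fin// mulr_ge0.
  - by apply: emeasurable_funM; [exact: measurable_cst|exact/measurable_EFinP].
  - by apply: emeasurable_funD; [exact: mg1|exact: mg2].
  move=> u _; rewrite -EFinM -EFinD lee_fin /near_part /g/= [hfar u x]hfar_sym.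
  rewrite [X in _ + X](_ : _ = chi x * (chi u * (~~ hfar x u)%:R * c u x)); last by ring.
  rewrite -mulrDr ler_wpM2l// -mulrDr ler_peMr// ?mulr_ge0//.
  by rewrite /c; have [|/ltW ->] := leP (eucl_dist v u) (eucl_dist v x); rewrite ?lerDl ?lerDr.
(* For fixed [x] the surviving [u] lie in the ball around the midpoint of [v] and [x], whose volume
   is [sqrt 3 ^+ d] because a ball of radius [rad d] has volume 1. *)
have inner x : (\int[vol d]_u (g (x, u))%:E <=
    (lam * Num.sqrt 3 ^+ d)%:E * (chi x)%:E)%E.
  have [chix|chix] := eqVneq (chi x) 0.
    by rewrite chix mule0 integral0_eq// => u _; rewrite /g/= chix mul0r.
  have vx : eucl_dist v x <= 2 * rad d.
    rewrite leNgt; apply/negP => h; move: (chile x); rewrite /hfar h mulr0 => h'.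
    by move/eqP: chix; apply; apply/eqP; rewrite eq_le h' chi0.
  pose B := eucl_cball (midpoint v x) (Num.sqrt 3 * rad d).
  have mB : measurable B by exact: measurable_eucl_cball.
  apply: (@le_trans _ _ (\int[vol d]_u ((chi x * lam)%:E * (\1_B u)%:E))%E).
    apply: ge0_le_integral => //.
    - by move=> u _; rewrite lee_fin.
    - by apply: emeasurable_funM => //; apply/measurable_EFinP; exact: measurable_indic.
    move=> u _; rewrite -EFinM lee_fin /g/= -!mulrA ler_wpM2l//.
    rewrite /c /hfar -leNgt.
    case: (leP (eucl_dist x u) (2 * rad d)) => xu; last first.
      by rewrite !(mul0r, mulr0) mulr_ge0.
    case: (leP (eucl_dist v u) (eucl_dist v x)) => vu; last first.
      by rewrite !mulr0 mulr_ge0.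
    rewrite indicE mem_set ?mulr1; last exact: lens_in_ball.
    by apply: (le_trans (chile u)); rewrite ler_piMr// lern1 leq_b1.
  rewrite ge0_integralZl//; last 2 first.
  - by apply/measurable_EFinP; exact: measurable_indic.
  - by rewrite lee_fin mulr_ge0.
  rewrite integral_indic// setIT.
  rewrite [X in (_ * X <= _)%E](_ : _ = (Num.sqrt 3 ^+ d)%:E); last first.
    exact: vol_cball_rad.
  rewrite -!EFinM lee_fin.
  by rewrite mulrAC [X in _ <= X]mulrC -mulrA [lam * _]mulrC mulrA.
have [F1 F1E] : {f : Rn d -> \bar R | f = fun x => (\int[vol d]_u (g (x, u))%:E)%E} by eexists.
have [F2 F2E] : {f : Rn d -> \bar R | f = fun x => (\int[vol d]_u (g (u, x))%:E)%E} by eexists.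
have mF1 : measurable_fun setT F1 by rewrite F1E; exact: mF.
have mF2 : measurable_fun setT F2 by rewrite F2E; exact: mG.
have F10 x : (0 <= F1 x)%E by rewrite F1E; apply: integral_ge0 => u _; rewrite lee_fin.
have F20 x : (0 <= F2 x)%E by rewrite F2E; apply: integral_ge0 => u _; rewrite lee_fin.
have halfF x : ((chi x)%:E * \int[vol d]_u (near_part (@hfar d) chi x u)%:E <=
    F1 x + F2 x)%E by rewrite F1E F2E; exact: half.
have innerF x : (F1 x <= (lam * Num.sqrt 3 ^+ d)%:E * (chi x)%:E)%E.
  by rewrite F1E; exact: inner.
have swapF : (\int[vol d]_x F2 x = \int[vol d]_x F1 x)%E.
  by rewrite F1E F2E; apply: esym; exact: (fubini_tonelli (EFin \o g)).
have mchiE : measurable_fun setT (EFin \o chi) by exact/measurable_EFinP.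
have near0 x : (0 <= \int[vol d]_u (near_part (@hfar d) chi x u)%:E)%E.
  by apply: integral_ge0 => u _; rewrite lee_fin mulr_ge0.
have mnear : measurable_fun setT
    (fun x => \int[vol d]_u (near_part (@hfar d) chi x u)%:E)%E.
  apply: (measurable_fun_fubini_tonelli_F (fun p => (near_part (@hfar d) chi p.1 p.2)%:E)).
    apply/measurable_EFinP; apply: measurable_funM; first exact: (measurableT_comp mchi).
    by apply: measurable_near_pair => //; exact: measurable_hfar.
  by move=> p; rewrite lee_fin mulr_ge0.
have ls0 : 0 <= lam * Num.sqrt 3 ^+ d by rewrite mulr_ge0// exprn_ge0// ltW.
clear half inner mF mG mn F1E F2E mg mgE mg1 mg2.
have I1 : (\int[vol d]_x F1 x <=
    (lam * Num.sqrt 3 ^+ d)%:E * \int[vol d]_x (chi x)%:E)%E.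
  rewrite -ge0_integralZl//; last by move=> x _; rewrite lee_fin.
  apply: ge0_le_integral; [exact: measurableT|by []|exact: mF1| |by []].
  exact: measurable_funeM.
apply: (@le_trans _ _ (\int[vol d]_x (F1 x + F2 x))%E).
  apply: ge0_le_integral; [exact: measurableT| | | |by []].
  - by move=> x _; apply: mule_ge0; [rewrite lee_fin|exact: near0].
  - exact: emeasurable_funM.
  - exact: emeasurable_funD.
rewrite ge0_integralD// swapF.
rewrite (_ : 2 * lam * _ = lam * Num.sqrt 3 ^+ d + lam * Num.sqrt 3 ^+ d); last by ring.
by rewrite EFinD ge0_muleDl ?lee_fin//; exact: leeD.
Qed.

End hard_spheres.

(** * Partition functions of bounded regions *)

Section partition_functions.
Context {R : realType}.
Local Notation Rn d := (d.-tuple (measurableTypeR R)).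

Definition bounded_region d (S : set (Rn d)) :=
  measurable S /\ exists2 rho : R, 0 < rho & S `<=` eucl_cball (@origin R d) rho.

Definition zhat d (S : set (Rn d)) k : R := fine (Zhat S k).

Lemma bounded_region_vol d (S : set (Rn d)) : bounded_region S ->
  exists2 V : R, 0 <= V & vol d S = V%:E.
Proof.
move=> [mS [rho r0 Srho]]; exists (fine (vol d S)); first exact: fine_ge0.
rewrite fineK// ge0_fin_numE//; apply: (@le_lt_trans _ _ (vol d (eucl_cball (@origin R d) rho))).
  by apply: le_measure; rewrite ?inE//; exact: measurable_eucl_cball.
by rewrite vol_cballE// ltry.
Qed.

Lemma bounded_regionU d (S S' : set (Rn d)) :
  bounded_region S -> bounded_region S' -> bounded_region (S `|` S').
Proof.
move=> [mS [r r0 Sr]] [mS' [r' r0' Sr']]; split; first exact: measurableU.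
exists (r + r'); first exact: addr_gt0.
by move=> x [/Sr|/Sr']; rewrite /eucl_cball/= => /le_trans; apply;
  rewrite ?lerDl ?lerDr ltW.
Qed.

Lemma bounded_region_set0 d : bounded_region (set0 : set (Rn d)).
Proof. by split => //; exists 1. Qed.

Let integral_indic_region d (S : set (Rn d)) (V : R) : measurable S ->
  vol d S = V%:E -> (\int[vol d]_x (\1_S x)%:E = V%:E)%E.
Proof. by move=> mS VS; rewrite integral_indic// setIT. Qed.

Let hint_fin d (S : set (Rn d)) k : bounded_region S ->
  hint k (\1_S : Rn d -> R) \is a fin_num.
Proof.
move=> bS; have [V V0 VS] := bounded_region_vol bS; have [mS _] := bS.
have aS := activity_indic mS.
rewrite ge0_fin_numE; last exact: (wint_ge0 _ (@measurable_hfar R d)).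
apply: (@le_lt_trans _ _ (V ^+ k)%:E); last exact: ltry.
apply: wint_le_expr => //; first exact: measurable_hfar.
by rewrite (integral_indic_region mS VS).
Qed.

Lemma ZhatEfin d (S : set (Rn d)) k : bounded_region S -> Zhat S k = (zhat S k)%:E.
Proof.
move=> bS; have [mS _] := bS; rewrite fineK// ZhatE// fin_numM//.
exact: hint_fin.
Qed.

Lemma hintE d (S : set (Rn d)) k : bounded_region S ->
  hint k (\1_S : Rn d -> R) = (k`!%:R * zhat S k)%:E.
Proof.
move=> bS; have [mS _] := bS; rewrite EFinM -ZhatEfin// ZhatE// muleA -EFinM.
by rewrite mulfV ?mul1e// pnatr_eq0 -lt0n fact_gt0.
Qed.

Lemma zhat_ge0 d (S : set (Rn d)) k : bounded_region S -> 0 <= zhat S k.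
Proof.
move=> [mS bS]; rewrite fine_ge0// ZhatE// mule_ge0 ?lee_fin//.
exact: (wint_ge0 _ (@measurable_hfar R d) _ (activity_indic mS)).
Qed.

Lemma zhat0 d (S : set (Rn d)) : zhat S 0 = 1.
Proof. by []. Qed.

Lemma le_zhat d (S S' : set (Rn d)) k : bounded_region S -> bounded_region S' ->
  S `<=` S' -> zhat S k <= zhat S' k.
Proof.
move=> bS bS' SS'; rewrite -lee_fin -!ZhatEfin//.
have [mS _] := bS; have [mS' _] := bS'.
rewrite !ZhatE//; apply: lee_wpmul2l; first by rewrite lee_fin.
apply: le_wint; [exact: measurable_hfar|exact: activity_indic..|].
by move=> x; rewrite !indicE ler_nat; have [/set_mem/SS'/mem_set ->|] := boolP (x \in S).
Qed.

Lemma zhat_le d (S : set (Rn d)) (V : R) k : bounded_region S -> vol d S = V%:E ->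
  zhat S k <= V ^+ k / k`!%:R.
Proof.
move=> bS VS; have [mS _] := bS.
rewrite ler_pdivlMr ?ltr0n ?fact_gt0// mulrC -lee_fin -hintE//.
apply: wint_le_expr; [exact: measurable_hfar|exact: activity_indic|].
by rewrite (integral_indic_region mS VS).
Qed.

Lemma zhat_gt0_le d (S : set (Rn d)) k k' : bounded_region S -> (k <= k')%N ->
  0 < zhat S k' -> 0 < zhat S k.
Proof.
move=> bS kk' zk'; rewrite lt_def zhat_ge0// andbT; apply/eqP => zk.
have [V V0 VS] := bounded_region_vol bS; have [mS _] := bS.
have : hint k' (\1_S : Rn d -> R) = 0.
  apply: (@wint_eq0_le _ _ _ _ _ _ k k' _ V) => //.
  - exact: measurable_hfar.
  - by rewrite (integral_indic_region mS VS).
  - by have := hintE k bS; rewrite zk mulr0.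
rewrite hintE// => -[] /eqP; rewrite mulf_eq0 (gt_eqF zk') orbF.
by rewrite pnatr_eq0 -leqn0 leqNgt fact_gt0.
Qed.

Lemma zhat_separated d (S S' : set (Rn d)) m l : bounded_region S -> bounded_region S' ->
  (forall x y, S x -> S' y -> hfar x y) ->
  zhat S m * zhat S' l <= zhat (S `|` S') (m + l).
Proof.
move=> bS bS' sep; have bU := bounded_regionU bS bS'.
have [mS _] := bS; have [mS' _] := bS'.
rewrite -lee_fin EFinM -!ZhatEfin// !ZhatE//; last by case: bU.
apply: le_trans (wint_separated (vol d) (@measurable_hfar R d) (@hfar_sym R d)
  m l (activity_indic mS) (activity_indic mS') _) _.
  move=> x y; rewrite !indicE !pnatr_eq0 !eqb0 !negbK => /set_mem Sx /set_mem Sy.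
  exact: sep.
apply: lee_wpmul2l; first by rewrite lee_fin.
apply: le_wint; [exact: measurable_hfar| |exact: activity_indic (measurableU _ _ mS mS')|].
  by apply: activityD; exact: activity_indic.
move=> x; rewrite /= !indicE -natrD ler_nat.
have [xS|xS] := boolP (x \in S); have [xS'|xS'] := boolP (x \in S').
(* No point lies in both regions: it would be farther than [2 * rad d] from itself. Dimension 0 is
   allowed here, so nonnegativity of [rad d] is read off [xget], whose default is 0. *)
- exfalso; have := sep _ _ (set_mem xS) (set_mem xS').
  rewrite /hfar eucl_distxx => h; have : 0 <= 2 * rad d :> R.
    by rewrite mulr_ge0// /rad /ball_radius; case: xgetP => [y -> []|].
  by rewrite leNgt h.
- by rewrite mem_set//; left; exact: set_mem.
- by rewrite mem_set//; right; exact: set_mem.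
- by [].
Qed.

Lemma zhat_bigU (I : choiceType) d (F : I -> set (Rn d)) (kk : I -> nat) (s : seq I) :
  uniq s -> (forall i, i \in s -> bounded_region (F i)) ->
  (forall i j, i \in s -> j \in s -> i != j ->
    forall x y, F i x -> F j y -> hfar x y) ->
  bounded_region (\big[setU/set0]_(i <- s) F i) /\
  \prod_(i <- s) zhat (F i) (kk i) <=
    zhat (\big[setU/set0]_(i <- s) F i) (\sum_(i <- s) kk i)%N.
Proof.
elim: s => [_ _ _|i s IH /= /andP[iNs us] bF sep].
  by rewrite !big_nil zhat0; split => //; exact: bounded_region_set0.
have [] := IH us; first by move=> j js; apply: bF; rewrite inE js orbT.
  by move=> j k js ks; apply: sep; rewrite inE ?js ?ks orbT.
move=> bU le; have bi : bounded_region (F i) by apply: bF; rewrite mem_head.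
rewrite !big_cons; split; first exact: bounded_regionU.
apply: (@le_trans _ _ (zhat (F i) (kk i) *
    zhat (\big[setU/set0]_(i <- s) F i) (\sum_(i <- s) kk i)%N)).
  by rewrite ler_wpM2l// zhat_ge0.
apply: zhat_separated => // x y Fix.
rewrite -bigcup_seq => -[j js Fjy]; apply: (sep i j) => //.
- exact: mem_head.
- by rewrite inE; apply/orP; right.
- by apply/eqP => ij; move: iNs; rewrite ij js.
Qed.

Lemma measurable_affine_preimage d (a : R) (b : Rn d) (S : set (Rn d)) :
  measurable S -> measurable (affine_map a b @^-1` S).
Proof.
by move=> mS; rewrite -[X in measurable X]setTI; exact: measurable_affine_map.
Qed.

Lemma Zhat_translate d (b : Rn d) (S : set (Rn d)) k : measurable S ->
  Zhat (affine_map 1 b @^-1` S) k = Zhat S k.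
Proof.
move=> mS; rewrite !ZhatE//; last exact: measurable_affine_preimage.
congr (_ * _)%E; rewrite -[RHS](hint_translate k b (activity_indic mS)).
by congr hint; apply/funext => x; rewrite !indicE/=; congr (_%:R); apply/idP/idP => /set_mem h; exact/mem_set.
Qed.

Lemma vol_disjoint_balls d (s : seq (Rn d)) : (0 < d)%N -> pairwise (@hfar R d) s ->
  vol d (\big[setU/set0]_(c <- s) eucl_cball c (rad d)) = (size s)%:R%:E.
Proof.
move=> d0; have v1 c : vol d (eucl_cball c (rad d)) = 1%:E :> \bar R.
  by rewrite -[X in eucl_cball _ X]mul1r vol_cball_rad// expr1n.
elim: s => [_|c s IH /= /andP[/allP cs ps]]; first by rewrite big_nil measure0.
rewrite big_cons measureU.
- rewrite [X in (X + _)%E](_ : _ = 1%:E); last exact: v1.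
  rewrite [X in (_ + X)%E](_ : _ = (size s)%:R%:E); last exact: IH.
  by rewrite -EFinD -natr1 addrC.
- exact: measurable_eucl_cball.
- by apply: bigsetU_measurable => i _; exact: measurable_eucl_cball.
apply/seteqP; split => // x [xc]; rewrite -bigcup_seq => -[e /cs + xe].
rewrite /hfar ltNge => /negP; apply.
apply: (le_trans (eucl_dist_triangle c x e)); rewrite mulr2n mulrDl mul1r.
by rewrite lerD// eucl_distC.
Qed.

(** Spheres of radius [rad d] have volume 1, so their number is the volume of their union, which
    lies in the ball enlarged by [rad d]. *)
Lemma size_packing_in_ball d (s : seq (Rn d)) (x : Rn d) (rho : R) : (0 < d)%N -> 0 < rho ->
  pairwise (@hfar R d) s -> (forall c, c \in s -> eucl_cball x rho c) ->
  (size s)%:R <= (rho + rad d) ^+ d * unit_ball_vol d :> R.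
Proof.
move=> d0 r0 ps sx; have rad0 := @rad_gt0 R d d0.
rewrite -lee_fin -(vol_disjoint_balls d0 ps) -(vol_cballE x) ?addr_gt0//.
apply: le_measure; rewrite ?inE.
- by apply: bigsetU_measurable => i _; exact: measurable_eucl_cball.
- exact: measurable_eucl_cball.
move=> y; rewrite -bigcup_seq => -[c /sx xc cy].
by apply: (le_trans (eucl_dist_triangle x c y)); exact: lerD.
Qed.

Lemma zhat_gt0_config d (S : set (Rn d)) k : measurable S -> Zhat S k != 0%E ->
  exists s : seq (Rn d), [/\ size s = k, pairwise (@hfar R d) s &
    forall c, c \in s -> S c].
Proof.
move=> mS zk; have [|s [sk ps /allP sS]] :=
    @wint_neq0 _ _ R (vol d) _ (@measurable_hfar R d) k _ (activity_indic mS).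
  by apply: contra zk => /eqP h; rewrite ZhatE// /hint h mule0.
exists s; split=> // c /sS; rewrite indicE pnatr_eq0 eqb0 negbK; exact: set_mem.
Qed.

Lemma zhat_gt0_size d (S : set (Rn d)) k (x : Rn d) (rho : R) : (0 < d)%N -> 0 < rho ->
  measurable S -> S `<=` eucl_cball x rho -> Zhat S k != 0%E ->
  k%:R <= (rho + rad d) ^+ d * unit_ball_vol d :> R.
Proof.
move=> d0 r0 mS Sx /(zhat_gt0_config mS)[s [<- ps sS]].
by apply: (size_packing_in_ball d0 r0 ps) => c /sS/Sx; apply.
Qed.

(** The occupancy inequality for the constant activity [lam] on [S]: [D = lam 2^d] since the
    exclusion ball has volume [2^d], and [q] is the lens bound. Dividing by the coefficient of
    [insert] bounds the mean number of points below by [a V], so some term at or above [a V - 1] is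
    heavy. *)
Lemma zhat_heavy d (S : set (Rn d)) (V lam y : R) K : (0 < d)%N ->
  bounded_region S -> vol d S = V%:E -> 0 < lam -> 0 <= y ->
  (forall k, (K <= k)%N -> Zhat S k = 0%E) ->
  let q := 2 * lam * Num.sqrt 3 ^+ d in
  let a := (1 + y) / (expR y / lam + expR q * 2 ^+ d) in
  1 <= a * V ->
  exists k : nat, [/\ (k < K)%N, a * V - 1 <= k%:R &
    (K%:R ^+ 2)^-1 <= lam ^+ k * zhat S k].
Proof.
move=> d0 bS VS lam0 y0 zK q a aV1.
have [mS _] := bS; have aS := activity_indic mS.
have q0 : 0 <= q by rewrite !mulr_ge0// ?exprn_ge0 ?sqrtr_ge0// ltW.
have K0 : (0 < K)%N.
  by rewrite lt0n; apply/eqP => K0; have := zK 0%N; rewrite K0 => /(_ isT) [] /eqP; rewrite oner_eq0.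
pose phi : Rn d -> R := fun x => lam * \1_S x.
have aphi : activity phi.
  split=> [|x]; first by apply: measurable_funM => //; case: aS.
  by rewrite mulr_ge0// ltW.
have phiE k : hint k phi = ((k`!%:R * (lam ^+ k * zhat S k))%:E).
  rewrite /hint wint_scale//; [|exact: measurable_hfar|exact: ltW].
  by rewrite -/(hint _ _) hintE// -EFinM mulrCA.
have intphi : (\int[vol d]_x (phi x)%:E = (lam * V)%:E)%E.
  rewrite /phi; under eq_integral do rewrite EFinM.
  rewrite ge0_integralZl//; last 2 first.
  - by apply/measurable_EFinP; exact: measurable_indic.
  - by rewrite lee_fin ltW.
  by rewrite (integral_indic_region mS VS).
have phi0 k : (K <= k)%N -> hint k phi = 0%E.
  by move=> /zK zk; rewrite phiE /zhat zk /= !mulr0.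
have D x : (\int[vol d]_u (near_part (@hfar R d) phi x u)%:E <= (lam * 2 ^+ d)%:E)%E.
  pose B := eucl_cball x (2 * rad d).
  have mB : measurable B by exact: measurable_eucl_cball.
  apply: (@le_trans _ _ (\int[vol d]_u (lam%:E * (\1_B u)%:E))%E).
    have [mn n0] := activity_near_part (@measurable_hfar R d) x aphi.
    apply: ge0_le_integral => //.
    - by move=> u _; rewrite lee_fin.
    - exact/measurable_EFinP.
    - by apply: emeasurable_funM => //; apply/measurable_EFinP; exact: measurable_indic.
    move=> u _; rewrite -EFinM lee_fin /near_part /phi -mulrA ler_wpM2l ?(ltW lam0)//.
    rewrite !indicE /hfar -leNgt -natrM ler_nat mulnb.
    by case: leP => [xu|_]; [rewrite (@mem_set _ B)// leq_b1|rewrite andbF].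
  rewrite ge0_integralZl//; last 2 first.
  - by apply/measurable_EFinP; exact: measurable_indic.
  - by rewrite lee_fin ltW.
  rewrite integral_indic// setIT.
  rewrite [X in (_ * X <= _)%E](_ : _ = (2 ^+ d)%:E); last exact: vol_cball_rad.
  by rewrite -EFinM.
have Q v chi : activity chi -> (forall x, chi x <= near_part (@hfar R d) phi v x) ->
    (\int[vol d]_x ((chi x)%:E * \int[vol d]_u (near_part (@hfar R d) chi x u)%:E) <=
    q%:E * \int[vol d]_x (chi x)%:E)%E.
  move=> achi chile; apply: (@local_pair_integral R d v) => //; first exact: ltW.
  move=> x; apply: (le_trans (chile x)); rewrite /near_part /phi ler_wpM2r//.
  by rewrite ler_piMr ?(ltW lam0)// indicE lern1 leq_b1.
have occ := @Zsum_occupancy _ _ R (vol d) _ (@measurable_hfar R d) (@hfar_sym R d)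
  K phi (lam * V) q y (lam * 2 ^+ d) q0 y0 aphi intphi phi0 D Q.
have c0 : 0 < 1 + expR (q - y) * (lam * 2 ^+ d).
  by rewrite addr_gt0// !mulr_gt0// ?expR_gt0 ?exprn_gt0.
have hm : ((a * V - 1 + 1)%:E * Zsum (vol d) (@hfar R d) K phi <=
    insert (vol d) (@hfar R d) (Zsum (vol d) (@hfar R d) K) phi)%E.
  rewrite subrK -(@lee_pmul2l _ (1 + expR (q - y) * (lam * 2 ^+ d))%:E)//.
  rewrite muleA -EFinM; apply: le_trans occ.
  rewrite le_eqVlt; apply/orP; left; apply/eqP; congr (_%:E * _)%E.
  have y1 := expR_gt0 y; have q1 := expR_gt0 q.
  have D0 : 0 < expR y / lam + expR q * 2 ^+ d.
    by rewrite addr_gt0 ?divr_gt0// mulr_gt0// exprn_gt0.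
  (* Multiplying numerator and denominator by [exp y / lam] brings the quotient [exp(-y) (1 + y) lam
     / (1 + exp(q - y) lam 2^d)] to the form of [a]. *)
  have D1 : expR y / lam + expR q * 2 ^+ d =
      expR y / lam * (1 + expR (q - y) * (lam * 2 ^+ d)).
    by rewrite expRB; field; rewrite !gt_eqF.
  rewrite /a D1 expRN; field.
  by rewrite !gt_eqF//.
have [||k [kK ak hk]] := @exists_heavy_term _ _ R (vol d) _ (@measurable_hfar R d)
  K phi (lam * V) (a * V - 1) aphi K0 _ (phi0 K (leqnn K)) hm.
- by rewrite intphi.
- by rewrite subr_ge0.
exists k; split => //; move: hk; rewrite -/(hint k phi) phiE -EFinM lee_fin.
by rewrite mulKf// pnatr_eq0 -lt0n fact_gt0.
Qed.

End partition_functions.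

(** * Lattice cells *)

Section cells.
Context {R : realType}.
Local Notation Rn d := (d.-tuple (measurableTypeR R)).

(** Half-open, so that the cells of side [L] tile space exactly. *)
Definition cube d (c : 'I_d -> R) (L : R) : set (Rn d) :=
  [set t | forall i, c i <= tnth t i < c i + L].

Definition gap d : R := 3 * rad d.

Definition cell d (L : R) (j : d.-tuple int) : set (Rn d) :=
  cube (fun i => (tnth j i)%:~R * L) L.

(* Points of the cores of two distinct cells are more than [2 * rad d] apart. *)
Definition core d (L : R) (j : d.-tuple int) : set (Rn d) :=
  cube (fun i => (tnth j i)%:~R * L) (L - gap d).

(** The points stay in the core, whereas densities are measured against the full cell, of volume
    [L ^+ d]. *)
Definition zcell d (L : R) k : R := zhat (@cube d (fun=> 0) (L - gap d)) k.

Lemma bounded_region_cube d (c : 'I_d -> R) (L : R) : bounded_region (cube c L).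
Proof.
split; first exact: measurable_cube.
pose B := \sum_(i < d) `|c i| + `|L| + 1.
have B0 : 0 < B by rewrite ltr_wpDl// addr_ge0// sumr_ge0.
exists (d%:R * B + 1); first by rewrite ltr_wpDl// mulr_ge0// ltW.
move=> t ht; rewrite /eucl_cball/= (@le_trans _ _ (d%:R * B))// ?lerDl//.
apply: eucl_dist_le => [|i]; first exact: ltW.
rewrite tnth_mktuple sub0r normrN.
have ci : `|c i| <= \sum_(i < d) `|c i|.
  by rewrite (bigD1 i)//= lerDl sumr_ge0.
have := ht i; have := ler_norm L; have := ler_norm (c i); have := ler_norm (- c i).
rewrite normrN ler_norml /B; lra.
Qed.

Lemma zhat_cube d (c : 'I_d -> R) (L : R) k :
  zhat (cube c L) k = zhat (@cube d (fun=> 0) L) k.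
Proof.
rewrite /zhat -(Zhat_translate [tuple c i | i < d] _ (measurable_cube c L)).
congr (fine (Zhat _ _)); apply/seteqP; split => t /= h i; have := h i;
  rewrite !tnth_mktuple mul1r add0r; lra.
Qed.

Lemma cube_dist d (c : 'I_d -> R) (L : R) (x y : Rn d) : 0 <= L ->
  cube c L x -> cube c L y -> eucl_dist x y <= d%:R * L.
Proof.
move=> L0 hx hy; apply: eucl_dist_le => // i.
by have := hx i; have := hy i; rewrite ler_norml; lra.
Qed.

Lemma core_sub_cell d (L : R) (j : d.-tuple int) : (0 < d)%N -> core L j `<=` cell L j.
Proof.
move=> d0 t h i; have := h i; have := @rad_gt0 R d d0; rewrite /gap; lra.
Qed.

Lemma cell_inj d (L : R) (j j' : d.-tuple int) (t : Rn d) : 0 < L ->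
  cell L j t -> cell L j' t -> j = j'.
Proof.
move=> L0 h h'; apply: eq_from_tnth => i.
have fl (a : int) : a%:~R * L <= tnth t i < a%:~R * L + L -> Num.floor (tnth t i / L) = a.
  move=> /andP[h1 h2]; apply: floor_def; rewrite ler_pdivlMr// ltr_pdivrMr//.
  by rewrite h1 intrD mulrDl mul1r.
by rewrite -(fl _ (h i)) (fl _ (h' i)).
Qed.

Lemma mem_cell d (L : R) (t : Rn d) : 0 < L ->
  cell L [tuple Num.floor (tnth t i / L) | i < d] t.
Proof.
move=> L0 i; rewrite tnth_mktuple.
have /andP[h1 h2] := floor_itv (tnth t i / L).
move: h1 h2; rewrite ler_pdivlMr// ltr_pdivrMr// intrD mulrDl mul1r.
by move=> -> ->.
Qed.

Lemma core_separated d (L : R) (j j' : d.-tuple int) (x y : Rn d) :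
  (0 < d)%N -> 0 < L -> j != j' -> core L j x -> core L j' y -> hfar x y.
Proof.
move=> d0 L0 jj' hx hy; have r0 := @rad_gt0 R d d0.
have [i ji] : exists i, tnth j i != tnth j' i.
  apply/existsP; rewrite -negb_forall; apply: contra jj' => /forallP h.
  by apply/eqP/eq_from_tnth => i; exact/eqP/h.
have step (a b : int) : (a < b)%R -> a%:~R * L + L <= b%:~R * L.
  move=> ab; rewrite -{2}[L]mul1r -mulrDl ler_wpM2r ?(ltW L0)//.
  by rewrite -(intrD _ a 1) ler_int -lezD1 in ab *.
rewrite /hfar; apply: lt_le_trans (coord_le_eucl_dist x y i).
have := hx i; have := hy i; rewrite /gap.
have [/step h|/step h|h] := ltgtP (tnth j i) (tnth j' i); last by rewrite h eqxx in ji.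
  by move=> h1 h2; rewrite lter_normr; apply/orP; right; lra.
by move=> h1 h2; rewrite lter_normr; apply/orP; left; lra.
Qed.

Lemma vol_cells d (L : R) (js : seq (d.-tuple int)) : 0 < L -> uniq js ->
  vol d (\big[setU/set0]_(j <- js) cell L j) = ((size js)%:R * L ^+ d)%:E.
Proof.
move=> L0; elim: js => [|j js IH /= /andP[jjs ujs]].
  by rewrite big_nil measure0 mul0r.
rewrite big_cons measureU.
- rewrite [X in (X + _)%E](_ : _ = (L ^+ d)%:E); last exact: (vol_box _ (ltW L0)).
  rewrite [X in (_ + X)%E](_ : _ = ((size js)%:R * L ^+ d)%:E); last exact: IH.
  by rewrite -EFinD -[in RHS]natr1 mulrDl mul1r addrC.
- exact: measurable_cube.
- by apply: bigsetU_measurable => i _; exact: measurable_cube.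
apply/seteqP; split => // t [tj]; rewrite -bigcup_seq => -[k /= + tk].
by rewrite -(cell_inj L0 tj tk) (negbTE jjs).
Qed.

(** The indices of the cells that tile [[- M L, M L)^d]. *)
Definition index_box d (M : nat) : seq (d.-tuple int) :=
  [seq [tuple (f i : nat)%:Z - M%:Z | i < d] | f : {ffun 'I_d -> 'I_(2 * M)}].

Lemma size_index_box d M : size (index_box d M) = ((2 * M) ^ d)%N.
Proof. by rewrite size_map -cardE card_ffun !card_ord. Qed.

Lemma uniq_index_box d M : uniq (index_box d M).
Proof.
rewrite map_inj_uniq ?enum_uniq// => f g /(congr1 (fun t => tnth t)) fg.
apply/ffunP => i; apply: val_inj; have := congr1 (fun h => h i) fg.
by rewrite !tnth_mktuple => /addIr [].
Qed.

Lemma mem_index_box d M (j : d.-tuple int) :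
  (j \in index_box d M) = [forall i, - M%:Z <= tnth j i < M%:Z].
Proof.
apply/mapP/forallP => [[f _ ->] i|h].
  rewrite tnth_mktuple lerBrDr addrC subrr ltrBlDr -PoszD; apply/andP; split => //.
  by rewrite ltz_nat addnn -mul2n.
have h' i : exists m : nat, tnth j i + M%:Z = m /\ (m < 2 * M)%N.
  have /andP[h1 h2] := h i; exists (absz (tnth j i + M%:Z)).
  rewrite gez0_abs -?lerBlDr ?sub0r//; split => //.
  by rewrite -ltz_nat gez0_abs -?lerBlDr ?sub0r// mul2n -addnn PoszD ltrD2r.
pose f := [ffun i => Ordinal (projT2 (cid (h' i))).2].
exists f; first by rewrite mem_enum.
apply: eq_from_tnth => i; rewrite tnth_mktuple ffunE/=.
by case: cid => m [/= <- _]; rewrite addrK.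
Qed.

(** A cell has diameter at most [d L], so every cell meeting the ball of radius [rho - d L] is
    inside the ball of radius [rho], and these cells cover the smaller ball. *)
Lemma cells_in_ball d (L rho : R) : 0 < L -> d%:R * L < rho ->
  exists js : seq (d.-tuple int), [/\ uniq js,
    (forall j, j \in js -> cell L j `<=` eucl_cball (origin d) rho) &
    (rho - d%:R * L) ^+ d * unit_ball_vol d <= (size js)%:R * L ^+ d].
Proof.
move=> L0 dL; have rho0 : 0 < rho by rewrite (le_lt_trans _ dL)// mulr_ge0// ltW.
pose M := (Num.truncn (rho / L)).+1.
have rM : rho < M%:R * L by rewrite -ltr_pdivrMr// truncnS_gt.
pose js := [seq j <- index_box d M | `[< cell L j `<=` eucl_cball (origin d) rho >]].
have ujs : uniq js by rewrite filter_uniq// uniq_index_box.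
exists js; split => //.
  by move=> j; rewrite mem_filter => /andP[/asboolP].
rewrite -lee_fin -(vol_cballE (origin d)) ?subr_gt0// -vol_cells//.
apply: le_measure; rewrite ?inE.
- exact: measurable_eucl_cball.
- by apply: bigsetU_measurable => i _; exact: measurable_cube.
move=> t ht; rewrite -bigcup_seq.
pose j := [tuple Num.floor (tnth t i / L) | i < d].
have tj : cell L j t by exact: mem_cell.
exists j => //=; rewrite mem_filter; apply/andP; split.
  apply/asboolP => u uj; rewrite /eucl_cball/=.
  apply: (le_trans (eucl_dist_triangle _ t _)).
  by rewrite -lerBrDr (le_trans ht)// lerB// (cube_dist (ltW L0) tj uj).
rewrite mem_index_box; apply/forallP => i.
have := le_trans (coord_le_eucl_dist (origin d) t i) ht.
rewrite tnth_mktuple sub0r normrN ler_norml => /andP[h1 h2].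
have dL0 : 0 <= d%:R * L by rewrite mulr_ge0// ltW.
rewrite tnth_mktuple floor_ge_int floor_lt_int ler_pdivlMr// ltr_pdivrMr//.
by rewrite mulrNz mulNr; apply/andP; split; lra.
Qed.

(** The discarded cells meet the ball of radius [rho], hence lie in the ball of radius [rho + d L];
    this bounds their total volume. *)
Lemma cells_off_ball d (L rho : R) M : 0 < L -> 0 < rho ->
  exists js : seq (d.-tuple int), [/\ uniq js,
    {subset js <= index_box d M},
    (forall j t, j \in js -> cell L j t -> rho < eucl_dist (origin d) t) &
    (2 * M%:R * L) ^+ d <=
      (size js)%:R * L ^+ d + (rho + d%:R * L) ^+ d * unit_ball_vol d].
Proof.
move=> L0 rho0.
pose P (j : d.-tuple int) := `[< exists2 t, cell L j t & eucl_dist (origin d) t <= rho >].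
exists [seq j <- index_box d M | ~~ P j]; split.
- by rewrite filter_uniq// uniq_index_box.
- by move=> j; rewrite mem_filter => /andP[].
- move=> j t; rewrite mem_filter => /andP[/asboolPn h _] tj.
  by rewrite ltNge; apply/negP => tr; apply: h; exists t.
pose ks := [seq j <- index_box d M | P j].
have uks : uniq ks by rewrite filter_uniq// uniq_index_box.
have hk : (size ks)%:R * L ^+ d <= (rho + d%:R * L) ^+ d * unit_ball_vol d.
  have dL0 : 0 <= d%:R * L by rewrite mulr_ge0// ltW.
  rewrite -lee_fin -vol_cells// -(vol_cballE (origin d)) ?ltr_pwDl//.
  apply: le_measure; rewrite ?inE.
  - by apply: bigsetU_measurable => i _; exact: measurable_cube.
  - exact: measurable_eucl_cball.
  move=> t; rewrite -bigcup_seq => -[j /=]; rewrite mem_filter => /andP[/asboolP[u uj ur] _] tj.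
  apply: (le_trans (eucl_dist_triangle _ u _)); apply: lerD => //.
  exact: (cube_dist (ltW L0) uj tj).
apply: (@le_trans _ _ ((size [seq j <- index_box d M | ~~ P j])%:R * L ^+ d +
    (size ks)%:R * L ^+ d)); last by rewrite lerD2l.
rewrite -mulrDl -natrD addnC !size_filter count_predC size_index_box.
by rewrite exprMn natrX natrM.
Qed.

Lemma zcell_ge0 d (L : R) k : 0 <= @zcell d L k.
Proof. by rewrite zhat_ge0//; exact: bounded_region_cube. Qed.

Let cores d (L : R) (js : seq (d.-tuple int)) (kk : d.-tuple int -> nat) :
  (0 < d)%N -> 0 < L -> uniq js ->
  bounded_region (\big[setU/set0]_(j <- js) core L j) /\
  \prod_(j <- js) @zcell d L (kk j) <=
    zhat (\big[setU/set0]_(j <- js) core L j) (\sum_(j <- js) kk j)%N.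
Proof.
move=> d0 L0 ujs; have [||bU le] := @zhat_bigU R _ d (@core d L) kk js ujs.
- by move=> j _; exact: bounded_region_cube.
- by move=> i j _ _ ij x y; exact: core_separated.
split=> //; apply: le_trans le; rewrite le_eqVlt; apply/orP; left; apply/eqP.
by apply: eq_bigr => j _; rewrite zhat_cube.
Qed.

(** Here [m] cells receive [k] points each, one more receives the remainder [k'], and the others
    stay empty; the extra cell is why [m < size js] is strict. *)
Lemma zhat_fill d (L : R) (B : set (Rn d)) (js : seq (d.-tuple int)) m k k' :
  (0 < d)%N -> 0 < L -> bounded_region B -> uniq js ->
  (forall j, j \in js -> cell L j `<=` B) -> (m < size js)%N ->
  zcell d L k ^+ m * zcell d L k' <= zhat B (m * k + k').
Proof.
move=> d0 L0 bB ujs jsB mjs.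
case: js ujs jsB mjs => // j0 js /= /andP[j0js ujs] jsB mjs.
pose s := j0 :: take m js; pose kk j := if j == j0 then k' else k.
have sjs : {subset take m js <= js} by move=> j; exact: mem_take.
have us : uniq s by rewrite /= take_uniq// andbT; apply: contra j0js => /sjs.
have kkE j : j \in take m js -> kk j = k.
  by move=> /sjs jjs; rewrite /kk; case: eqP => // jj0; rewrite -jj0 jjs in j0js.
have [bU le] := cores kk d0 L0 us.
have szm : size (take m js) = m by rewrite size_takel.
have prodE : \prod_(j <- s) @zcell d L (kk j) = zcell d L k ^+ m * zcell d L k'.
  rewrite big_cons {1}/kk eqxx mulrC; congr (_ * _).
  rewrite (eq_big_seq (fun=> zcell d L k)); last by move=> j /kkE ->.
  by rewrite big_const_seq count_predT szm iter_mulr_1.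
have sumE : (\sum_(j <- s) kk j = m * k + k')%N.
  rewrite big_cons {1}/kk eqxx addnC; congr (_ + _)%N.
  rewrite (eq_big_seq (fun=> k)); last by move=> j /kkE ->.
  by rewrite big_const_seq count_predT szm iter_addn_0 mulnC.
rewrite -prodE -sumE; apply: (le_trans le); apply: le_zhat => //.
move=> t; rewrite -bigcup_seq => -[j /= js' /(core_sub_cell d0)]; apply: jsB.
by move: js'; rewrite !inE => /orP[->//|/sjs ->]; rewrite orbT.
Qed.

(** Everything fits in the core [[- M L, M L - gap)^d] of a cell of side [2 M L]: the cores of the
    outermost cells end exactly at its upper faces, and [rho + gap d < M L] handles the ball. The
    cells keep a distance above [gap d] from the ball, so all parts are separated. *)
Lemma zhat_surround d (L rho : R) (js : seq (d.-tuple int)) M n k :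
  (0 < d)%N -> 0 < L -> 0 < rho -> uniq js -> {subset js <= index_box d M} ->
  (forall j t, j \in js -> cell L j t -> rho + gap d < eucl_dist (origin d) t) ->
  rho + gap d < M%:R * L ->
  zhat (eucl_cball (@origin R d) rho) n * zcell d L k ^+ size js <=
  zcell d (2 * M%:R * L) (n + size js * k).
Proof.
move=> d0 L0 rho0 ujs jsM jsrho rhoM; have r0 := @rad_gt0 R d d0.
have [bU le] := cores (fun=> k) d0 L0 ujs.
have prodE : \prod_(j <- js) @zcell d L k = zcell d L k ^+ size js.
  by rewrite big_const_seq count_predT iter_mulr_1.
have bB : bounded_region (eucl_cball (@origin R d) rho).
  by split; [exact: measurable_eucl_cball|exists rho].
apply: (@le_trans _ _ (zhat (eucl_cball (origin d) rho) n *
    zhat (\big[setU/set0]_(j <- js) core L j) (size js * k))).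
  rewrite ler_wpM2l ?zhat_ge0// -prodE; apply: (le_trans le).
  by rewrite big_const_seq count_predT iter_addn_0 mulnC.
apply: le_trans (zhat_separated _ _ bB bU _) _.
  move=> x y xr; rewrite -bigcup_seq => -[j /= jjs /(core_sub_cell d0) yj].
  have := jsrho j y jjs yj; have := eucl_dist_triangle (origin d) x y.
  move: xr; rewrite /eucl_cball/= /hfar /gap; lra.
rewrite /zcell -(zhat_cube (fun=> - (M%:R * L))).
apply: le_zhat; [exact: bounded_regionU|exact: bounded_region_cube|].
move=> t [tr i|].
  have := le_trans (coord_le_eucl_dist (origin d) t i) tr.
  rewrite tnth_mktuple sub0r normrN ler_norml.
  move: rhoM; rewrite /gap -(mulrA 2); set x := M%:R * L => h1 /andP[h2 h3].
  by apply/andP; split; lra.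
rewrite -bigcup_seq => -[j /= /jsM]; rewrite mem_index_box => /forallP h tj i.
have /andP[h1 h2] := h i; have := tj i.
have : - (M%:R * L) <= (tnth j i)%:~R * L.
  rewrite -mulNr (_ : - M%:R = (- M%:Z)%:~R); last by rewrite mulrNz.
  by rewrite ler_wpM2r ?(ltW L0)// ler_int.
have : (tnth j i)%:~R * L + L <= M%:R * L.
  rewrite -{2}[L]mul1r -mulrDl ler_wpM2r ?(ltW L0)//.
  by rewrite -(intrD _ _ 1) (ler_int _ _ M%:Z) lezD1.
rewrite -(mulrA 2); set x := M%:R * L; set y := _%:~R * L => h3 h4 /andP[h5 h6].
by apply/andP; split; lra.
Qed.

End cells.

(** * The thermodynamic limit *)

Section asymptotic_facts.
Context {R : realType}.

(** Half of Stirling's formula, from [k^k / k! <= exp k]. The companion upper bound loses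
    [ln k + 1], which is negligible after division by [k]. *)
Lemma ln_fact_ge k : k%:R * ln k%:R - k%:R <= ln k`!%:R :> R.
Proof.
case: k => [|k]; first by rewrite mul0r subr0 fact0 ln1.
have k0 : 0 < k.+1%:R :> R by rewrite ltr0n.
have f0 : 0 < k.+1`!%:R :> R by rewrite ltr0n fact_gt0.
have p : 0 < k.+1%:R ^+ k.+1 / k.+1`!%:R :> R by rewrite divr_gt0// exprn_gt0.
have h : ln (1 + k.+1%:R ^+ k.+1 / k.+1`!%:R) <= k.+1%:R :> R.
  rewrite -[leRHS]expRK ler_ln ?posrE ?addr_gt0 ?expR_gt0//.
  exact: expR_ge1Dxn (ltW k0).
rewrite lerBlDr -lerBlDl; apply: le_trans h.
rewrite mulr_natl -lnXn// -ln_div ?posrE ?exprn_gt0//.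
by rewrite ler_ln ?posrE ?addr_gt0// lerDr.
Qed.

Lemma ln_fact_le k : (0 < k)%N ->
  ln k`!%:R <= k%:R * ln k%:R - k%:R + ln k%:R + 1 :> R.
Proof.
case: k => // k _; elim: k => [|k IH]; first by rewrite ln1; lra.
have k0 : 0 < k.+1%:R :> R by rewrite ltr0n.
have k1 : 0 < k.+2%:R :> R by rewrite ltr0n.
have E2 : k.+2%:R = k.+1%:R + 1 :> R by rewrite natr1.
rewrite factS natrM lnM ?posrE ?ltr0n ?fact_gt0//.
have h : ln (k.+1%:R / k.+2%:R) <= - k.+2%:R^-1 :> R.
  rewrite (_ : k.+1%:R / k.+2%:R = 1 + - k.+2%:R^-1); last first.
    by rewrite E2; field; rewrite gt_eqF// addr_gt0.
  by apply: le_ln1Dx; rewrite ltrN2 invf_lt1// ltr1n.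
rewrite ln_div ?posrE// in h.
have h2 : 1 <= k.+2%:R * (ln k.+2%:R - ln k.+1%:R) :> R.
  by rewrite -ler_pdivrMl// mulr1 -lerN2 opprB.
move: IH h2; rewrite mulrBr {1 3}E2; lra.
Qed.

Lemma ln_le_sqrt (x : R) : 0 < x -> ln x <= 2 * Num.sqrt x.
Proof.
move=> x0; have s0 : 0 < Num.sqrt x by rewrite sqrtr_gt0.
rewrite -{1}(sqr_sqrtr (ltW x0)) lnXn// mulr2n.
have := ln_sublinear s0; lra.
Qed.

Lemma cvg_invn0 : (n%:R^-1 : R) @[n --> \oo] --> (0 : R).
Proof.
apply/gtr0_cvgV0; last exact: cvgr_idn.
by near=> n; rewrite ltr0n; near: n; exact: nbhs_infty_gt.
Unshelve. all: by end_near. Qed.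

Lemma cvg_sqrt_invn0 : (Num.sqrt (n%:R^-1) : R) @[n --> \oo] --> (0 : R).
Proof.
rewrite -sqrtr0; apply: continuous_cvg; first exact: sqrt_continuous.
exact: cvg_invn0.
Qed.

Lemma cvg_lnn_divn0 : (ln n%:R / n%:R : R) @[n --> \oo] --> (0 : R).
Proof.
apply: (@squeeze_cvgr _ _ _ _ (fun=> 0) (fun n => 2 * Num.sqrt (n%:R^-1))).
- near=> n; have n0 : (0 < n)%N by near: n; exact: nbhs_infty_gt.
  have n0' : 0 < n%:R :> R by rewrite ltr0n.
  rewrite divr_ge0 ?ln_ge0 ?ler1n//= ler_pdivrMr// (le_trans (ln_le_sqrt n0'))//.
  rewrite -mulrA ler_wpM2l// sqrtrV ?ler0n// mulrC -{2}(sqr_sqrtr (ltW n0')).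
  by rewrite expr2 mulfK// gt_eqF// sqrtr_gt0.
- exact: cvg_cst.
- rewrite -(mulr0 2); apply: cvgM; [exact: cvg_cst|exact: cvg_sqrt_invn0].
Unshelve. all: by end_near. Qed.

Lemma near_ge_natr (A c : R) : 0 < c -> \forall n \near \oo, A <= c * n%:R.
Proof.
move=> c0; near=> n; rewrite -ler_pdivrMl//; near: n; exact: nbhs_infty_ger.
Unshelve. all: by end_near. Qed.

End asymptotic_facts.

(** * Growth of the radius of the ball of volume n *)

Section ball_growth.
Context {R : realType}.
Variable d : nat.
Hypothesis d0 : (0 < d)%N.

Lemma near_radius_ge (A : R) :
  \forall n \near \oo, A <= @ball_radius R d n%:R.
Proof.
have w0 := @unit_ball_vol_gt0 R d.
near=> n; have n0 : (0 < n)%N by near: n; exact: nbhs_infty_gt.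
have n1 : 0 < n%:R :> R by rewrite ltr0n.
have [r0 rn] := ball_radiusP d0 n1.
have nA : `|A| ^+ d * unit_ball_vol d <= n%:R.
  by rewrite -[leRHS]mul1r; near: n; exact: near_ge_natr.
rewrite leNgt; apply/negP => rA; move: nA; rewrite leNgt => /negP; apply.
rewrite -{1}rn ltr_pM2r// ltrXn2r ?gtn_eqF// ?nnegrE ?ltW//.
exact: lt_le_trans (ler_norm A).
Unshelve. all: by end_near. Qed.

Lemma cvg_radius_ratio (D : R) :
  (1 + D / ball_radius d n%:R) ^+ d @[n --> \oo] --> (1 : R).
Proof.
have h : 1 + D / ball_radius d n%:R @[n --> \oo] --> (1 : R).
  rewrite -[X in _ --> X]addr0; apply: cvgD; first exact: cvg_cst.
  rewrite -[X in _ --> X](mulr0 D); apply: cvgM; first exact: cvg_cst.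
  apply/gtr0_cvgV0; last exact/cvgryPge/near_radius_ge.
  near=> n; have n0 : (0 < n)%N by near: n; exact: nbhs_infty_gt.
  have n1 : 0 < n%:R :> R by rewrite ltr0n.
  by have [] := ball_radiusP d0 n1.
have := cvg_comp _ _ h (@exprn_continuous R d 1); rewrite expr1n; exact.
Unshelve. all: by end_near. Qed.

End ball_growth.

(** * Comparison of balls with cubes *)

Section thermodynamic_limit.
Context {R : realType}.
Local Notation Rn d := (d.-tuple (measurableTypeR R)).
Variables (d : nat) (alpha : R).
Hypotheses (d0 : (0 < d)%N) (alpha0 : 0 < alpha).

Local Notation rho n := (@ball_radius R d n%:R).
Local Notation omega := (@unit_ball_vol R d).

Definition npoints n := Num.truncn (alpha * n%:R).

Definition zball n : R := zhat (@vol_ball R d n) (npoints n).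

(** The strict inequality gives a surplus of points over density [alpha] in the whole cell, gap
    included; it absorbs the boundary layers and the rounding in the comparisons with balls. *)
Definition dense_cell (L : R) k :=
  [/\ gap d < L, alpha * L ^+ d < k%:R & 0 < zcell d L k].

Let rho_gt0 n : (0 < n)%N -> 0 < rho n.
Proof. by move=> n0; have [] := @ball_radiusP R d n%:R d0; rewrite ?ltr0n. Qed.

Let rho_vol n : (0 < n)%N -> rho n ^+ d * omega = n%:R.
Proof. by move=> n0; have [] := @ball_radiusP R d n%:R d0; rewrite ?ltr0n. Qed.

Let gap_gt0 : 0 < @gap R d.
Proof. by rewrite mulr_gt0// rad_gt0. Qed.

Let npoints_le n : (npoints n)%:R <= alpha * n%:R.
Proof. by rewrite truncn_le mulr_ge0// ltW. Qed.

Let npoints_gt n : alpha * n%:R - 1 < (npoints n)%:R.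
Proof. by rewrite ltrBlDr natr1 truncnS_gt. Qed.

Lemma bounded_region_vol_ball n : (0 < n)%N -> bounded_region (@vol_ball R d n).
Proof.
move=> n0; split; first exact: measurable_eucl_cball.
by exists (rho n) => //; exact: rho_gt0.
Qed.

Let dense_cell_gt0 L k : dense_cell L k -> 0 < L /\ 0 < k%:R :> R.
Proof.
move=> [gL ak _]; have L0 : 0 < L by apply: lt_trans gL.
by split => //; apply: lt_trans ak; rewrite mulr_gt0// exprn_gt0.
Qed.

Lemma zcell_size (L : R) k : gap d < L -> 0 < zcell d L k ->
  k%:R <= (d.+1%:R * L) ^+ d * omega.
Proof.
move=> gL zk; have L0 : 0 < L by apply: lt_trans gL.
have r0 := @rad_gt0 R d d0.
have dL0 : 0 < d%:R * L by rewrite mulr_gt0// ltr0n.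
have := @zhat_gt0_size R d (@cube R d (fun=> 0) (L - gap d)) k (origin d) (d%:R * L) d0 dL0.
move=> /(_ (measurable_cube _ _)) h; apply: le_trans (h _ _) _.
- move=> t ht; apply: eucl_dist_le => [|i]; first exact: ltW.
  have /= := ht i; have := gap_gt0; rewrite tnth_mktuple ler_norml => g /andP[h1 h2].
  by apply/andP; split; lra.
- by apply/eqP => z0; move: zk; rewrite /zcell /zhat z0 ltxx.
have dS0 : 0 < d.+1%:R * L by rewrite mulr_gt0.
rewrite ler_pM2r ?unit_ball_vol_gt0// lerXn2r// ?nnegrE ?(ltW dS0) ?(ltW (addr_gt0 dL0 r0))//.
by rewrite -natr1 mulrDl mul1r lerD2l ltW// (lt_trans _ gL)// /gap; lra.
Qed.

(** The ideal-gas bound [V^k / k!] with [V <= k / alpha], combined with [k^k / k! <= exp k]. It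
    makes the supremum of the cell entropies finite. *)
Lemma dense_cell_ub L k : dense_cell L k -> ln (zcell d L k) / k%:R <= 1 - ln alpha.
Proof.
move=> [gL ak zk]; have [L0 k0] := dense_cell_gt0 (And3 gL ak zk).
rewrite ler_pdivrMr//; have kN : (0 < k)%N by rewrite -(ltr0n R).
have V0 : 0 <= (L - gap d) ^+ d by rewrite exprn_ge0// subr_ge0 ltW.
have Vle : (L - gap d) ^+ d <= k%:R / alpha.
  rewrite ler_pdivlMr// mulrC ltW// (le_lt_trans _ ak)// ler_wpM2l ?(ltW alpha0)//.
  by rewrite lerXn2r ?nnegrE ?subr_ge0 ?(ltW L0) ?(ltW gL)// gerBl ltW.
have zle : zcell d L k <= (k%:R / alpha) ^+ k / k`!%:R.
  apply: (le_trans (zhat_le _ (bounded_region_cube _ _) (vol_box _ _))).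
    by rewrite subr_ge0 ltW.
  rewrite ler_pM2r ?invr_gt0 ?ltr0n ?fact_gt0//.
  by apply: lerXn2r => //; rewrite nnegrE divr_ge0// ltW.
apply: (@le_trans _ _ (ln ((k%:R / alpha) ^+ k / k`!%:R))).
  by rewrite ler_ln ?posrE// divr_gt0 ?exprn_gt0 ?divr_gt0// ltr0n fact_gt0.
rewrite ln_div ?posrE ?exprn_gt0 ?divr_gt0 ?ltr0n ?fact_gt0// lnXn ?divr_gt0//.
rewrite ln_div ?posrE// -[X in X - _ <= _]mulr_natl; have := @ln_fact_ge R k; lra.
Qed.

(** Write the required number of points as [m k + k'] with [k' < k]. By the surplus, [m] cells take
    up at most a fraction [kappa < 1] of the volume of the ball, and the cells inside the ball
    eventually cover more than that. *)
Lemma dense_cell_lower L k : dense_cell L k -> forall e : R, 0 < e ->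
  \forall n \near \oo, 0 < zball n /\
    ln (zcell d L k) / k%:R - e <= ln (zball n) / (alpha * n%:R).
Proof.
move=> dc e e0; have [gL ak zk] := dc; have [L0 k0] := dense_cell_gt0 dc.
have Ld0 : 0 < L ^+ d by rewrite exprn_gt0.
have kN : (0 < k)%N by rewrite -(ltr0n R).
set s := ln (zcell d L k) / k%:R.
(* Bounds the logarithm of the cell that holds the remainder, whichever [k' < k] occurs, together
   with the term [k' s] by which [m] full cells fall short of [s] per point. *)
pose C := \sum_(j < k) `|ln (zcell d L j)| + `|ln (zcell d L k)|.
pose kappa := alpha * L ^+ d / k%:R.
have kap1 : kappa < 1 by rewrite ltr_pdivrMr// mul1r.
near=> n.
have n0 : (0 < n)%N by near: n; exact: nbhs_infty_gt.
have n1 : 0 < n%:R :> R by rewrite ltr0n.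
have r0 := rho_gt0 n0.
have hr : d%:R * L < rho n.
  apply: (@lt_le_trans _ _ (d%:R * L + 1)); first by rewrite ltrDl.
  by near: n; exact: near_radius_ge.
have hk : (1 + kappa) / 2 <= (1 + - (d%:R * L) / rho n) ^+ d.
  near: n; apply: (@cvgr_ge _ _ _ _ _ 1); first exact: cvg_radius_ratio.
  lra.
have he : C + `|s| <= e * alpha * n%:R.
  by near: n; apply: near_ge_natr; rewrite mulr_gt0.
have [js [ujs jsB hjs]] := cells_in_ball L0 hr.
have hn : (rho n - d%:R * L) ^+ d * omega = n%:R * (1 + - (d%:R * L) / rho n) ^+ d.
  rewrite -{2}(rho_vol n0) mulrAC -exprMn; congr (_ ^+ _ * _).
  by field; rewrite gt_eqF.
pose m := (npoints n %/ k)%N; pose k' := (npoints n %% k)%N.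
have mk : m%:R * k%:R <= alpha * n%:R.
  by rewrite -natrM (le_trans _ (npoints_le n))// ler_nat leq_trunc_div.
have mjs : (m < size js)%N.
  rewrite -(ltr_nat R) -(ltr_pM2r Ld0); apply: lt_le_trans hjs; rewrite hn.
  apply: (@le_lt_trans _ _ (n%:R * kappa)).
    rewrite /kappa mulrA ler_pdivlMr// mulrAC mulrA (mulrC n%:R) ler_wpM2r// ltW//.
  by rewrite ltr_pM2l//; lra.
have bB := bounded_region_vol_ball n0.
have fill := zhat_fill k k' d0 L0 bB ujs jsB mjs.
rewrite -divn_eq -/(zball n) in fill.
have k'k : (k' < k)%N by rewrite ltn_mod.
have zk' : 0 < zcell d L k'.
  by apply: (zhat_gt0_le (bounded_region_cube _ _) _ zk); exact: ltnW.
have zb0 : 0 < zball n by apply: lt_le_trans fill; rewrite mulr_gt0// exprn_gt0.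
split=> //.
have lnfill : m%:R * ln (zcell d L k) + ln (zcell d L k') <= ln (zball n).
  rewrite [m%:R * _]mulr_natl -lnXn// -lnM ?posrE ?exprn_gt0// ler_ln ?posrE//.
  by rewrite mulr_gt0// exprn_gt0.
have C1 : `|ln (zcell d L k')| + `|ln (zcell d L k)| <= C.
  by rewrite /C lerD2r (bigD1 (Ordinal k'k))//= lerDl sumr_ge0.
have mE : m%:R * ln (zcell d L k) = (npoints n)%:R * s - k'%:R * s.
  rewrite -mulrBl (divn_eq (npoints n) k) natrD addrK natrM /s.
  by field; rewrite gt_eqF.
have h1 : k'%:R * s <= `|ln (zcell d L k)|.
  apply: (le_trans (ler_norm _)); rewrite normrM ger0_norm// /s normrM normfV.
  rewrite (ger0_norm (ltW k0)) mulrA ler_pdivrMr// mulrC ler_wpM2l// ler_nat ltnW//.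
have h2 : alpha * n%:R * s - `|s| <= (npoints n)%:R * s.
  have := npoints_le n; have := npoints_gt n => a1 a2.
  rewrite lerBlDr -lerBlDl -mulrBl; apply: (le_trans (ler_norm _)).
  by rewrite normrM ler_piMl// ger0_norm ?subr_ge0//; lra.
have := ler_norm (- ln (zcell d L k')); rewrite normrN => h3.
rewrite ler_pdivlMr ?mulr_gt0// mulrBl; apply: le_trans lnfill; rewrite mE.
move: he h1 h2 h3 C1; rewrite [s * _]mulrC; lra.
Unshelve. all: by end_near. Qed.


(** The side [2 M L] is between [8 rho] and [10 rho]. As the unit ball has volume at most [4^d], the
    cube has volume at least [2^d n >= 2 n], so that the ball fills at most half of it, yet at most
    a fixed multiple of [n]. *)
Let box_bounds n (L : R) : (0 < n)%N -> 0 < L -> L <= rho n ->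
  let X := (2 * (Num.truncn (4 * rho n / L)).+1%:R * L) ^+ d in
  [/\ 4 * rho n < (Num.truncn (4 * rho n / L)).+1%:R * L, 2 * n%:R <= X &
    X <= (10 * rho n) ^+ d].
Proof.
move=> n0 L0 Lrho; have r0 := rho_gt0 n0.
set M := (Num.truncn _).+1.
have M1 : 4 * rho n < M%:R * L by rewrite -ltr_pdivrMr// truncnS_gt.
have M2 : M%:R * L <= 5 * rho n.
  have : (Num.truncn (4 * rho n / L))%:R <= 4 * rho n / L.
    by rewrite truncn_le divr_ge0 ?mulr_ge0 ?ltW.
  rewrite ler_pdivlMr// => h; rewrite /M -natr1 mulrDl mul1r; lra.
have ML0 : 0 <= M%:R * L by rewrite mulr_ge0// ltW.
split=> //; rewrite -(mulrA 2).
- apply: (@le_trans _ _ ((8 * rho n) ^+ d)); last first.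
    by rewrite lerXn2r ?nnegrE ?mulr_ge0// ?ltW//; move: M1; set x := _ * L; lra.
  rewrite -[X in 2 * X](rho_vol n0) exprMn mulrC -mulrA mulrC ler_wpM2r ?exprn_ge0 ?(ltW r0)//.
  apply: (@le_trans _ _ (2 ^+ d * 4 ^+ d)); last by rewrite -exprMn lerXn2r ?nnegrE//; lra.
  rewrite mulrC ler_pM ?(ltW (unit_ball_vol_gt0 _))//; last exact: unit_ball_vol_le.
  by rewrite -[leLHS]expr1 ler_weXn2l// ler1n.
- rewrite lerXn2r ?nnegrE ?mulr_ge0// ?(ltW r0)//; move: M2; set x := _ * L; lra.
Qed.

(** The ball surrounded by near-optimal cells lives in a large cube that is itself a dense cell, so
    the total entropy is at most [sigma] per point. Subtracting the surrounding cells, which fall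
    short of [sigma] by at most [delta] per point, leaves the bound on the ball; the surrounding
    points number at most a constant times [n]. *)
Lemma dense_cell_upper L k (sigma delta : R) : dense_cell L k ->
  (forall L' k', dense_cell L' k' -> ln (zcell d L' k') / k'%:R <= sigma) ->
  0 <= delta -> sigma - delta <= ln (zcell d L k) / k%:R -> forall e : R, 0 < e ->
  \forall n \near \oo, 0 < zball n -> ln (zball n) / (alpha * n%:R) <=
    sigma + delta * (10 * d.+1%:R) ^+ d / alpha + e.
Proof.
move=> dc ub delta0 hs e e0; have [gL ak zk] := dc; have [L0 k0] := dense_cell_gt0 dc.
have Ld0 : 0 < L ^+ d by rewrite exprn_gt0.
have w0 := @unit_ball_vol_gt0 R d.
have aL0 : 0 < alpha * L ^+ d by rewrite mulr_gt0.
pose eta := k%:R / (alpha * L ^+ d) - 1.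
have eta0 : 0 < eta by rewrite subr_gt0 ltr_pdivlMr// mul1r.
have kE : k%:R = (1 + eta) * alpha * L ^+ d.
  by rewrite /eta addrC subrK -mulrA divfK// gt_eqF.
near=> n => zb0.
have n0 : (0 < n)%N by near: n; exact: nbhs_infty_gt.
have n1 : 0 < n%:R :> R by rewrite ltr0n.
have r0 := rho_gt0 n0.
have gr : gap d < rho n.
  apply: (@lt_le_trans _ _ (gap d + 1)); first by rewrite ltrDl.
  by near: n; exact: near_radius_ge.
have Lr : L <= rho n by near: n; exact: near_radius_ge.
have hh : (1 + (gap d + d%:R * L) / rho n) ^+ d <= 1 + eta / (2 * (1 + eta)).
  near: n; apply: (@cvgr_le _ _ _ _ _ 1); first exact: cvg_radius_ratio.
  by rewrite ltrDl divr_gt0// mulr_gt0// addr_gt0.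
set h := (_ ^+ d) in hh.
have hn : 1 <= alpha * eta / 2 * n%:R.
  by near: n; apply: near_ge_natr; rewrite divr_gt0// mulr_gt0.
have he : `|sigma| <= e * alpha * n%:R.
  by near: n; apply: near_ge_natr; rewrite mulr_gt0.
have [M1 X1 X2] := box_bounds n0 L0 Lr.
set M := (Num.truncn (4 * rho n / L)).+1 in M1 X1 X2 *.
set X := (2 * M%:R * L) ^+ d in X1 X2 *.
have rg0 : 0 < rho n + gap d by rewrite addr_gt0.
have [js [ujs jsM jsoff hjs]] := cells_off_ball d M L0 rg0.
have hE : (rho n + gap d + d%:R * L) ^+ d * omega = n%:R * h.
  rewrite -[X in X * h](rho_vol n0) mulrAC /h -exprMn; congr (_ ^+ _ * _).
  by field; rewrite gt_eqF.
rewrite -/X hE in hjs.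
pose m := size js.
have mM : m%:R * L ^+ d <= X.
  rewrite /X exprMn ler_wpM2r ?(ltW Ld0)// -natrM -natrX ler_nat -size_index_box.
  exact: uniq_leq_size.
have sur := zhat_surround (npoints n) k d0 L0 r0 ujs jsM jsoff.
have rM : rho n + gap d < M%:R * L by move: M1; set x := _ * L; lra.
have {}sur := sur rM; rewrite -/(zball n) -/m in sur.
have mk1 : (1 + eta) * alpha * (X - n%:R * h) <= m%:R * k%:R.
  rewrite kE [leRHS](_ : _ = (1 + eta) * alpha * (m%:R * L ^+ d)); last by ring.
  rewrite ler_wpM2l//; last by move: hjs; rewrite -/m; lra.
  by rewrite mulr_ge0 ?(ltW alpha0)// addr_ge0// ltW.
have mk2 : m%:R * k%:R <= (10 * d.+1%:R) ^+ d * n%:R :> R.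
  apply: (@le_trans _ _ (m%:R * ((d.+1%:R * L) ^+ d * omega))).
    by rewrite ler_wpM2l//; exact: zcell_size.
  rewrite -[X in _ <= _ * X](rho_vol n0) !exprMn.
  rewrite (_ : m%:R * _ = d.+1%:R ^+ d * omega * (m%:R * L ^+ d)); last by ring.
  rewrite (_ : 10 ^+ d * _ * _ = d.+1%:R ^+ d * omega * (10 ^+ d * rho n ^+ d)); last by ring.
  rewrite ler_wpM2l ?mulr_ge0 ?exprn_ge0 ?(ltW w0)//.
  by rewrite -exprMn (le_trans mM).
pose K := (npoints n + m * k)%N.
have zK0 : 0 < zcell d (2 * M%:R * L) K.
  by apply: lt_le_trans sur; rewrite mulr_gt0// exprn_gt0.
have KE : K%:R = (npoints n)%:R + m%:R * k%:R :> R by rewrite /K natrD natrM.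
(* The large cube must again be strictly denser than [alpha]. In units of [alpha n], the surplus
   [eta X / n >= 2 eta] beats the loss [(1 + eta) h - 1 <= 3 eta / 2] around the ball, and the
   remaining [eta / 2] covers the rounding of [npoints n]. *)
have dK : dense_cell (2 * M%:R * L) K.
  split=> //; first by move: M1; rewrite -(mulrA 2); set x := _ * L; lra.
  rewrite -/X KE; have := npoints_gt n => ng.
  have h1 : (1 + eta) * h <= 1 + eta + eta / 2.
    have /ler_wpM2l/(_ _ _ hh) : 0 <= 1 + eta by lra.
    rewrite (_ : (1 + eta) * (1 + eta / (2 * (1 + eta))) = 1 + eta + eta / 2)//.
    by field; rewrite gt_eqF// addr_gt0.
  have h2 : alpha * n%:R * ((1 + eta) * h) <= alpha * n%:R * (1 + eta + eta / 2).
    by rewrite ler_wpM2l// mulr_ge0// ltW.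
  have h3 : alpha * eta * (2 * n%:R) <= alpha * eta * X.
    by rewrite ler_wpM2l// mulr_ge0// ltW.
  move: mk1 ng hn h2 h3; lra.
have := ub _ _ dK; have [_ K0] := dense_cell_gt0 dK.
rewrite ler_pdivrMr// => lnK.
have lnsur : ln (zball n) + m%:R * ln (zcell d L k) <= ln (zcell d (2 * M%:R * L) K).
  rewrite [m%:R * _]mulr_natl -lnXn// -lnM ?posrE ?exprn_gt0// ler_ln ?posrE//.
  by rewrite mulr_gt0// exprn_gt0.
have sk : (sigma - delta) * k%:R <= ln (zcell d L k) by rewrite -ler_pdivlMr.
have msk : m%:R * ((sigma - delta) * k%:R) <= m%:R * ln (zcell d L k).
  by rewrite ler_wpM2l.
have dmk : delta * (m%:R * k%:R) <= delta * ((10 * d.+1%:R) ^+ d * n%:R).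
  by rewrite ler_wpM2l.
have sN : sigma * (npoints n)%:R <= sigma * (alpha * n%:R) + `|sigma|.
  have := npoints_le n; have := npoints_gt n => a1 a2.
  rewrite -lerBlDl -mulrBr; apply: (le_trans (ler_norm _)).
  by rewrite normrM ler_piMr// ler0_norm ?subr_le0//; lra.
rewrite ler_pdivrMr ?mulr_gt0// (mulrDl (sigma + _) e) (mulrDl sigma).
have cancel (G : R) : delta * G / alpha * (alpha * n%:R) = delta * (G * n%:R).
  by field; rewrite gt_eqF.
rewrite cancel; set G := (10 * d.+1%:R) ^+ d in dmk *.
move: lnK lnsur msk dmk sN he; rewrite KE; lra.
Unshelve. all: by end_near. Qed.

Definition cell_entropies : set R :=
  [set x | exists L k, dense_cell L k /\ x = ln (zcell d L k) / k%:R].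

(** One nearly optimal cell serves both bounds: [delta] is at most [e / 2] for the lower bound and
    at most [e / (2 G)] for the upper one, where the deficit is multiplied by [G]. *)
Lemma cvg_zball L k : dense_cell L k ->
  ln (zball n) / (alpha * n%:R) @[n --> \oo] --> sup cell_entropies.
Proof.
move=> dc; set sigma := sup _.
have hs : has_sup cell_entropies.
  split; first by exists (ln (zcell d L k) / k%:R), L, k.
  by exists (1 - ln alpha) => _ [L' [k' [dc' ->]]]; exact: dense_cell_ub.
have ub L' k' : dense_cell L' k' -> ln (zcell d L' k') / k'%:R <= sigma.
  by move=> dc'; apply: sup_upper_bound => //; exists L', k'.
apply/cvgrPdist_le => e e0.
pose G := (10 * d.+1%:R) ^+ d / alpha : R.
have G0 : 0 < G by rewrite divr_gt0// exprn_gt0// mulr_gt0.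
pose delta := Num.min (e / 2) (e / (2 * G)).
have delta0 : 0 < delta by rewrite lt_min !divr_gt0// mulr_gt0.
have [_ [L' [k' [dc' ->]]] /ltW near_opt] := sup_adherent delta0 hs.
have e2 : 0 < e / 2 by rewrite divr_gt0.
near=> n.
have [zb0 lo] : 0 < zball n /\
    ln (zcell d L' k') / k'%:R - e / 2 <= ln (zball n) / (alpha * n%:R).
  by near: n; exact: (dense_cell_lower dc' e2).
have hi : 0 < zball n -> ln (zball n) / (alpha * n%:R) <= sigma +
    delta * (10 * d.+1%:R) ^+ d / alpha + e / 2.
  by near: n; exact: (dense_cell_upper dc' ub (ltW delta0) near_opt e2).
have := hi zb0; rewrite -(mulrA delta) -/G.
have d1 : delta <= e / 2 by rewrite /delta ge_min lexx.
have d2 : delta * G <= e / 2.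
  apply: (@le_trans _ _ (e / (2 * G) * G)).
    by rewrite ler_wpM2r ?(ltW G0)// /delta ge_min lexx orbT.
  by rewrite (_ : e / (2 * G) * G = e / 2)//; field; rewrite gt_eqF.
have no : sigma - delta <= ln (zcell d L' k') / k'%:R by exact: near_opt.
by move=> hi'; rewrite ler_distl; apply/andP; split; lra.
Unshelve. all: by end_near. Qed.

Lemma dense_cell_zball L k : dense_cell L k -> \forall n \near \oo, 0 < zball n.
Proof.
by move=> dc; apply: filterS (dense_cell_lower dc ltr01) => n [].
Qed.

Lemma cvg_npoints_div : (npoints n)%:R / n%:R @[n --> \oo] --> alpha.
Proof.
apply: (@squeeze_cvgr _ _ _ _ (fun n => alpha - n%:R^-1) (fun=> alpha)).
- near=> n; have n0 : (0 < n)%N by near: n; exact: nbhs_infty_gt.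
  have n1 : 0 < n%:R :> R by rewrite ltr0n.
  rewrite ler_pdivlMr// mulrBl mulVf ?gt_eqF// ltW//=.
  by rewrite ler_pdivrMr.
- rewrite -[X in _ --> X]subr0; apply: cvgB; [exact: cvg_cst|exact: cvg_invn0].
- exact: cvg_cst.
Unshelve. all: by end_near. Qed.

(** The contribution of the normalisation [n^k / k!]: with [u = k / n], Stirling's formula gives
    [(u / alpha) (ln u - 1)] up to terms of order [ln k / n], and [u] tends to [alpha]. *)
Lemma cvg_ln_fact_npoints :
  (ln (npoints n)`!%:R - (npoints n)%:R * ln n%:R) / (alpha * n%:R) @[n --> \oo]
  --> ln alpha - 1.
Proof.
pose u n := (npoints n)%:R / n%:R : R.
pose lo n := u n / alpha * (ln (u n) - 1).
pose hi n := lo n + (ln (npoints n)%:R + 1) / (alpha * n%:R).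
have npos : \forall n \near \oo, (0 < npoints n)%N.
  near=> n; rewrite -(ltr0n R) (le_lt_trans _ (npoints_gt n))// subr_ge0.
  by near: n; exact: near_ge_natr.
have lo_lim : lo n @[n --> \oo] --> ln alpha - 1.
  have -> : ln alpha - 1 = alpha / alpha * (ln alpha - 1).
    by rewrite mulfV ?mul1r// gt_eqF.
  apply: cvgM; first by apply: cvgM; [exact: cvg_npoints_div|exact: cvg_cst].
  apply: cvgB; last exact: cvg_cst.
  by apply: (cvg_comp _ _ cvg_npoints_div); exact: continuous_ln.
apply: (@squeeze_cvgr _ _ _ _ lo hi).
- near=> n; have n0 : (0 < n)%N by near: n; exact: nbhs_infty_gt.
  have n1 : 0 < n%:R :> R by rewrite ltr0n.
  have k0 : (0 < npoints n)%N by near: n.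
  have k1 : 0 < (npoints n)%:R :> R by rewrite ltr0n.
  have loE : lo n = ((npoints n)%:R * ln (npoints n)%:R - (npoints n)%:R -
      (npoints n)%:R * ln n%:R) / (alpha * n%:R).
    by rewrite /lo /u ln_div ?posrE//; field; rewrite !gt_eqF.
  rewrite /hi loE -mulrDl !ler_pM2r ?invr_gt0 ?mulr_gt0//.
  have := @ln_fact_ge R (npoints n); have := @ln_fact_le R _ k0; lra.
- exact: lo_lim.
- rewrite -[X in _ --> X]addr0; apply: cvgD; first exact: lo_lim.
  apply: (@squeeze_cvgr _ _ _ _ (fun=> 0)
      (fun n => alpha^-1 * (ln n%:R / n%:R + (`|ln alpha| + 1) * n%:R^-1))).
  + near=> n; have n0 : (0 < n)%N by near: n; exact: nbhs_infty_gt.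
    have n1 : 0 < n%:R :> R by rewrite ltr0n.
    have k0 : (0 < npoints n)%N by near: n.
    have k1 : 0 < (npoints n)%:R :> R by rewrite ltr0n.
    rewrite divr_ge0 ?addr_ge0 ?ln_ge0 ?ler1n ?mulr_ge0 ?(ltW alpha0)//=.
    rewrite ler_pdivrMr ?mulr_gt0//.
    rewrite [leRHS](_ : _ = ln n%:R + `|ln alpha| + 1); last by field; rewrite !gt_eqF.
    rewrite lerD2r (@le_trans _ _ (ln (alpha * n%:R)))//.
      by rewrite ler_ln ?posrE// mulr_gt0.
    by rewrite lnM ?posrE// addrC lerD2l ler_norm.
  + exact: cvg_cst.
  + rewrite -[X in _ --> X](mulr0 alpha^-1); apply: cvgM; first exact: cvg_cst.
    rewrite -[X in _ --> X]addr0; apply: cvgD; first exact: cvg_lnn_divn0.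
    rewrite -[X in _ --> X](mulr0 (`|ln alpha| + 1)).
    by apply: cvgM; [exact: cvg_cst|exact: cvg_invn0].
Unshelve. all: by end_near. Qed.

Lemma cvg_entropy_seq L k : dense_cell L k ->
  entropy_seq d alpha n @[n --> \oo] --> (sup cell_entropies + (ln alpha - 1))%:E.
Proof.
move=> dc.
have h : (ln (zball n) / (alpha * n%:R) + (ln (npoints n)`!%:R -
    (npoints n)%:R * ln n%:R) / (alpha * n%:R))%:E @[n --> \oo] -->
    (sup cell_entropies + (ln alpha - 1))%:E.
  apply: cvg_EFin; first by near=> n.
  by apply: cvgD; [exact: cvg_zball dc|exact: cvg_ln_fact_npoints].
apply: cvg_trans h; apply: near_eq_cvg.
near=> n; have n0 : (0 < n)%N by near: n; exact: nbhs_infty_gt.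
have n1 : 0 < n%:R :> R by rewrite ltr0n.
have zb0 : 0 < zball n by near: n; exact: dense_cell_zball dc.
rewrite /entropy_seq -/(npoints n) ZhatEfin; last exact: bounded_region_vol_ball.
have f0 : 0 < (npoints n)`!%:R :> R by rewrite ltr0n fact_gt0.
have q0 : 0 < (n%:R ^+ npoints n / (npoints n)`!%:R)^-1 :> R.
  by rewrite invr_gt0 divr_gt0// exprn_gt0.
rewrite -/(zball n) -EFinM lne_EFin ?mulr_gt0// -EFinM; congr _%:E.
have nk0 : 0 < n%:R ^+ npoints n :> R by rewrite exprn_gt0.
have lnq : ln (n%:R ^+ npoints n / (npoints n)`!%:R)^-1 =
    ln (npoints n)`!%:R - (npoints n)%:R * ln n%:R :> R.
  by rewrite invf_div ln_div ?posrE// lnXn// [in RHS]mulr_natl.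
by rewrite lnM ?posrE// lnq -mulrDl mulrC.
Unshelve. all: by end_near. Qed.

End thermodynamic_limit.

(** * Dense cells *)

Section dense_cells.
Context {R : realType}.
Local Notation Rn d := (d.-tuple (measurableTypeR R)).
Variable d : nat.
Hypothesis d0 : (0 < d)%N.

Let gap_gt0 : 0 < @gap R d.
Proof. by rewrite mulr_gt0// rad_gt0. Qed.

Lemma Zhat_cell_eq0 (L : R) k : gap d < L ->
  (d.+1%:R * L) ^+ d * unit_ball_vol d < k%:R ->
  Zhat (@cube R d (fun=> 0) (L - gap d)) k = 0%E.
Proof.
move=> gL kL; rewrite ZhatEfin; last exact: bounded_region_cube.
have [/(zcell_size d0 gL)|] := ltP 0 (zcell d L k); first by rewrite leNgt kL.
by move=> z0; congr _%:E; apply/eqP; rewrite eq_le z0 zcell_ge0.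
Qed.

(** In a cube of side [L] the bound [K] on the number of points is of order [L ^+ d], so a heavy
    term costs [2 ln K], negligible against [k], and [ln z / k >= - ln lam - eps] remains. The
    margin [a - alpha] absorbs the gap of the cell and the point lost in [a V - 1]. *)
Lemma exists_dense_cell (lam y alpha eps : R) : 0 < lam -> 0 <= y -> 0 < alpha ->
  0 < eps ->
  alpha < (1 + y) / (expR y / lam + expR (2 * lam * Num.sqrt 3 ^+ d) * 2 ^+ d) ->
  exists L k, dense_cell d alpha L k /\
    - ln lam - eps <= ln (zcell d L k) / k%:R.
Proof.
move=> lam0 y0 alpha0 eps0; set a := (1 + y) / _ => aa.
have a0 : 0 < a by exact: lt_trans aa.
pose c : R := d.+1%:R ^+ d * unit_ball_vol d + 1.
have c0 : 0 < c by rewrite ltr_wpDl// mulr_ge0 ?exprn_ge0// ltW ?unit_ball_vol_gt0.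
have ratio : (1 - gap d / n%:R) ^+ d @[n --> \oo] --> (1 : R).
  have h : 1 - gap d / n%:R @[n --> \oo] --> (1 : R).
    rewrite -[X in _ --> X]subr0; apply: cvgB; first exact: cvg_cst.
    rewrite -[X in _ --> X](mulr0 (gap d)); apply: cvgM; first exact: cvg_cst.
    exact: cvg_invn0.
  have := cvg_comp _ _ h (@exprn_continuous R d 1); rewrite expr1n; exact.
(* In turn: the side exceeds the gap; the core has nearly the volume of the cell; half of
   [a - alpha] amounts to more than one point; and [2 ln K <= eps k] will follow from
   [ln x <= 2 sqrt x], squared. *)
have [N [n0 gN hN hN2 hN3]] : exists N : nat, [/\ (0 < N)%N, gap d + 1 <= N%:R :> R,
    (alpha / a + 1) / 2 <= (1 - gap d / N%:R) ^+ d,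
    1 < (a - alpha) / 2 * N%:R &
    16 * c <= (eps * alpha) ^+ 2 * N%:R].
  near \oo => N; exists N; split; near: N.
  - exact: nbhs_infty_gt.
  - exact: nbhs_infty_ger.
  - apply: (@cvgr_ge _ _ _ _ _ 1); first exact: ratio.
    have : alpha / a < 1 by rewrite ltr_pdivrMr// mul1r.
    lra.
  - near=> n; rewrite -ltr_pdivrMl ?divr_gt0 ?subr_gt0// mulr1.
    apply: (@lt_le_trans _ _ (((a - alpha) / 2)^-1 + 1)); first by rewrite ltrDl.
    by near: n; exact: nbhs_infty_ger.
  - by apply: near_ge_natr; rewrite exprn_gt0// mulr_gt0.
set L : R := N%:R in gN hN hN2 hN3.
have gL : gap d < L by apply: lt_le_trans gN; rewrite ltrDl.
have L0 : 0 < L by apply: lt_trans gL.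
have L1 : 1 <= L by rewrite /L ler1n.
have LX : L <= L ^+ d by rewrite -{1}[L]expr1 ler_weXn2l.
have X0 : 0 < L ^+ d by rewrite exprn_gt0.
pose S := @cube R d (fun=> 0) (L - gap d).
have VS : vol d S = ((L - gap d) ^+ d)%:E by apply: vol_box; rewrite subr_ge0 ltW.
pose K := (Num.truncn ((d.+1%:R * L) ^+ d * unit_ball_vol d)).+1.
have SK k : (K <= k)%N -> Zhat S k = 0%E.
  move=> Kk; apply: Zhat_cell_eq0 => //.
  by apply: (@lt_le_trans _ _ K%:R); [exact: truncnS_gt|rewrite ler_nat].
have Vhigh : (alpha + a) / 2 * L ^+ d <= a * (L - gap d) ^+ d.
  have -> : L - gap d = L * (1 - gap d / L) by field; rewrite gt_eqF.
  rewrite exprMn [leRHS](_ : _ = a * (1 - gap d / L) ^+ d * L ^+ d); last by ring.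
  rewrite ler_wpM2r ?(ltW X0)// (le_trans _ (ler_wpM2l (ltW a0) hN))//.
  by rewrite le_eqVlt; apply/orP; left; apply/eqP; field; rewrite gt_eqF.
have aX : 1 < (a - alpha) / 2 * L ^+ d.
  by apply: (lt_le_trans hN2); rewrite ler_wpM2l// divr_ge0// subr_ge0 ltW.
have alX : 0 < alpha * L ^+ d by rewrite mulr_gt0.
have aV1 : 1 <= a * (L - gap d) ^+ d by lra.
have [k [kK kV zk]] := zhat_heavy d0 (bounded_region_cube _ _) VS lam0 y0 SK aV1.
rewrite -/a in kV; rewrite -/(zcell d L k) in zk.
have K0 : 0 < K%:R :> R by rewrite ltr0n.
have kal : alpha * L ^+ d < k%:R by lra.
have k0 : 0 < k%:R :> R by apply: lt_trans kal.
have lamk : 0 < lam ^+ k by rewrite exprn_gt0.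
have zk0 : 0 < zcell d L k.
  by rewrite -(pmulr_rgt0 _ lamk); apply: lt_le_trans zk; rewrite invr_gt0 exprn_gt0.
exists L, k; split => //.
have lnz : - (2 * ln K%:R) <= k%:R * ln lam + ln (zcell d L k).
  rewrite [k%:R * _]mulr_natl -lnXn// -lnM ?posrE// [2 * _]mulr_natl -lnXn// -lnV ?posrE ?exprn_gt0//.
  by rewrite ler_ln ?posrE ?mulr_gt0// invr_gt0 exprn_gt0.
have KX : K%:R <= c * L ^+ d.
  rewrite /K -natr1 /c mulrDl mul1r; apply: lerD; last exact: le_trans LX.
  rewrite mulrAC -exprMn truncn_le mulr_ge0 ?exprn_ge0 ?mulr_ge0 ?(ltW L0)//.
  by rewrite ltW ?unit_ball_vol_gt0.
have lnK : 2 * ln K%:R <= eps * k%:R.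
  have cX : 0 < c * L ^+ d by rewrite mulr_gt0.
  apply: (@le_trans _ _ (4 * Num.sqrt (c * L ^+ d))).
    apply: (@le_trans _ _ (2 * ln (c * L ^+ d))).
      by rewrite ler_wpM2l// ler_ln ?posrE.
    by rewrite (_ : 4 = 2 * 2 :> R) -?mulrA ?ler_wpM2l// ?ln_le_sqrt//; ring.
  apply: (@le_trans _ _ (eps * (alpha * L ^+ d))); last first.
    by rewrite ler_wpM2l ?(ltW eps0)// ltW.
  have ea0 : 0 < eps * (alpha * L ^+ d) by rewrite mulr_gt0.
  rewrite -(@ler_pXn2r _ 2)//= ?nnegrE ?(ltW ea0) ?mulr_ge0 ?sqrtr_ge0//.
  rewrite exprMn sqr_sqrtr ?(ltW cX)// mulrA [leRHS]exprMn.
  rewrite [leRHS](_ : _ = (eps * alpha) ^+ 2 * L ^+ d * L ^+ d); last by ring.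
  rewrite mulrA ler_wpM2r ?(ltW X0)//.
  rewrite (_ : 4 ^+ 2 * c = 16 * c); last by ring.
  apply: (le_trans hN3); rewrite ler_wpM2l//.
  by rewrite exprn_ge0// mulr_ge0// ltW.
rewrite ler_pdivlMr// mulrBl mulNr; lra.
Unshelve. all: by end_near. Qed.

Lemma cvg_unit_minus_div (D : R) : (1 - D / s) ^+ d @[s --> +oo] --> (1 : R).
Proof.
have h : 1 - D / s @[s --> +oo] --> (1 : R).
  rewrite -[X in _ --> X]subr0; apply: cvgB; first exact: cvg_cst.
  rewrite -[X in _ --> X](mulr0 D); apply: cvgM; first exact: cvg_cst.
  apply/gtr0_cvgV0; last exact: cvg_id.
  exact: nbhs_pinfty_gt.
have := cvg_comp _ _ h (@exprn_continuous R d 1); rewrite expr1n; exact.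
Qed.

(** * Periodic packings *)

Section periodic_packing.
Variables (alpha L : R) (k : nat) (cfg : seq (Rn d)).
Hypotheses (L0 : 0 < L) (alpha0 : 0 < alpha) (cfgk : size cfg = k)
  (cfg_far : pairwise (@hfar R d) cfg)
  (cfg_core : forall c, c \in cfg -> cube (fun=> 0) (L - gap d) c).

Let shift (j : d.-tuple int) (c : Rn d) : Rn d :=
  affine_map 1 [tuple (tnth j i)%:~R * L | i < d] c.

Definition periodic_packing : set (Rn d) :=
  [set x | exists j c, c \in cfg /\ x = shift j c].

Let shift_core j c : c \in cfg -> core L j (shift j c).
Proof.
move=> /cfg_core h i; have /= := h i.
rewrite /core /cube/= !tnth_mktuple mul1r; set x := _ * L => /andP[h1 h2].
by apply/andP; split; lra.
Qed.

Let cfg_hfar c c' : c \in cfg -> c' \in cfg -> c != c' -> hfar c c'.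
Proof.
move=> cin c'in cc'.
have px := pairwiseP (origin d) cfg_far.
have ic : (index c cfg < size cfg)%N by rewrite index_mem.
have ic' : (index c' cfg < size cfg)%N by rewrite index_mem.
have [h|h|h] := ltngtP (index c cfg) (index c' cfg).
- by have := px _ _ ic ic' h; rewrite !nth_index.
- by have := px _ _ ic' ic h; rewrite !nth_index// hfar_sym.
- by move: cc'; rewrite -(nth_index (origin d) cin) h nth_index// eqxx.
Qed.

Let shift_hfar j j' c c' : c \in cfg -> c' \in cfg -> (j, c) != (j', c') ->
  hfar (shift j c) (shift j' c').
Proof.
move=> cin c'in ne; have [jj'|jj'] := eqVneq j j'; last first.
  exact: (core_separated d0 L0 jj' (shift_core j cin) (shift_core j' c'in)).
rewrite -jj' /hfar eucl_dist_affine// mul1r; apply: cfg_hfar => //.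
by apply: contra ne => /eqP ->; rewrite jj'.
Qed.

Lemma periodic_packing_hfar x y : periodic_packing x -> periodic_packing y ->
  x != y -> hfar x y.
Proof.
move=> [j [c [cin ->]]] [j' [c' [c'in ->]]] ne; apply: shift_hfar => //.
by apply: contra ne => /eqP[-> ->].
Qed.

Lemma sphere_packing_periodic : sphere_packing (rad d) periodic_packing.
Proof.
split; first exact: rad_gt0.
move=> x y Cx Cy [z [/= xz yz]]; apply/eqP/negPn/negP => /(periodic_packing_hfar Cx Cy).
rewrite /hfar ltNge => /negP; apply; apply: (le_trans (eucl_dist_triangle x z y)).
move: xz yz; rewrite /eucl_oball/= [eucl_dist y z]eucl_distC; lra.
Qed.

Lemma measurable_covered : measurable (covered (rad d) periodic_packing).
Proof.
rewrite (_ : covered _ _ = \bigcup_(j in [set: d.-tuple int])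
    \big[setU/set0]_(c <- cfg) eucl_cball (shift j c) (rad d)).
  apply: countable_bigcupT_measurable; first exact: countableP.
  by move=> j; apply: bigsetU_measurable => c _; exact: measurable_eucl_cball.
apply/seteqP; split=> x.
  by move=> [_ [j [c [cin ->]]] xc]; exists j => //; rewrite -bigcup_seq; exists c.
move=> [j _]; rewrite -bigcup_seq => -[c cin xc].
by exists (shift j c) => //; exists j, c.
Qed.

(** Each cell inside the ball of radius [s - rad d] contributes [k] disjoint spheres of volume 1,
    and these stay inside the ball of radius [s]. *)
Lemma periodic_packing_ratio (s : R) : d%:R * L + rad d < s ->
  (((k%:R / L ^+ d) * (1 - (d%:R * L + rad d) / s) ^+ d)%:E <=
   vol d (covered (rad d) periodic_packing `&` eucl_cball (origin d) s) /
   vol d (eucl_cball (origin d) s))%E.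
Proof.
move=> hs; have r0 := @rad_gt0 R d d0.
have dL0 : 0 <= d%:R * L by rewrite mulr_ge0// ltW.
have s0 : 0 < s by apply: le_lt_trans hs; rewrite addr_ge0// ltW.
have w0 := @unit_ball_vol_gt0 R d.
have X0 : 0 < L ^+ d by rewrite exprn_gt0.
have sr : d%:R * L < s - rad d by lra.
have [js [ujs jsB hjs]] := cells_in_ball L0 sr.
pose P := [seq shift j c | j <- js, c <- cfg].
have ucfg : uniq cfg.
  move: cfg_far; rewrite uniq_pairwise; apply: sub_pairwise => x y.
  rewrite /hfar; apply: contraTneq => ->; rewrite eucl_distxx -leNgt mulr_ge0// ltW//.
have uP : uniq P.
  apply: allpairs_uniq => // -[j c] [j' c'] /allpairsP[[j1 c1] /= [_ c1in [-> ->]]].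
  move=> /allpairsP[[j2 c2] /= [_ c2in [-> ->]]] e.
  apply/eqP/negPn/negP => /(shift_hfar c1in c2in).
  by rewrite e /hfar eucl_distxx ltNge mulr_ge0// ltW.
have PC x : x \in P -> periodic_packing x.
  by move=> /allpairsP[[j c] /= [_ cin ->]]; exists j, c.
have PB x : x \in P -> eucl_cball (origin d) (s - rad d) x.
  move=> /allpairsP[[j c] /= [jjs cin ->]]; apply: (jsB j) => //.
  by apply: core_sub_cell => //; exact: shift_core.
have farP : pairwise (@hfar R d) P.
  have : pairwise [rel x y | x != y] P by rewrite -uniq_pairwise.
  move/(pairwiseP (origin d)) => h; apply/(pairwiseP (origin d)) => i j iP jP ij.
  by apply: periodic_packing_hfar; [exact/PC/mem_nth..|exact: h].
have sizeP : size P = (size js * k)%N by rewrite size_allpairs cfgk.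
have lower : ((size P)%:R%:E <=
    vol d (covered (rad d) periodic_packing `&` eucl_cball (origin d) s))%E.
  rewrite -(vol_disjoint_balls d0 farP); apply: le_measure; rewrite ?inE.
  - by apply: bigsetU_measurable => c _; exact: measurable_eucl_cball.
  - by apply: measurableI; [exact: measurable_covered|exact: measurable_eucl_cball].
  move=> x; rewrite -bigcup_seq => -[c /= cP xc]; split; first by exists c => //; exact: PC.
  apply: (le_trans (eucl_dist_triangle _ c _)).
  by have := PB _ cP; move: xc; rewrite /eucl_cball/=; lra.
rewrite vol_cballE// inver gt_eqF ?mulr_gt0 ?exprn_gt0//.
apply: le_trans (lee_wpmul2r _ lower); last by rewrite lee_fin invr_ge0 mulr_ge0 ?exprn_ge0// ltW.
rewrite -EFinM lee_fin ler_pdivlMr ?mulr_gt0 ?exprn_gt0// sizeP natrM.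
rewrite [leLHS](_ : _ = ((s - rad d - d%:R * L) ^+ d * unit_ball_vol d) * (k%:R / L ^+ d)).
  rewrite [leRHS](_ : _ = ((size js)%:R * L ^+ d) * (k%:R / L ^+ d)).
    by rewrite ler_wpM2r// divr_ge0// ltW.
  by field; rewrite gt_eqF.
rewrite [s - _ - _](_ : _ = s * (1 - (d%:R * L + rad d) / s)); last by field; rewrite gt_eqF.
by rewrite exprMn; ring.
Qed.

Lemma packing_density_periodic : alpha * L ^+ d < k%:R ->
  (alpha%:E < packing_density (rad d) periodic_packing)%E.
Proof.
move=> ak; have X0 : 0 < L ^+ d by rewrite exprn_gt0.
(* A value strictly between [alpha] and [k / L ^+ d]. The covered ratio is at least [b] for all
   large [s], and every set of the filter in the upper limit contains such an [s]. *)
pose b := (alpha + k%:R / L ^+ d) / 2.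
have kap : alpha < k%:R / L ^+ d by rewrite ltr_pdivlMr.
have kap0 : 0 < k%:R / L ^+ d by apply: lt_trans kap.
apply: (@lt_le_trans _ _ b%:E); first by rewrite lte_fin /b; lra.
rewrite /packing_density limf_esupE; apply: le_ereal_inf_tmp => _ [V FV <-].
have : \forall s \near +oo, b <= k%:R / L ^+ d * (1 - (d%:R * L + rad d) / s) ^+ d.
  near=> s; rewrite -ler_pdivrMl// mulrC; near: s.
  apply: (@cvgr_ge _ _ _ _ _ 1); first exact: cvg_unit_minus_div.
  by rewrite ltr_pdivrMr// mul1r /b; lra.
move=> hb; have hs : \forall s \near +oo, d%:R * L + rad d < s.
  by apply: nbhs_pinfty_gt; exact: num_real.
have [s [[Vs bs] ls]] := filter_ex (filterI (filterI FV hb) hs).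
apply: le_ereal_sup_tmp; exists (vol d (covered (rad d) periodic_packing `&`
  eucl_cball (origin d) s) / vol d (eucl_cball (origin d) s))%E; first by exists s.
by apply: le_trans (periodic_packing_ratio ls); rewrite lee_fin.
Unshelve. all: by end_near. Qed.

End periodic_packing.

Lemma dense_cell_lt_theta (alpha L : R) k : 0 < alpha -> dense_cell d alpha L k ->
  (alpha%:E < theta d)%E.
Proof.
move=> alpha0 [gL ak zk]; have L0 : 0 < L by apply: lt_trans gL.
have [||cfg [szc farc corec]] := @zhat_gt0_config R d (cube (fun=> 0) (L - gap d)) k.
- exact: measurable_cube.
- by apply/eqP => z0; move: zk; rewrite /zcell /zhat z0 ltxx.
apply: lt_le_trans (packing_density_periodic L0 alpha0 szc farc corec ak) _.
apply: ereal_sup_ubound; exists (rad d, periodic_packing L cfg) => //=.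
exact: (sphere_packing_periodic L0 farc corec).
Qed.

End dense_cells.

(** * Choice of the parameters *)

Section parameters.
Context {R : realType}.

Definition log_ratio : R := ln (2 / Num.sqrt 3).

Definition fugacity d : R := (Num.sqrt 3 ^+ d * d%:R)^-1.

(** The second argument solves [exp y = (2 / sqrt 3)^d / d^2], so that [exp y / lam = 2^d / d] is
    negligible against [2^d]. The maximum keeps [y] nonnegative in small dimensions. *)
Definition tangent_point d : R := Num.max 0 (log_ratio * d%:R - 2 * ln d%:R).

Definition occupancy d : R := (1 + tangent_point d) /
  (expR (tangent_point d) / fugacity d +
   expR (2 * fugacity d * Num.sqrt 3 ^+ d) * 2 ^+ d).

(** The factor makes the inequality with [occupancy d] strict and tends to 1; [d + 1] keeps it
    positive at [d = 1]. *)
Definition alpha_ d : R := occupancy d * (1 - d.+1%:R^-1).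

Definition err_density d : R := alpha_ d / (log_ratio * d%:R / 2 ^+ d) - 1.

(** Chosen so that [(1 + err_entropy d) log_ratio d] is exactly [ln lam - ln alpha + 1], the
    opposite of the lower bound on the entropy. *)
Definition err_entropy d : R :=
  (ln (fugacity d) - ln (alpha_ d) + 1) / (log_ratio * d%:R) - 1.

Let s30 : 0 < Num.sqrt 3 :> R.
Proof. by rewrite sqrtr_gt0. Qed.

Lemma log_ratio_gt0 : 0 < log_ratio.
Proof.
rewrite ln_gt0// ltr_pdivlMr// mul1r -(@ltr_pXn2r _ 2)//= ?nnegrE ?ltW//.
by rewrite sqr_sqrtr//; lra.
Qed.

Let c0 := log_ratio_gt0.

Lemma fugacity_gt0 d : (0 < d)%N -> 0 < fugacity d.
Proof. by move=> d0; rewrite invr_gt0 mulr_gt0 ?exprn_gt0 ?ltr0n. Qed.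

Lemma tangent_point_ge0 d : 0 <= tangent_point d.
Proof. by rewrite le_max lexx. Qed.

Lemma occupancy_gt0 d : (0 < d)%N -> 0 < occupancy d.
Proof.
move=> d0; have l0 := fugacity_gt0 d0; rewrite divr_gt0//.
  by rewrite ltr_pwDl// tangent_point_ge0.
by rewrite addr_gt0 ?divr_gt0 ?mulr_gt0 ?expR_gt0 ?exprn_gt0.
Qed.

Lemma alpha_gt0 d : (0 < d)%N -> 0 < alpha_ d.
Proof.
move=> d0; rewrite mulr_gt0 ?occupancy_gt0// subr_gt0 invf_lt1 ?ltr0n//.
by rewrite ltr1n.
Qed.

Lemma alpha_lt_occupancy d : (0 < d)%N -> alpha_ d < occupancy d.
Proof. by move=> d0; rewrite gtr_pMr ?occupancy_gt0// gtrBl invr_gt0. Qed.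

Lemma alphaE d : (0 < d)%N ->
  alpha_ d = (1 + err_density d) * (log_ratio * d%:R / 2 ^+ d).
Proof.
move=> d0; rewrite /err_density addrC subrK divfK//.
by rewrite gt_eqF// divr_gt0 ?mulr_gt0 ?exprn_gt0 ?ltr0n.
Qed.

Lemma cvg_invSn0 : (n.+1%:R^-1 : R) @[n --> \oo] --> (0 : R).
Proof. exact: (@cvg_harmonic R). Qed.

Lemma cvg_tangent_ratio :
  (1 + (log_ratio * d%:R - 2 * ln d%:R)) / (log_ratio * d%:R) @[d --> \oo] --> (1 : R).
Proof.
have h : log_ratio^-1 * d%:R^-1 + (1 - 2 / log_ratio * (ln d%:R / d%:R))
    @[d --> \oo] --> (log_ratio^-1 * 0 + (1 - 2 / log_ratio * 0) : R).
  apply: cvgD; first by apply: cvgM; [exact: cvg_cst|exact: cvg_invn0].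
  apply: cvgB; first exact: cvg_cst.
  by apply: cvgM; [exact: cvg_cst|exact: cvg_lnn_divn0].
rewrite !mulr0 subr0 add0r in h; apply: cvg_trans h; apply: near_eq_cvg.
near=> d; have d0 : 0 < d%:R :> R by rewrite ltr0n; near: d; exact: nbhs_infty_gt.
by field; rewrite !gt_eqF.
Unshelve. all: by end_near. Qed.

Lemma near_tangent_point : \forall d \near \oo,
  tangent_point d = log_ratio * d%:R - 2 * ln d%:R.
Proof.
near=> d; have d0 : 0 < d%:R :> R by rewrite ltr0n; near: d; exact: nbhs_infty_gt.
apply/max_idPr; rewrite subr_ge0.
have h : ln d%:R / d%:R <= log_ratio / 2.
  by near: d; apply: (@cvgr_le _ _ _ _ _ 0); [exact: cvg_lnn_divn0|rewrite divr_gt0].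
by move: h; rewrite ler_pdivrMr//; lra.
Unshelve. all: by end_near. Qed.

Lemma cvg_err_density : err_density d @[d --> \oo] --> (0 : R).
Proof.
(* For large [d], the denominator of [occupancy d] divided by [2^d]. *)
pose w d : R := d%:R^-1 + expR (2 * d%:R^-1).
have w_lim : w d @[d --> \oo] --> (1 : R).
  have -> : 1 = 0 + expR (2 * 0) :> R by rewrite mulr0 expR0 add0r.
  apply: cvgD; first exact: cvg_invn0.
  apply: continuous_cvg; first exact: continuous_expR.
  by apply: cvgM; [exact: cvg_cst|exact: cvg_invn0].
have h : (1 - d.+1%:R^-1) * ((1 + (log_ratio * d%:R - 2 * ln d%:R)) /
    (log_ratio * d%:R)) * (w d)^-1 - 1 @[d --> \oo] --> ((1 - 0) * 1 * 1^-1 - 1 : R).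
  apply: cvgB; last exact: cvg_cst.
  apply: cvgM; last by apply: cvgV => //; exact: oner_neq0.
  apply: cvgM; last exact: cvg_tangent_ratio.
  by apply: cvgB; [exact: cvg_cst|exact: cvg_invSn0].
rewrite subr0 !mul1r invr1 subrr in h; apply: cvg_trans h; apply: near_eq_cvg.
near=> d; have dN : (0 < d)%N by near: d; exact: nbhs_infty_gt.
have d0 : 0 < d%:R :> R by rewrite ltr0n.
have tE : tangent_point d = log_ratio * d%:R - 2 * ln d%:R.
  by near: d; exact: near_tangent_point.
rewrite /err_density /alpha_ /occupancy tE; congr (_ - 1).
have s3d : 0 < Num.sqrt 3 ^+ d :> R by rewrite exprn_gt0.
have two : 0 < 2 ^+ d :> R by rewrite exprn_gt0.
have w0 : 0 < w d by rewrite addr_gt0 ?expR_gt0// invr_gt0.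
have -> : expR (log_ratio * d%:R - 2 * ln d%:R) / fugacity d +
    expR (2 * fugacity d * Num.sqrt 3 ^+ d) * 2 ^+ d = w d * 2 ^+ d.
  have -> : 2 * fugacity d * Num.sqrt 3 ^+ d = 2 * d%:R^-1.
    by rewrite /fugacity; field; rewrite !gt_eqF.
  rewrite /w [in RHS]mulrDl; congr (_ + _).
  rewrite expRB expRM_natr /log_ratio lnK ?posrE ?divr_gt0//.
  rewrite (expRM_natl 2) lnK ?posrE// /fugacity exprMn exprVn.
  by field; rewrite !gt_eqF.
by field; rewrite !gt_eqF ?addr_gt0 ?invr_gt0//.
Unshelve. all: by end_near. Qed.

Lemma cvg_err_entropy : err_entropy d @[d --> \oo] --> (0 : R).
Proof.
have h : - (2 / log_ratio) * (ln d%:R / d%:R) +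
    (1 - ln log_ratio - ln (1 + err_density d)) / log_ratio * d%:R^-1
    @[d --> \oo] --> (- (2 / log_ratio) * 0 +
    (1 - ln log_ratio - ln (1 + 0)) / log_ratio * 0 : R).
  apply: cvgD; first by apply: cvgM; [exact: cvg_cst|exact: cvg_lnn_divn0].
  apply: cvgM; last exact: cvg_invn0.
  apply: cvgM; last exact: cvg_cst.
  apply: cvgB; first exact: cvg_cst.
  apply: continuous_cvg; first by apply: continuous_ln; rewrite addr0.
  by apply: cvgD; [exact: cvg_cst|exact: cvg_err_density].
rewrite !mulr0 addr0 in h; apply: cvg_trans h; apply: near_eq_cvg.
near=> d; have dN : (0 < d)%N by near: d; exact: nbhs_infty_gt.
have d0 : 0 < d%:R :> R by rewrite ltr0n.
have two : 0 < 2 ^+ d :> R by rewrite exprn_gt0.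
have s3d : 0 < Num.sqrt 3 ^+ d :> R by rewrite exprn_gt0.
have base : 0 < log_ratio * d%:R / 2 ^+ d by rewrite divr_gt0 ?mulr_gt0.
have e1 : 0 < 1 + err_density d.
  by have := alpha_gt0 dN; rewrite alphaE// pmulr_lgt0.
have lnf : ln (fugacity d) = - (d%:R * ln (Num.sqrt 3) + ln d%:R).
  by rewrite lnV ?posrE ?mulr_gt0// lnM ?posrE// lnXn// [in RHS]mulr_natl.
have lna : ln (alpha_ d) = ln (1 + err_density d) + (ln log_ratio + ln d%:R - d%:R * ln 2).
  rewrite {1}alphaE// lnM ?posrE// ln_div ?posrE ?mulr_gt0//.
  by rewrite (@lnM _ log_ratio) ?posrE// lnXn// [in RHS]mulr_natl.
have cE : log_ratio = ln 2 - ln (Num.sqrt 3) by rewrite /log_ratio ln_div ?posrE.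
(* The terms linear in [d] combine to [d ln 2 - d ln (sqrt 3) = log_ratio d]; the rest is
   logarithmic in [d] or bounded. *)
have num : ln (fugacity d) - ln (alpha_ d) + 1 = log_ratio * d%:R - 2 * ln d%:R +
    (1 - ln log_ratio - ln (1 + err_density d)).
  rewrite lnf lna [X in X * d%:R]cE; ring.
by rewrite /err_entropy num; field; rewrite !gt_eqF.
Unshelve. all: by end_near. Qed.

Lemma sup_cell_entropies_ge d : (0 < d)%N ->
  - ln (fugacity d) <= sup (cell_entropies d (alpha_ d)).
Proof.
move=> d0; have a0 := alpha_gt0 d0; apply/ler_addgt0Pr => e e0.
have [L [k [dc h]]] := exists_dense_cell d0 (fugacity_gt0 d0) (tangent_point_ge0 d) a0 e0
  (alpha_lt_occupancy d0).
rewrite -lerBlDr; apply: (le_trans h); apply: sup_upper_bound; last by exists L, k.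
split; first by exists (ln (zcell d L k) / k%:R), L, k.
by exists (1 - ln (alpha_ d)) => _ [L' [k' [dc' ->]]]; exact: dense_cell_ub.
Qed.

End parameters.

Theorem theorem5 (R : realType) :
  exists (alpha eps1 eps2 : nat -> R),
    [/\ eps1 @ \oo --> (0 : R),
        eps2 @ \oo --> (0 : R) &
        forall d : nat, (0 < d)%N ->
          [/\ 0 < alpha d,
              ((alpha d)%:E < theta d)%E,
              alpha d = (1 + eps1 d) * (ln (2 / Num.sqrt 3) * d%:R / 2 ^+ d),
              cvgn (entropy_seq d (alpha d)) &
              ((- ((1 + eps2 d) * (ln (2 / Num.sqrt 3) * d%:R)))%:E
                 <= entropy_density d (alpha d))%E]].
Proof.
exists alpha_, err_density, err_entropy; split.
- exact: cvg_err_density.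
- exact: cvg_err_entropy.
move=> d d0; have a0 := @alpha_gt0 R d d0.
(* Any precision does here: this cell witnesses convergence and [alpha < theta], while the entropy
   bound comes from [sup_cell_entropies_ge]. *)
have [L [k [dc _]]] := exists_dense_cell d0 (fugacity_gt0 d0) (tangent_point_ge0 d)
  a0 ltr01 (alpha_lt_occupancy d0).
have cv := cvg_entropy_seq d0 a0 dc.
split=> //.
- exact: dense_cell_lt_theta dc.
- exact: alphaE.
- by apply/cvg_ex; eexists; exact: cv.
have -> : entropy_density d (alpha_ d) =
    (sup (cell_entropies d (alpha_ d)) + (ln (alpha_ d) - 1))%:E :> \bar R.
  exact/cvg_lim/cv.
rewrite lee_fin -/(@log_ratio R) /err_entropy addrC subrK divfK; last first.
  by rewrite gt_eqF// mulr_gt0 ?log_ratio_gt0 ?ltr0n.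
have := @sup_cell_entropies_ge R d d0; lra.
Qed.
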